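(* Let $\kappa,\rho\in\mathcal{P}_b^r$. The set ${}_\kappa B_\rho=\{b_{w,\underline l,\underline a}\mid w\in{}_\kappa S_\rho,\ \underline l\in\{0,1\}^b,\ \underline a\in\mathbb{N}^b\}$ is a basis of $1_\kappa T_b^{\lambda,\underline N}1_\rho$ as a $\mathbb{Z}\times\mathbb{Z}^2$-graded $\Bbbk$-module.
   Context: $\Bbbk$ is a commutative unital ring, $\underline N=(N_1,\dots,N_r)\in\mathbb N^r$. The dg-enhanced KLRW algebra $T_b^{\lambda,\underline N}$ is the $\Bbbk$-algebra spanned by braid-like diagrams read bottom to top (product $D\cdot D'$ = $D$ stacked on top of $D'$, zero if colours/labels do not match): a leftmost vertical blue strand labelled $\lambda$; $r$ red strands labelled $N_1,\dots,N_r$ left to right, never crossing each other or the blue strand; $b$ black strands, which may cross black and red strands, carry dots, and, when they are the first strand right of the blue strand, be nailed (touch the blue strand at a point and go back). Dots, crossings: homological degree $0$; nails: homological degree $1$. Diagrams are up to graded braid-like planar isotopy (no critical points created; exchanging heights of far-apart generators of homological degrees $a,c$ gives $(-1)^{ac}$). With $x_j$ a dot on the $j$-th strand right of blue, $\tau_j$ a crossing of strands $j,j+1$, $\omega$ a nail on the first strand, top factor written on the left, the relations are: (i) on black strands $\tau_j^2=0$, $\tau_j\tau_{j+1}\tau_j=\tau_{j+1}\tau_j\tau_{j+1}$, $\tau_jx_j-x_{j+1}\tau_j=1=x_j\tau_j-\tau_jx_{j+1}$; (ii) dots slide through black/red crossings; (iii) a black strand crossing a red strand labelled $N_i$ twice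 equals $N_i$ dots on the black strand; (iv) the braid relation holds for two black and one red strand unless the red strand is the middle one, in which case $\tau_j\tau_{j+1}\tau_j=\tau_{j+1}\tau_j\tau_{j+1}+\sum_{k+\ell=N_i-1}x_j^kx_{j+2}^\ell$; (v) $\omega x_1=x_1\omega$, $\omega^2=0$, $\tau_1\omega\tau_1\omega=-\omega\tau_1\omega\tau_1$. Gradings: a black/black crossing has $(q,\lambda)$-degree $(-2,0)$, a dot $(2,0)$, a black/red crossing with red label $N_i$ degree $(N_i,0)$, a nail $(0,2)$. $\mathcal{P}_b^r$ is the set of $(b_0,\dots,b_r)\in\mathbb N^{r+1}$ with $\sum b_i=b$; $1_\rho$ for $\rho\in\mathcal P_b^r$ is the idempotent with all strands vertical, $b_0$ black strands between blue and the first red strand and $b_i$ black strands right of the $i$-th red strand. ${}_\kappa S_\rho$ is the set of permutations viewed as diagrams with the blue strand on the left, strands ordered at the bottom according to $1_\rho$ and at the top according to $1_\kappa$, with no red/red crossings in any reduced expression. A reduced expression $\sigma_{i_1}\cdots\sigma_{i_k}$ is left-adjusted if $i_1+\cdots+i_k$ is minimal (diagrammatically: every strand pulled as far left as possible). For $w\in{}_\kappa S_\rho$, $\underline l\in\{0,1\}^b$, $\underline a\in\mathbb N^b$, the element $b_{w,\underline l,\underline a}\in1_\kappa T_b^{\lambda,\underline N}1_\rho$ is obtained by: choosing a left-adjusted reduced expression of $w$ as a diagram; for each $i$ with $l_i=1$, nailing the $i$-th black strand (counting at the top from the left) on the blue strand by pulling it from its leftmost position; then adding $a_i$ dots on the $i$-th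 black strand at the top. *)

(* Defs.v *)
(* Formalization of the dg-enhanced KLRW algebra
   T_b^{lambda,N} as the free k-module on (valid) braid-like diagram words
   modulo the two-sided ideal generated by the defining relations, and of the
   candidate basis {}_kappa B_rho.  Conventions:
   - positions right of the blue strand are 0-based (x_{j+1}, tau_{j+1} of
     the paper are [Dot j], [Cr j] here; omega is [Nail]);
   - a diagram word is (bottom state, list of generators read BOTTOM TO TOP);
   - a strand is [None] (black) or [Some i] (red strand labelled N_{i+1},
     i.e. [nth 0 N i]). *)
From HB Require Import structures.
From mathcomp Require Import all_boot all_order all_algebra.

Set Implicit Arguments.
Unset Strict Implicit.
Unset Printing Implicit Defensive.

Import GRing.Theory.

Definition strand := option nat.   (* None = black, Some i = i-th red strand *)

Inductive gen := Dot of nat | Cr of nat | Nail.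

Definition gen_enc (g : gen) : (nat + nat) + unit :=
  match g with Dot j => inl (inl j) | Cr j => inl (inr j) | Nail => inr tt end.
Definition gen_dec (x : (nat + nat) + unit) : gen :=
  match x with inl (inl j) => Dot j | inl (inr j) => Cr j | inr _ => Nail end.
Lemma gen_encK : cancel gen_enc gen_dec. Proof. by case. Qed.
HB.instance Definition _ := Equality.copy gen (can_type gen_encK).

(* a diagram word: bottom state and generators applied from bottom to top *)
Definition word := (seq strand * seq gen)%type.

Definition isBlk (s : seq strand) (j : nat) : bool :=
  (j < size s) && (nth None s j == None).
Definition isRed (s : seq strand) (j i : nat) : bool := nth None s j == Some i.

Definition swapS (j : nat) (s : seq strand) : seq strand :=
  take j s ++ [:: nth None s j.+1; nth None s j] ++ drop j.+2 s.

Definition step (s : seq strand) (g : gen) : option (seq strand) :=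
  match g with
  | Dot j => if isBlk s j then Some s else None
  | Cr j => if (j.+1 < size s) && (isBlk s j || isBlk s j.+1)
            then Some (swapS j s) else None
  | Nail => if isBlk s 0 then Some s else None
  end.

Fixpoint run (s : seq strand) (gs : seq gen) : option (seq strand) :=
  match gs with
  | [::] => Some s
  | g :: gs' => if step s g is Some s' then run s' gs' else None
  end.

Definition top (D : word) : option (seq strand) := run D.1 D.2.
Definition valid (D : word) : bool := top D != None.

(* D on top of D' (zero, i.e. None, if the states do not match) *)
Definition wmul (D D' : word) : option word :=
  if top D' == Some D.1 then Some (D'.1, D'.2 ++ D.2) else None.

Definition supp (g : gen) : seq nat :=
  match g with Dot j => [:: j] | Cr j => [:: j; j.+1] | Nail => [:: 0] end.

Section Algebra.
Local Open Scope ring_scope.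
Variable R : comPzRingType.
Variable N : seq nat.

(* formal k-linear combinations of words (elements of the free k-module) *)
Definition fcoef (f : seq (R * word)) (D : word) : R :=
  \sum_(x <- f | x.2 == D) x.1.
Definition fscale (c : R) (f : seq (R * word)) : seq (R * word) :=
  [seq (c * x.1, x.2) | x <- f].
Definition fmul (f g : seq (R * word)) : seq (R * word) :=
  flatten [seq flatten [seq (if wmul x.2 y.2 is Some D then [:: (x.1 * y.1, D)]
                             else [::]) | y <- g] | x <- f].

Definition lab (i : nat) : nat := nth 0%N N i.

(* the defining local relations, written as elements that are set to 0 *)
Inductive klrw_rel : seq (R * word) -> Prop :=
| r_ccBB s j : isBlk s j -> isBlk s j.+1 ->
    klrw_rel [:: (1, (s, [:: Cr j; Cr j]))]
| r_nh1 s j : isBlk s j -> isBlk s j.+1 ->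
    klrw_rel [:: (1, (s, [:: Dot j; Cr j])); (-1, (s, [:: Cr j; Dot j.+1]));
                 (-1, (s, [::]))]
| r_nh2 s j : isBlk s j -> isBlk s j.+1 ->
    klrw_rel [:: (1, (s, [:: Cr j; Dot j])); (-1, (s, [:: Dot j.+1; Cr j]));
                 (-1, (s, [::]))]
| r_braidBBB s j : isBlk s j -> isBlk s j.+1 -> isBlk s j.+2 ->
    klrw_rel [:: (1, (s, [:: Cr j; Cr j.+1; Cr j]));
                 (-1, (s, [:: Cr j.+1; Cr j; Cr j.+1]))]
| r_dotBR s j i : isBlk s j -> isRed s j.+1 i ->
    klrw_rel [:: (1, (s, [:: Dot j; Cr j])); (-1, (s, [:: Cr j; Dot j.+1]))]
| r_dotRB s j i : isRed s j i -> isBlk s j.+1 ->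
    klrw_rel [:: (1, (s, [:: Dot j.+1; Cr j])); (-1, (s, [:: Cr j; Dot j]))]
| r_ccBR s j i : isBlk s j -> isRed s j.+1 i ->
    klrw_rel [:: (1, (s, [:: Cr j; Cr j])); (-1, (s, nseq (lab i) (Dot j)))]
| r_ccRB s j i : isRed s j i -> isBlk s j.+1 ->
    klrw_rel [:: (1, (s, [:: Cr j; Cr j])); (-1, (s, nseq (lab i) (Dot j.+1)))]
| r_braidRBB s j i : isRed s j i -> isBlk s j.+1 -> isBlk s j.+2 ->
    klrw_rel [:: (1, (s, [:: Cr j; Cr j.+1; Cr j]));
                 (-1, (s, [:: Cr j.+1; Cr j; Cr j.+1]))]
| r_braidBBR s j i : isBlk s j -> isBlk s j.+1 -> isRed s j.+2 i ->
    klrw_rel [:: (1, (s, [:: Cr j; Cr j.+1; Cr j]));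
                 (-1, (s, [:: Cr j.+1; Cr j; Cr j.+1]))]
| r_braidBRB s j i : isBlk s j -> isRed s j.+1 i -> isBlk s j.+2 ->
    klrw_rel ((1, (s, [:: Cr j; Cr j.+1; Cr j]))
              :: (-1, (s, [:: Cr j.+1; Cr j; Cr j.+1]))
              :: [seq (-1, (s, nseq k (Dot j) ++ nseq ((lab i).-1 - k) (Dot j.+2)))
                 | k <- iota 0 (lab i)])
| r_nailDot s : isBlk s 0 ->
    klrw_rel [:: (1, (s, [:: Dot 0; Nail])); (-1, (s, [:: Nail; Dot 0]))]
| r_nail2 s : isBlk s 0 -> klrw_rel [:: (1, (s, [:: Nail; Nail]))]
| r_nailCr s : isBlk s 0 -> isBlk s 1 ->
    klrw_rel [:: (1, (s, [:: Nail; Cr 0; Nail; Cr 0]));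
                 (1, (s, [:: Cr 0; Nail; Cr 0; Nail]))]
(* graded braid-like planar isotopy: far-apart generators commute (the sign
   (-1)^{ac} is always +1 here since the only generator of homological
   degree 1, the nail, lives on the first strand, so two nails are never
   far apart) *)
| r_far s g h : ~~ has (fun p => p \in supp h) (supp g) -> valid (s, [:: g; h]) ->
    klrw_rel [:: (1, (s, [:: g; h])); (-1, (s, [:: h; g]))].

Inductive in_ideal : seq (R * word) -> Prop :=
| I_nil : in_ideal [::]
| I_gen u r v : klrw_rel r -> valid u -> valid v ->
    in_ideal (fmul [:: (1, u)] (fmul r [:: (1, v)]))
| I_add f g : in_ideal f -> in_ideal g -> in_ideal (f ++ g)
| I_scale c f : in_ideal f -> in_ideal (fscale c f)
| I_ext f g : fcoef f =1 fcoef g -> in_ideal f -> in_ideal g.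

Definition congT (f g : seq (R * word)) : Prop := in_ideal (f ++ fscale (-1) g).

End Algebra.

Definition in_P (b r : nat) (rho : seq nat) : bool :=
  (size rho == r.+1) && (sumn rho == b).

Definition stateOf (rho : seq nat) : seq strand :=
  nseq (nth 0 rho 0) None ++
  flatten [seq Some i :: nseq (nth 0 rho i.+1) None | i <- iota 0 (size rho).-1].

Definition swapn (j p : nat) : nat :=
  if p == j then j.+1 else if p == j.+1 then j else p.

(* position at the top of the strand starting at bottom position p, for the
   diagram of the crossings cs (listed bottom to top) *)
Definition pos_after (cs : seq nat) (p : nat) : nat :=
  foldl (fun q j => swapn j q) p cs.

(* a permutation w of {0..n-1} is represented by its list of values
   [w 0; ...; w (n-1)], w p = top position of the strand at bottom position p *)
Definition perm_list (n : nat) (cs : seq nat) : seq nat :=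
  [seq pos_after cs p | p <- iota 0 n].

Definition in_S (kap rho : seq nat) (w : seq nat) : bool :=
  let n := size (stateOf rho) in
  perm_eq w (iota 0 n) &&
  all (fun p => nth None (stateOf kap) (nth 0 w p) == nth None (stateOf rho) p)
      (iota 0 n).

(* cs (crossings sigma_{j+1}, listed bottom to top) is an expression of w *)
Definition expr_of (n : nat) (w cs : seq nat) : bool :=
  all (fun j => j.+1 < n) cs && (perm_list n cs == w).
Definition reduced_expr (n : nat) (w cs : seq nat) : Prop :=
  expr_of n w cs /\ forall cs', expr_of n w cs' -> size cs <= size cs'.
Definition left_adjusted (n : nat) (w cs : seq nat) : Prop :=
  reduced_expr n w cs /\ forall cs', reduced_expr n w cs' -> sumn cs <= sumn cs'.

Definition blk_pos (s : seq strand) (i : nat) : nat :=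
  nth 0 [seq p <- iota 0 (size s) | nth None s p == None] i.

Definition hpos (cs : seq nat) (p0 h : nat) : nat := pos_after (take h cs) p0.

Definition bot_of (kap w : seq nat) (i : nat) : nat :=
  index (blk_pos (stateOf kap) i) w.

(* pull the strand at position m to the blue strand, nail it, pull it back *)
Definition theta (m : nat) : seq gen :=
  [seq Cr j | j <- rev (iota 0 m)] ++ Nail :: [seq Cr j | j <- iota 0 m].

(* a nailing plan: a list of pairs (height h, top black index i), each nailed
   strand i listed once, inserted at a height h where the strand is at its
   leftmost position; nails at the same height are performed in plan order
   (from bottom to top) *)
Definition nail_plan_ok (kap w cs : seq nat) (l : seq bool)
    (plan : seq (nat * nat)) : Prop :=
  perm_eq (map snd plan) [seq i <- iota 0 (size l) | nth false l i] /\
  forall x, x \in plan ->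
    x.1 <= size cs /\
    forall h, h <= size cs ->
      hpos cs (bot_of kap w x.2) x.1 <= hpos cs (bot_of kap w x.2) h.

Definition bword (kap rho w cs : seq nat) (plan : seq (nat * nat))
    (a : seq nat) : word :=
  (stateOf rho,
   flatten [seq flatten [seq theta (hpos cs (bot_of kap w x.2) x.1)
                        | x <- plan & x.1 == h]
                ++ [seq Cr j | j <- take 1 (drop h cs)]
           | h <- iota 0 (size cs).+1]
   ++ flatten [seq nseq (nth 0 a i) (Dot (blk_pos (stateOf kap) i))
              | i <- iota 0 (size a)]).

Definition idx := (seq nat * (seq bool * seq nat))%type.
Definition in_B (b : nat) (kap rho : seq nat) (t : idx) : bool :=
  in_S kap rho t.1 && (size t.2.1 == b) && (size t.2.2 == b).

(* Main.v *)
(** A diagram acts on signed configurations: a crossing exchanges two adjacent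
    labels and a nail negates the first one, as in the hyperoctahedral group.
    The type B length of the resulting configuration bounds from below the
    number of crossings and nails, and every relation preserves the
    configuration up to diagrams with fewer crossings and nails.

    Spanning: dots can be pushed to the top and, as in Matsumoto's theorem, a
    diagram without dots is congruent, modulo diagrams with fewer crossings and
    nails, to any reduced diagram with the same configuration, or to zero if it
    is not reduced.  The diagrams b_(w,l,a) supply one reduced diagram for each
    configuration: in a left-adjusted expression every strand makes all its
    moves to the left before any move to the right, so that pulling a strand to
    the blue one from its leftmost position p costs exactly 2p+1 letters.

    Independence: the algebra acts on functions of signed configurations, a
    black crossing as a divided difference and a nail as a signed creation
    operator, the dots acting by elements z_k of a field.  The functionals
    F |-> (b_(w,l,0) F)(c), for a fixed top configuration c, span all
    evaluations at the configurations compatible with both idempotents; these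
    are as many as the pairs (w,l), so the functionals are independent.  The
    substitution z_k = X^(D^k) separates the exponents a.  This gives a basis
    over the integers, whose coordinate functionals give independence over
    every ring. *)

Require Import Defs.
From HB Require Import structures.
From mathcomp Require Import all_boot all_order all_algebra.
From mathcomp Require Import zify ring.
From Stdlib Require ClassicalEpsilon.

Set Implicit Arguments.
Unset Strict Implicit.
Unset Printing Implicit Defensive.

Import Defs Order.TTheory GRing.Theory Num.Theory.

(** Independence rests on spanning: over the integers, spanning puts every compatible evaluation
    into the span of the functionals of the b_(w,l,0), and then the equality of the two counts
    decides. The representation divides by z_x - z_y, so it lives over a field and says nothing
    directly about a ring with zero divisors. But every relation has coefficients 1 and -1, hence an
    integral coordinate functional respects the relations over every ring.

    Left-adjustment enters through a potential. With [nb] the number of smaller labels left of a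
    strand, a reduced expression from the identity to [a] has index sum at least [Bp id - Bp a],
    with equality only if each strand visits position [nb]. The length of a signed configuration is
    the number of inversions of its absolute values plus 2 nb + 1 for each negative entry, which is
    exactly the letter count of b_(w,l,0).

    Strands are labelled by bottom positions for spanning and by top positions for independence. In
    the second labelling the top configuration is the identity, so the dots at the top act by fixed
    scalars. *)

(** * Adjacent transpositions of lists *)

(** The recursion makes the swap the identity on lists that are too short, hence an involution
    without side condition; [swapS_swp] links it to [swapS]. *)
Fixpoint swp T (j : nat) (c : seq T) : seq T :=
  match j, c with
  | 0, x :: y :: c' => y :: x :: c'
  | j'.+1, x :: c' => x :: swp j' c'
  | _, _ => c
  end.

Section Swap.
Variable T : Type.
Implicit Types (c u v : seq T).

Lemma size_swp j c : size (swp j c) = size c.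
Proof. by elim: j c => [|j IH] [|x [|y c]] //=; rewrite IH. Qed.

Lemma swpK j : involutive (@swp T j).
Proof. by elim: j => [|j IH] [|x [|y c]] //=; rewrite IH. Qed.

Lemma map_swp (T' : Type) (f : T -> T') j c : map f (swp j c) = swp j (map f c).
Proof. by elim: j c => [|j IH] [|x [|y c]] //=; rewrite IH. Qed.

Lemma swp_cat u x y v : swp (size u) (u ++ x :: y :: v) = u ++ y :: x :: v.
Proof. by elim: u => [|a u IH] //=; rewrite IH. Qed.

Lemma split_two j c : j.+1 < size c ->
  exists u x y v, c = u ++ x :: y :: v /\ size u = j.
Proof.
elim: j c => [|j IH] [|x [|y c]] //= H; first by exists [::], x, y, c.
have [u [x' [y' [v [E1 E2]]]]] := IH (y :: c) H.
by exists (x :: u), x', y', v; rewrite E1 /= E2.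
Qed.

Lemma swp_oob j c : size c <= j.+1 -> swp j c = c.
Proof.
elim: j c => [|j IH] [|x [|y c]] //= H; first by case: j {IH H}.
by rewrite IH.
Qed.

Lemma swp_comm i j c : j.+1 < i -> swp i (swp j c) = swp j (swp i c).
Proof.
elim: j i c => [|j IH] [|[|i]] [|x [|y c]] //= H.
  by case: j {IH H}.
by congr cons; apply: (IH i.+1).
Qed.

Lemma nth_swp d j c p : j.+1 < size c -> nth d (swp j c) p = nth d c (swapn j p).
Proof.
elim: j c p => [|j IH] [|x [|y c]] //= p H; first by case: p => [|[|p]].
case: p => [|p] //=; rewrite IH // /swapn !eqSS.
by case: (p == j) => //; case: (p == j.+1).
Qed.

End Swap.

Lemma perm_swp (T : eqType) j (c : seq T) : perm_eq (swp j c) c.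
Proof.
case: (ltnP j.+1 (size c)) => H; last by rewrite swp_oob.
have [u [x [y [v [-> <-]]]]] := split_two H.
by rewrite swp_cat perm_cat2l (perm_catCA [:: y] [:: x] v).
Qed.

Lemma swapS_swp j s : j.+1 < size s -> swapS j s = swp j s.
Proof.
move=> H; have [u [x [y [v [-> <-]]]]] := split_two H.
rewrite swp_cat /swapS take_size_cat // drop_cat ltnNge leqW ?leqnSn //=.
rewrite !nth_cat ltnn ltnNge leqnSn /= subnn subSn // subnn.
by rewrite -addn2 addnC addnK /=  drop0.
Qed.

Lemma swapnK j : involutive (swapn j).
Proof. by move=> p; rewrite /swapn; do ![case: eqP => //=]; lia. Qed.

(** * Signed configurations and their length *)

Notation conf := (seq int).

(** For x placed before y, the two terms test the type B roots e_j - e_i and e_i + e_j; the roots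
    e_i are counted in [len] by the negative entries. *)
Definition pcnt (x y : int) : nat := ((y < x)%R + (x + y < 0)%R)%N.

Fixpoint len (c : conf) : nat :=
  if c is x :: c' then ((x < 0)%R + sumn [seq pcnt x y | y <- c'] + len c')%N
  else 0.

Definition negh (c : conf) : conf := if c is x :: c' then (- x)%R :: c' else c.

Definition cact (g : gen) (c : conf) : conf :=
  match g with Dot _ => c | Cr j => swp j c | Nail => negh c end.

Definition crun (gs : seq gen) (c : conf) : conf := foldl (fun c g => cact g c) c gs.

(** With distinct nonzero absolute values every comparison in [len] is strict, so a crossing or nail
    in range changes the length by exactly one. *)
Definition cgood (c : conf) := uniq (map absz c) && (0%R \notin c).

Definition desc (g : gen) (c : conf) : bool :=
  match g with
  | Dot _ => false
  | Cr j => (j.+1 < size c) && (nth 0%R c j.+1 < nth 0%R c j)%R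
  | Nail => (head 0%R c < 0)%R
  end.

Definition inrange (g : gen) (n : nat) : bool :=
  match g with Dot _ => false | Cr j => j.+1 < n | Nail => 0 < n end.

Lemma neghK : involutive negh.
Proof. by case=> //= x c; rewrite opprK. Qed.

Lemma cactK g : involutive (cact g).
Proof. by case: g => [j|j|] c //=; [apply: swpK | apply: neghK]. Qed.

Lemma size_cact g c : size (cact g c) = size c.
Proof. by case: g => [j|j|] //=; [rewrite size_swp | case: c]. Qed.

Lemma perm_abs_cact g c : perm_eq (map absz (cact g c)) (map absz c).
Proof.
case: g => [j|j|] //=; first by rewrite map_swp perm_swp.
by case: c => //= x c; rewrite abszN.
Qed.

Lemma cgoodE c : cgood c = uniq (map absz c) && (0 \notin map absz c).
Proof.
congr (_ && ~~ _); apply/idP/mapP => [H|[x H /esym/eqP]]; first by exists 0%R.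
by rewrite absz_eq0 => /eqP <-.
Qed.

Lemma cgood_cact g c : cgood (cact g c) = cgood c.
Proof.
by rewrite !cgoodE (perm_uniq (perm_abs_cact g c)) (perm_mem (perm_abs_cact g c)).
Qed.

Lemma cgood_crun gs c : cgood (crun gs c) = cgood c.
Proof. by elim: gs c => //= g gs IH c; rewrite IH cgood_cact. Qed.

Lemma sumn_swp (f : int -> nat) j c :
  sumn [seq f y | y <- swp j c] = sumn [seq f y | y <- c].
Proof. by apply: perm_sumn; apply: perm_map; apply: perm_swp. Qed.

Lemma len_asc g c : cgood c -> inrange g (size c) -> ~~ desc g c ->
  len (cact g c) = (len c).+1.
Proof.
case: g => [j|j|] //=.
  elim: j c => [|j IH] [|x [|y c]] //= /andP[/= /andP[Hx Hu] H0] Hs.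
    have : x != y by apply: contraNneq Hx => ->; rewrite inE eqxx.
    by rewrite /pcnt; lia.
  move=> Hd; rewrite sumn_swp IH //; first by rewrite addnS.
  by rewrite /cgood /= Hu; apply: contra H0 => H0; rewrite inE H0 orbT.
case: c => //= x c /andP[_ H0] _ Hd.
(* Negating the first entry exchanges the two terms of [pcnt]. *)
have -> : sumn [seq pcnt (- x)%R y | y <- c] = sumn [seq pcnt x y | y <- c].
  by congr sumn; apply: eq_map => y; rewrite /pcnt; lia.
by move: H0; rewrite inE negb_or => /andP[]; lia.
Qed.

Lemma desc_inrange g c : desc g c -> inrange g (size c).
Proof. by case: g => [j|j|] //=; [case/andP | case: c]. Qed.

Lemma desc_cact g c : cgood c -> inrange g (size c) ->
  desc g (cact g c) = ~~ desc g c.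
Proof.
case: g => [j|j|] //=.
  move=> /andP[Hu _] Hj; rewrite size_swp Hj !nth_swp // /swapn !eqxx /=.
  rewrite (_ : j.+1 == j = false); last by lia.
  have : nth 0%R c j != nth 0%R c j.+1.
    rewrite nth_uniq ?(ltnW Hj) //; first by lia.
    exact: map_uniq Hu.
  by move: (nth _ _ _) (nth _ _ _) => x y; lia.
by case: c => //= x c /andP[_]; rewrite inE negb_or => /andP[]; lia.
Qed.

Lemma len_desc g c : cgood c -> desc g c -> len c = (len (cact g c)).+1.
Proof.
move=> Hc Hd; have Hr := desc_inrange Hd.
by rewrite -(@len_asc g) ?cactK ?cgood_cact ?size_cact // desc_cact // Hd.
Qed.

Lemma cact_oob g c : ~~ inrange g (size c) -> cact g c = c.
Proof. by case: g => [j|j|] //=; [rewrite -leqNgt; apply: swp_oob | case: c]. Qed.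

Lemma len_cact_le g c : cgood c -> len (cact g c) <= (len c).+1.
Proof.
move=> Hc; case Hr: (inrange g (size c)); last by rewrite cact_oob ?Hr.
case Hd: (desc g c); first by rewrite (len_desc Hc Hd); lia.
by rewrite len_asc // Hd.
Qed.

Lemma crun_rcons gs g c : crun (rcons gs g) c = cact g (crun gs c).
Proof. by rewrite /crun foldl_rcons. Qed.

Lemma crun_cat g1 g2 c : crun (g1 ++ g2) c = crun g2 (crun g1 c).
Proof. by rewrite /crun foldl_cat. Qed.

Lemma len_crun_le gs c : cgood c -> len (crun gs c) <= len c + size gs.
Proof.
move=> Hc; elim/last_ind: gs => [|gs g IH] /=; first by rewrite addn0.
rewrite crun_rcons size_rcons.
have := @len_cact_le g (crun gs c); rewrite cgood_crun => /(_ Hc); lia.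
Qed.

(* [ds] is read from the top of a diagram to its bottom *)
Fixpoint dpath (c : conf) (ds : seq gen) : bool :=
  if ds is d :: ds' then desc d c && dpath (cact d c) ds' else true.

Lemma crun_revK gs c : crun (rev gs) (crun gs c) = c.
Proof.
by elim: gs c => //= g gs IH c; rewrite rev_cons crun_rcons IH cactK.
Qed.

Lemma dpath_len c ds : cgood c -> dpath c ds -> len c = len (crun ds c) + size ds.
Proof.
elim: ds c => [|d ds IH] c Hc /=; first by rewrite addn0.
by case/andP=> Hd Hp; rewrite (len_desc Hc Hd) (IH _ _ Hp) ?cgood_cact // addnS.
Qed.

(** A letter raises the length by at most one, so a word that raises it by its full size ascends at
    every letter; read backwards, it descends. *)
Lemma dpath_crun gs c : cgood c -> len (crun gs c) = len c + size gs ->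
  dpath (crun gs c) (rev gs).
Proof.
move=> Hc; elim/last_ind: gs => [|gs g IH] //; rewrite rev_rcons crun_rcons size_rcons /=.
have Hc' : cgood (crun gs c) by rewrite cgood_crun.
have := len_crun_le gs Hc => H1 H2; rewrite cactK.
case Hr: (inrange g (size (crun gs c))); last by move: H2; rewrite cact_oob ?Hr //; lia.
rewrite desc_cact //; case Hd: (desc g (crun gs c)) => /=.
  by move: H2; have := len_desc Hc' Hd; lia.
by apply: IH; move: H2; rewrite len_asc ?Hd //; lia.
Qed.

Definition idc (n : nat) : conf := map Posz (iota 1 n).

Lemma abs_idc n : map absz (idc n) = iota 1 n.
Proof. by rewrite /idc -map_comp (eq_map (g := id)) ?map_id. Qed.

Lemma size_idc n : size (idc n) = n.
Proof. by rewrite size_map size_iota. Qed.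

Lemma cgood_wf n c : perm_eq (map absz c) (iota 1 n) -> cgood c.
Proof. by move=> H; rewrite cgoodE (perm_uniq H) (perm_mem H) iota_uniq mem_iota. Qed.

Lemma cgood_idc n : cgood (idc n).
Proof. by apply: (@cgood_wf n); rewrite abs_idc. Qed.

Lemma no_desc n c : perm_eq (map absz c) (iota 1 n) -> (forall g, ~~ desc g c) ->
  c = idc n.
Proof.
move=> Hp Hd; have Hc := cgood_wf Hp.
have Hs : sorted <%R c.
  apply/(sortedP 0%R) => i Hi; have := Hd (Cr i); rewrite /= Hi /= -leNgt le_eqVlt.
  case/orP=> // /eqP E; move: Hc => /andP[/map_uniq Hu _].
  by move/eqP: E; rewrite nth_uniq ?(ltnW Hi) //; lia.
have Hpos x : x \in c -> (0 < x)%R.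
  have := Hd Nail; case: c Hs Hc {Hp Hd} => //= y c Hs /andP[_ H0] Hy.
  have Hy0 : (0 < y)%R by move: H0; rewrite inE negb_or => /andP[]; lia.
  rewrite inE => /orP[/eqP -> //|Hx].
  by apply: lt_trans Hy0 _; move: Hs; rewrite lt_path_sortedE => /andP[/allP /(_ x Hx)].
have E : c = map Posz (map absz c).
  by rewrite -map_comp -[LHS]map_id; apply/eq_in_map => x /Hpos /=; lia.
rewrite E; congr map; apply: (irr_sorted_eq ltn_trans ltnn) => //; last exact: perm_mem.
  move: Hs; rewrite {1}E sorted_map; apply: sub_sorted => x y /=; lia.
exact: iota_ltn_sorted.
Qed.

Lemma len_idc n : len (idc n) = 0.
Proof.
rewrite /idc; elim: n 1 => //= n IH m; rewrite IH addn0.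
apply/eqP; rewrite sumnE big_map big1_seq // => y /= /mapP[k].
by rewrite mem_iota /pcnt => Hk ->; lia.
Qed.

(** * Left-adjusted reduced expressions *)

Definition linv (a : seq nat) : nat := len (map Posz a).

(** In a reduced expression of [a], the smaller labels that end left of [q] are left of it
    throughout, so [nb a q] bounds every position of that strand from below; left-adjusted
    expressions attain the bound. *)
Definition nb (a : seq nat) (q : nat) : nat :=
  count (fun p => p < q) (take (index q a) a).

Definition arun (cs a : seq nat) : seq nat := foldl (fun a j => swp j a) a cs.

Lemma nb_cons x a q : nb (x :: a) q = if x == q then 0 else (x < q) + nb a q.
Proof. by rewrite /nb /=; case: eqP. Qed.

Lemma nb_cat u v q :
  nb (u ++ v) q = if q \in u then nb u q else count (fun p => p < q) u + nb v q.
Proof.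
rewrite /nb index_cat; case: ifP => Hq.
  by rewrite takel_cat // index_size.
by rewrite take_cat ltnNge leq_addr /= addKn count_cat.
Qed.

(** Against an earlier entry x, a negative y costs two more than its absolute value exactly when |x|
    < |y|, whatever the sign of x. The summand 2 nb + 1 is the size of [theta] at the leftmost
    position of the strand. *)
Lemma len_signs c : cgood c ->
  len c = linv (map absz c)
          + \sum_(y <- c | (y < 0)%R) (2 * nb (map absz c) (absz y) + 1).
Proof.
elim: c => [|x c IH]; first by rewrite big_nil.
move=> /andP[/= /andP[Hx Hu]]; rewrite inE negb_or => /andP[x0 H0].
rewrite IH; last by rewrite /cgood Hu.
rewrite big_cons /= nb_cons eqxx !sumnE !big_map.
have -> : \sum_(y <- c | (y < 0)%R) (2 * nb (`|x|%N :: map absz c) `|y| + 1)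
  = \sum_(y <- c) (if (y < 0)%R then 2 * (`|x|%N < `|y|%N) else 0)
    + \sum_(y <- c | (y < 0)%R) (2 * nb (map absz c) `|y| + 1).
  rewrite -big_mkcond /= -big_split /=.
  rewrite big_seq_cond [RHS]big_seq_cond; apply: eq_bigr => y /andP[yc _].
  rewrite nb_cons; case: eqP => [E|_]; last by lia.
  by case/negP: Hx; rewrite E map_f.
have -> : \sum_(y <- c) pcnt x y = \sum_(y <- c) pcnt (absz x) (absz y)
  + \sum_(y <- c) (if (y < 0)%R then 2 * (`|x|%N < `|y|%N) else 0).
  rewrite -big_split /= [LHS]big_seq [RHS]big_seq; apply: eq_bigr => y yc.
  have : `|x|%N != `|y|%N by apply: contraNneq Hx => ->; rewrite map_f.
  have : (0 != y)%R by apply: contraNneq H0 => ->.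
  by move: x0; rewrite /pcnt; case: ifP; lia.
rewrite [linv (_ :: _)]/linv /= -/(linv _) sumnE !big_map.
by case: ifP => _ /=; lia.
Qed.

Lemma arun_rcons cs j a : arun (rcons cs j) a = swp j (arun cs a).
Proof. by rewrite /arun foldl_rcons. Qed.

Lemma arun_cat cs cs' a : arun (cs ++ cs') a = arun cs' (arun cs a).
Proof. by rewrite /arun foldl_cat. Qed.

Lemma crun_Cr_pos cs a : crun (map Cr cs) (map Posz a) = map Posz (arun cs a).
Proof. by elim: cs a => //= j cs IH a; rewrite -map_swp IH. Qed.

Lemma perm_arun cs a : perm_eq (arun cs a) a.
Proof.
elim: cs a => //= j cs IH a; exact: perm_trans (IH _) (perm_swp _ _).
Qed.

Lemma size_arun cs a : size (arun cs a) = size a.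
Proof. exact: perm_size (perm_arun _ _). Qed.

(** The binomial telescopes: when [nb] of a label drops from k+1 to k, its term drops by k, which is
    the index of the crossing if all labels further left are smaller. *)
Definition Bp (a : seq nat) : nat := \sum_(q <- a) 'C(nb a q, 2).

Lemma Bp_swp (u v : seq nat) (x y : nat) : uniq (u ++ x :: y :: v) -> x < y ->
  Bp (u ++ x :: y :: v) = Bp (u ++ y :: x :: v) + count (fun p => p < y) u.
Proof.
rewrite cat_uniq /= => /and3P[_ /norP[xu /norP[yu /hasPn vu]]].
rewrite inE negb_or => /and3P[/andP[_ xv] yv _] Hxy.
rewrite /Bp !big_cat !big_cons /=.
rewrite !nb_cat (negPf xu) (negPf yu) !nb_cons !eqxx Hxy !addn0.
rewrite (_ : (x == y) = false) 1?(_ : (y == x) = false) 1?(_ : (y < x) = false); try lia.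
rewrite addn0 addn1 binS bin1.
have Eu w w' : \sum_(i <- u) 'C(nb (u ++ w) i, 2) = \sum_(i <- u) 'C(nb (u ++ w') i, 2).
  by rewrite !big_seq; apply: eq_bigr => q qu; rewrite !nb_cat qu.
have Ev : \sum_(j <- v) 'C(nb (u ++ [:: x, y & v]) j, 2) =
          \sum_(j <- v) 'C(nb (u ++ [:: y, x & v]) j, 2).
  rewrite !big_seq; apply: eq_bigr => q qv; rewrite !nb_cat (negPf (vu q qv)) !nb_cons.
  do 2![case: eqP => [E|_]; first by rewrite ?E qv in xv yv].
  by congr 'C(_, 2); lia.
rewrite Ev (Eu _ [:: y, x & v]); lia.
Qed.

Lemma uniq_arun cs n : uniq (arun cs (iota 1 n)).
Proof. by rewrite (perm_uniq (perm_arun _ _)) iota_uniq. Qed.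

Lemma cgood_arun cs n : cgood (map Posz (arun cs (iota 1 n))).
Proof. by rewrite -crun_Cr_pos cgood_crun cgood_idc. Qed.

Lemma linv_iota n : linv (iota 1 n) = 0.
Proof. exact: len_idc. Qed.

(* Each crossing at index j in which the label y moves left contributes
   j >= #{smaller labels left of y}, the decrease of Bp; equality forces every
   strand to make all its moves to the left before any move to the right. *)
Lemma arun_potential n cs : let id := iota 1 n in let a := arun cs id in
  size cs = linv a ->
  Bp id <= sumn cs + Bp a /\
  (Bp id = sumn cs + Bp a -> forall q, q \in a ->
     exists2 h, h <= size cs & index q (arun (take h cs) id) = nb a q).
Proof.
elim/last_ind: cs => [|cs j IH] /=.
  move=> _; split=> // _ q; rewrite mem_iota => Hq; exists 0 => //=.
  have E : index q (iota 1 n) = q - 1.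
    have {1}-> : q = nth 0 (iota 1 n) (q - 1) by rewrite nth_iota; lia.
    by rewrite index_uniq ?iota_uniq ?size_iota //; lia.
  rewrite /nb E take_iota (minn_idPl _); last by lia.
  rewrite (eq_in_count (a2 := predT)) ?count_predT ?size_iota //.
  by move=> p; rewrite mem_iota /=; lia.
rewrite arun_rcons size_rcons => Hs.
have Hg := cgood_arun cs n; set a := arun cs (iota 1 n) in Hg Hs IH *.
have Ha : linv a <= size cs.
  rewrite /linv /a -crun_Cr_pos.
  by have := len_crun_le (map Cr cs) (cgood_idc n); rewrite len_idc size_map.
have E : linv (swp j a) = len (cact (Cr j) (map Posz a)) by rewrite /linv map_swp.
(* The length [(size cs).+1] can only be reached if the last crossing is in range and ascends. *)
have Hr : inrange (Cr j) (size (map Posz a)).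
  by apply: contraT => Hr; move: E; rewrite cact_oob // -/(linv a); lia.
have Hd : ~~ desc (Cr j) (map Posz a).
  by apply/negP => /(len_desc Hg); rewrite -E -/(linv a); lia.
have Hs' : size cs = linv a by move: (len_asc Hg Hr Hd); rewrite -E -/(linv a); lia.
have [IH1 IH2] := IH Hs'; rewrite -/a in IH1 IH2.
have Hj : j.+1 < size a by move: Hr; rewrite /= size_map.
have [u [x [y [v [Ea Eu]]]]] := split_two Hj.
have Hu : uniq a by apply: uniq_arun.
have Hxy : x < y.
  move: Hd; rewrite /= size_map Hj /= !(nth_map 0) // ?(ltnW Hj) // Ea !nth_cat.
  have : x != y by apply: contraTneq Hu => E1; rewrite Ea E1 cat_uniq /= inE eqxx /= !andbF.
  by rewrite -Eu ltnn ltnNge leqnSn /= subnn subSn // subnn /=; lia.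
have Eb : swp j a = u ++ y :: x :: v by rewrite Ea -Eu swp_cat.
have := @Bp_swp u v x y; rewrite -Ea -Eb => /(_ Hu Hxy) EB.
have Hc : count (fun p => p < y) u <= j by rewrite -Eu count_size.
rewrite sumn_rcons; split; first by lia.
move=> H q; rewrite (perm_mem (perm_swp _ _)) => qa.
have [H1 H2] : count (fun p => p < y) u = j /\ Bp (iota 1 n) = sumn cs + Bp a by lia.
have [xu yu] : x \notin u /\ y \notin u.
  by move: Hu; rewrite Ea cat_uniq /= !negb_or => /and3P[_ /and3P[-> -> _]].
(* The label y has just arrived at index j, which by equality is its new [nb]; every other label, x
   included, keeps its [nb] and hence its earlier height. *)
have [->|Hq] := eqVneq q y.
  exists (size cs).+1 => //; rewrite -(size_rcons cs j) take_size arun_rcons -/a Eb.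
  by rewrite nb_cat (negPf yu) index_cat (negPf yu) /= eqxx nb_cons eqxx H1 Eu addn0.
have [h Hh Ih] := IH2 H2 q qa; exists h; first by rewrite leqW.
rewrite -cats1 takel_cat // Ih Eb Ea !nb_cat; case: ifP => // _.
by rewrite !nb_cons (eq_sym y q) (negPf Hq); case: eqP => [<-|_]; lia.
Qed.

(* Undoing the first descent at each step attains equality in [arun_potential]. *)
Lemma arun_exists n (a : seq nat) : perm_eq a (iota 1 n) ->
  exists cs, [/\ all (fun j => j.+1 < n) cs, arun cs (iota 1 n) = a,
    size cs = linv a & sumn cs + Bp a = Bp (iota 1 n)].
Proof.
have [m] := ubnP (linv a); elim: m a => // m IH a /ltnSE Hm Ha.
have Habs : map absz (map Posz a) = a.
  by rewrite -map_comp (eq_map (g := id)) ?map_id.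
have Hp : perm_eq (map absz (map Posz a)) (iota 1 n) by rewrite Habs.
have Hg := cgood_wf Hp; have Hsz : size a = n by rewrite (perm_size Ha) size_iota.
have [/hasP[j0 _ Hj0]|/hasPn Hno] := boolP (has (fun j => desc (Cr j) (map Posz a)) (iota 0 n)).
  have Hex : exists j, desc (Cr j) (map Posz a) by exists j0.
  case: (ex_minnP Hex) => j Hd Hmin {Hex Hj0 j0}.
  have Hj : j.+1 < size a by move: Hd => /= /andP[]; rewrite size_map.
  have Hu : uniq a by rewrite (perm_uniq Ha) iota_uniq.
  have [u [x [y [v [Ea Eu]]]]] := split_two Hj.
  have Hyx : y < x.
    move: Hd; rewrite /= size_map Hj /= !(nth_map 0) // ?(ltnW Hj) // Ea !nth_cat.
    by rewrite -Eu ltnn ltnNge leqnSn /= subnn subSn // subnn.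
  (* As j is the first descent, the entries before x increase up to x, so the bound on the index of
     the crossing is an equality. *)
  have Hux : all (fun p => p < x) u.
    have : sorted ltn (rcons u x).
      apply/(sortedP 0) => i; rewrite size_rcons ltnS => Hi.
      have Hia : i.+1 < size a by rewrite (leq_ltn_trans Hi) // Eu; lia.
      have : ~~ desc (Cr i) (map Posz a) by apply/negP => /Hmin; lia.
      rewrite /= size_map Hia /= !(nth_map 0) // ?(ltnW Hia) //.
      have : nth 0 a i != nth 0 a i.+1 by rewrite nth_uniq ?(ltnW Hia) //; lia.
      have E k : k <= size u -> nth 0 a k = nth 0 (rcons u x) k.
        by rewrite Ea -cat_rcons nth_cat size_rcons ltnS => ->.
      by rewrite !E ?(ltnW Hi) //; lia.
    rewrite sorted_pairwise; last exact: ltn_trans.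
    by rewrite pairwise_rcons => /andP[].
  have Hl : linv a = (linv (swp j a)).+1.
    by rewrite [LHS](len_desc Hg Hd) /= -map_swp.
  have [|cs [H1 H2 H3 H4]] := IH (swp j a) _ (perm_trans (perm_swp j a) Ha).
    by rewrite -ltnS -Hl.
  exists (rcons cs j); split; rewrite ?all_rcons ?size_rcons ?sumn_rcons.
  - by rewrite H1 -Hsz Hj.
  - by rewrite arun_rcons H2 swpK.
  - by rewrite H3.
  rewrite -H4 Ea -Eu swp_cat (@Bp_swp u v y x) //.
    by rewrite (eqP (_ : count _ u == size u)) -?all_count //; lia.
  have -> : u ++ [:: y, x & v] = swp j a by rewrite Ea -Eu swp_cat.
  by rewrite (perm_uniq (perm_swp _ _)).
have Ea : a = iota 1 n.
  rewrite -Habs (no_desc (n := n) (c := map Posz a)) ?abs_idc //.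
  case=> [//|j|]; last by case: (a).
  have [Hj|Hj] := ltnP j n; first by apply: Hno; rewrite mem_iota.
  by rewrite /= size_map Hsz ltnNge leqW.
by exists [::]; rewrite Ea linv_iota.
Qed.

(** * Permutations as lists of values *)

Lemma pos_after_rcons cs j p : pos_after (rcons cs j) p = swapn j (pos_after cs p).
Proof. by rewrite /pos_after foldl_rcons. Qed.

Lemma nth_arun d cs a p : all (fun j => j.+1 < size a) cs ->
  nth d (arun cs a) (pos_after cs p) = nth d a p.
Proof.
elim/last_ind: cs => [|cs j IH] //; rewrite all_rcons => /andP[Hj Hcs].
by rewrite arun_rcons pos_after_rcons nth_swp ?size_arun // swapnK IH.
Qed.

Lemma pos_after_lt n cs p : all (fun j => j.+1 < n) cs -> p < n -> pos_after cs p < n.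
Proof.
move=> + Hp; elim/last_ind: cs => [|cs j IH] //; rewrite all_rcons => /andP[Hj /IH].
by rewrite pos_after_rcons /swapn; case: eqP => [|_]; [lia | case: eqP => [|//]; lia].
Qed.

Lemma index_arun n cs p : all (fun j => j.+1 < n) cs -> p < n ->
  index p.+1 (arun cs (iota 1 n)) = pos_after cs p.
Proof.
move=> Hcs Hp; rewrite -[p.+1](nth_iota 0 1 Hp) -(nth_arun 0 (cs := cs)) ?size_iota //.
by rewrite index_uniq ?uniq_arun // size_arun size_iota pos_after_lt.
Qed.

(** The inverse of [w], read along the top. The shift by one avoids the label 0, which could not
    carry a sign. *)
Definition labels (n : nat) (w : seq nat) : seq nat :=
  [seq (index t w).+1 | t <- iota 0 n].

Lemma size_labels n w : size (labels n w) = n.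
Proof. by rewrite size_map size_iota. Qed.

Lemma nth_labels n w t : t < n -> nth 0 (labels n w) t = (index t w).+1.
Proof. by move=> Ht; rewrite (nth_map 0) ?size_iota // nth_iota. Qed.

Section Perm.
Variables (n : nat) (w : seq nat).
Hypothesis Hw : perm_eq w (iota 0 n).

Lemma perm_size_w : size w = n.
Proof. by rewrite (perm_size Hw) size_iota. Qed.

Lemma mem_w t : (t \in w) = (t < n).
Proof. by rewrite (perm_mem Hw) mem_iota. Qed.

Lemma uniq_w : uniq w.
Proof. by rewrite (perm_uniq Hw) iota_uniq. Qed.

Lemma nth_w_lt p : p < n -> nth 0 w p < n.
Proof. by move=> Hp; rewrite -mem_w mem_nth // perm_size_w. Qed.

Lemma index_w_lt t : t < n -> index t w < n.
Proof. by move=> Ht; rewrite -perm_size_w index_mem mem_w. Qed.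

Lemma perm_labels : perm_eq (labels n w) (iota 1 n).
Proof.
rewrite -[1]addn0 iotaDl -perm_size_w /labels perm_size_w.
rewrite (map_comp (addn 1) (index^~ w)); apply: perm_map.
apply: uniq_perm; rewrite ?iota_uniq //.
  rewrite map_inj_in_uniq ?iota_uniq // => t t'; rewrite !mem_iota /= => Ht Ht' E.
  by rewrite -[t](nth_index 0 (s := w)) ?mem_w // E nth_index ?mem_w.
move=> p; rewrite mem_iota; apply/mapP/idP => [[t Ht ->]|/= Hp].
  by rewrite mem_iota in Ht; apply: index_w_lt.
exists (nth 0 w p); rewrite ?mem_iota ?nth_w_lt //.
by rewrite index_uniq ?perm_size_w ?uniq_w.
Qed.

Lemma expr_ofP (cs : seq nat) :
  expr_of n w cs <-> all (fun j => j.+1 < n) cs /\ arun cs (iota 1 n) = labels n w.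
Proof.
rewrite /expr_of; split=> [/andP[Hcs /eqP E]|[Hcs E]].
  split=> //; apply: (@eq_from_nth _ 0); rewrite size_arun size_iota ?size_labels // => t Ht.
  rewrite nth_labels //; have Hp := index_w_lt Ht.
  have {1}-> : t = pos_after cs (index t w).
    rewrite -{1}[t](nth_index 0 (s := w)) ?mem_w // -{1}E /perm_list.
    by rewrite (nth_map 0) ?size_iota // nth_iota.
  by rewrite nth_arun ?size_iota // nth_iota.
rewrite Hcs; apply/eqP; apply: (@eq_from_nth _ 0); first by rewrite size_map size_iota perm_size_w.
rewrite size_map size_iota => p Hp; rewrite (nth_map 0) ?size_iota // nth_iota //.
rewrite -(index_arun Hcs Hp) E.
have -> : p.+1 = nth 0 (labels n w) (nth 0 w p).
  by rewrite nth_labels ?nth_w_lt // index_uniq ?uniq_w ?perm_size_w.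
by rewrite index_uniq ?size_labels ?nth_w_lt // (perm_uniq perm_labels) iota_uniq.
Qed.

(** Minimality of the index sum, compared with the expression from [arun_exists], turns the
    inequality of [arun_potential] into an equality, and equality provides the heights where [nb] is
    reached. *)
Lemma left_adjusted_spec cs : left_adjusted n w cs ->
  [/\ all (fun j => j.+1 < n) cs, arun cs (iota 1 n) = labels n w,
      size cs = linv (labels n w) &
      forall q, q < n -> exists2 h, h <= size cs & hpos cs q h = nb (labels n w) q.+1].
Proof.
case=> -[/expr_ofP[Hcs E] Hmin] Hsum.
have [cs0 [R0 E0 S0 B0]] := arun_exists perm_labels.
have X0 : expr_of n w cs0 by apply/expr_ofP.
have Hlen c : arun c (iota 1 n) = labels n w -> linv (labels n w) <= size c.
  move=> Ec; have := len_crun_le (map Cr c) (cgood_idc n).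
  by rewrite len_idc size_map crun_Cr_pos Ec.
have Hs : size cs = linv (labels n w).
  by apply/eqP; rewrite eqn_leq -{1}S0 Hmin //= Hlen.
have Hs' : size cs = linv (arun cs (iota 1 n)) by rewrite E.
have [P1 P2] := arun_potential Hs'; rewrite E in P1 P2.
have Hle : sumn cs <= sumn cs0.
  apply: Hsum; split=> // cs' /expr_ofP[_ /Hlen]; by rewrite S0.
have P3 : Bp (iota 1 n) = sumn cs + Bp (labels n w) by lia.
split=> // q Hq; have [|h Hh Ih] := P2 P3 q.+1.
  by rewrite (perm_mem perm_labels) mem_iota.
exists h => //; rewrite -Ih index_arun //.
by apply/allP => j /mem_take Hj; apply: (allP Hcs).
Qed.

End Perm.

(** * Validity of diagram words *)

Definition okstep (g : gen) (s : seq strand) : bool :=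
  match g with
  | Dot j => isBlk s j
  | Cr j => (j.+1 < size s) && (isBlk s j || isBlk s j.+1)
  | Nail => isBlk s 0
  end.

Definition sact (g : gen) (s : seq strand) : seq strand :=
  if g is Cr j then swp j s else s.

Lemma stepE s g : step s g = if okstep g s then Some (sact g s) else None.
Proof.
by case: g => [j|j|] //=; case: ifP => // /andP[/swapS_swp ->].
Qed.

Lemma isBlk_swp j i s : j.+1 < size s -> isBlk (swp j s) i = isBlk s (swapn j i).
Proof.
move=> H; rewrite /isBlk size_swp nth_swp //; congr andb.
by rewrite /swapn; case: eqP => [->|_]; [|case: eqP => [->|//]]; lia.
Qed.

Definition nondot (g : gen) : bool := if g is Dot _ then false else true.

Definition nd (gs : seq gen) : nat := count nondot gs.

Lemma nd_cat g1 g2 : nd (g1 ++ g2) = nd g1 + nd g2.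
Proof. exact: count_cat. Qed.

Lemma run_cat s g1 g2 :
  run s (g1 ++ g2) = if run s g1 is Some s' then run s' g2 else None.
Proof. by elim: g1 s => //= g g1 IH s; case: (step s g). Qed.

Lemma run_catP s g1 g2 t : run s (g1 ++ g2) = Some t ->
  exists2 s', run s g1 = Some s' & run s' g2 = Some t.
Proof. by rewrite run_cat; case: (run s g1) => // s' H; exists s'. Qed.

Lemma run_rconsP s gs g t : run s (rcons gs g) = Some t ->
  exists2 s', run s gs = Some s' & step s' g = Some t.
Proof.
rewrite -cats1 => /run_catP[s' H1 /= H2]; exists s' => //.
by case: (step s' g) H2.
Qed.

Lemma run_rcons s gs g s' t : run s gs = Some s' -> step s' g = Some t ->
  run s (rcons gs g) = Some t.
Proof. by move=> H1 H2; rewrite -cats1 run_cat H1 /= H2. Qed.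

Section Colours.
Variable s0 : seq strand.
Let n := size s0.
Implicit Types (c : conf) (g : gen).

(** Labels are bottom positions shifted by one, hence the predecessor; nailing a strand does not
    change its colour, hence the absolute value. *)
Definition colour (x : int) : strand := nth None s0 (absz x).-1.

Definition cst (c : conf) : seq strand := map colour c.

Lemma cstE c : cst c = map colour c.
Proof. by []. Qed.

Lemma colourN x : colour (- x) = colour x.
Proof. by rewrite /colour abszN. Qed.

Lemma cst_cact g c : cst (cact g c) = sact g (cst c).
Proof.
by case: g => [j|j|] //=; [rewrite /cst map_swp | case: c => //= x c; rewrite colourN].
Qed.

Lemma step_cst c g : step (cst c) g = if okstep g (cst c) then Some (cst (cact g c)) else None.
Proof. by rewrite cst_cact stepE. Qed.

Lemma run_cst gs c t : run (cst c) gs = Some t -> t = cst (crun gs c).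
Proof.
elim: gs c => [|g gs IH] c /=; first by case.
by rewrite step_cst; case: ifP => // _ /IH.
Qed.

Lemma cst_idc : cst (idc n) = s0.
Proof.
apply: (@eq_from_nth _ None); rewrite ?size_map ?size_iota // => i Hi.
by rewrite (nth_map 0%R) ?size_idc // /idc (nth_map 0) ?size_iota // nth_iota.
Qed.

(** The configurations reachable from the identity by valid words: only black strands are nailed and
    red strands never cross. [adm_run] and [adm_word] give the two directions. *)
Definition adm c : bool :=
  [&& perm_eq (map absz c) (iota 1 n),
      all (fun x => (x < 0)%R ==> (colour x == None)) c &
      pairwise (fun x y => (colour x != None) && (colour y != None) ==> (x < y)%R) c].

Lemma adm_perm c : adm c -> perm_eq (map absz c) (iota 1 n).
Proof. by case/and3P. Qed.

Lemma adm_good c : adm c -> cgood c.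
Proof. by move/adm_perm/cgood_wf. Qed.

Lemma adm_size c : adm c -> size c = n.
Proof. by move/adm_perm/perm_size; rewrite size_map size_iota. Qed.

Lemma okstep_cact g c : okstep g (cst (cact g c)) = okstep g (cst c).
Proof.
rewrite cst_cact; case: g => [j|j|] //=; rewrite size_swp; case: ltnP => //= H.
by rewrite !isBlk_swp // /swapn !eqxx orbC; case: eqP => //; lia.
Qed.

Lemma isBlk_split (u v : conf) x y :
  (isBlk (cst (u ++ x :: y :: v)) (size u) = (colour x == None)) *
  (isBlk (cst (u ++ x :: y :: v)) (size u).+1 = (colour y == None)).
Proof.
rewrite /isBlk /cst map_cat !size_cat !nth_cat !size_map /= ltnn.
rewrite (_ : (size u).+1 < size u = false) ?subnn ?subSnn /=; last by lia.
by rewrite !addnS !ltnS leq_addr leqW ?leq_addr.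
Qed.

Lemma adm_cact g c : adm c -> okstep g (cst c) -> adm (cact g c).
Proof.
case/and3P=> H1 H2 H3 Hok; apply/and3P; split.
- exact: perm_trans (perm_abs_cact g c) H1.
- case: g Hok => [j|j|] //=; first by rewrite (eq_all_r (perm_mem (perm_swp j c))).
  by case: c H2 {H1 H3} => //= x c /andP[_ ->]; rewrite /isBlk /= colourN => ->; rewrite implybT.
case: g Hok => [j|j|] //=.
  rewrite size_map => /andP[Hj]; have [u [x [y [v [E <-]]]]] := split_two Hj.
  move: H3; rewrite E swp_cat !isBlk_split !pairwise_cat /=.
  move=> /and3P[Hu -> /and3P[/andP[_ ->] -> ->]] Hb; rewrite !andbT.
  apply/andP; split; last by move: Hb; case: (colour x == None); case: (colour y == None).
  by apply/allrelP => a b Ha Hb'; apply: (allrelP Hu) => //; move: Hb'; rewrite !inE orbCA.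
case: c H3 {H1 H2} => //= x c /andP[_ ->]; rewrite /isBlk /= colourN => ->.
by rewrite andbT; apply/allP.
Qed.

Lemma adm_run gs c t : adm c -> run (cst c) gs = Some t -> adm (crun gs c).
Proof.
elim: gs c => [|g gs IH] c //= Hc.
by rewrite step_cst; case: ifP => // /(adm_cact Hc)/IH H /H.
Qed.

(** Red strands are in order and negative labels are black, so a descent always involves a black
    strand. Reduced words of admissible configurations are therefore automatically valid
    diagrams. *)
Lemma desc_ok g c : adm c -> desc g c -> okstep g (cst c).
Proof.
case/and3P=> _ H2 H3; case: g => [j|j|] //=.
  rewrite size_map => /andP[Hj]; rewrite Hj.
  have [u [x [y [v [E <-]]]]] := split_two Hj.
  move: H3; rewrite E !isBlk_split pairwise_cat /= => /and3P[_ _ /and3P[/andP[Hxy _] _ _]].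
  rewrite !nth_cat ltnn ltnNge leqnSn /= subnn subSnn /=.
  by move: Hxy; case: (colour x == None); case: (colour y == None) => //=; lia.
by case: c H2 {H3} => //= x c /andP[+ _] Hx; rewrite Hx /isBlk /=.
Qed.

Lemma adm_desc g c : adm c -> desc g c ->
  adm (cact g c) /\ step (cst (cact g c)) g = Some (cst c).
Proof.
move=> Hc Hd; have Hok := desc_ok Hc Hd; split; first exact: adm_cact.
by rewrite step_cst okstep_cact Hok cactK.
Qed.

Lemma adm_dpath ds c : adm c -> dpath c ds ->
  adm (crun ds c) /\ run (cst (crun ds c)) (rev ds) = Some (cst c).
Proof.
elim: ds c => //= d ds IH c Hc /andP[Hd /IH]; have [Ha Hs] := adm_desc Hc Hd.
by case/(_ Ha)=> H1 H2; split=> //; rewrite rev_cons; apply: run_rcons H2 Hs.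
Qed.

Lemma dpath_nondot c ds : dpath c ds -> all nondot ds.
Proof. by elim: ds c => //= d ds IH c /andP[Hd /IH ->]; case: d Hd. Qed.

Lemma adm_lt0 c : adm c -> 0 < len c -> exists2 g, desc g c & True.
Proof.
move=> Hc Hl; case: (boolP (desc Nail c)) => HN; first by exists Nail.
have [/hasP[j _ Hj]|/hasPn Hno] := boolP (has (fun j => desc (Cr j) c) (iota 0 n)).
  by exists (Cr j).
rewrite (@no_desc n c (adm_perm Hc)) ?len_idc // in Hl; case=> // j.
have [Hj|Hj] := ltnP j n; first by apply: Hno; rewrite mem_iota.
by rewrite /= (adm_size Hc) ltnNge leqW.
Qed.

Lemma adm_len0 c : adm c -> len c = 0 -> c = idc n.
Proof.
move=> Hc Hl; apply: no_desc (adm_perm Hc) _ => g.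
by apply/negP => /(len_desc (adm_good Hc)); rewrite Hl.
Qed.

Lemma adm_path c : adm c -> exists2 ds, dpath c ds & crun ds c = idc n.
Proof.
have [m] := ubnP (len c); elim: m c => // m IH c /ltnSE Hm Hc.
have [H0|/(adm_lt0 Hc)[g Hd _]] := posnP (len c).
  by exists [::] => //; apply: adm_len0.
have [Ha _] := adm_desc Hc Hd.
have [|ds H1 H2] := IH (cact g c) _ Ha.
  by rewrite -(len_desc (adm_good Hc) Hd).
by exists (g :: ds) => //=; rewrite Hd.
Qed.

Lemma adm_word c : adm c -> exists gs,
  [/\ size gs = len c, all nondot gs, run s0 gs = Some (cst c) & crun gs (idc n) = c].
Proof.
move=> Hc; have [ds H1 H2] := adm_path Hc; exists (rev ds).
have [_ Hr] := adm_dpath Hc H1.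
have E := dpath_len (adm_good Hc) H1; rewrite H2 len_idc in E.
split; rewrite ?size_rev ?all_rev ?(dpath_nondot H1) ?E //.
  by rewrite -cst_idc -H2.
by rewrite -H2 crun_revK.
Qed.

Lemma reduced_dpath gs c : crun gs (idc n) = c -> len c = size gs -> dpath c (rev gs).
Proof.
by move=> E H; have := dpath_crun (cgood_idc n) (gs := gs); rewrite E len_idc H; apply.
Qed.

Lemma reduced_run gs c : adm c -> crun gs (idc n) = c -> len c = size gs ->
  run s0 gs = Some (cst c).
Proof.
move=> Hc E H; have [_] := adm_dpath Hc (reduced_dpath E H).
by rewrite revK -E crun_revK cst_idc.
Qed.

End Colours.

Lemma okstep_far g h s : ~~ has (fun p => p \in supp h) (supp g) ->
  okstep g s -> okstep h (sact g s) = okstep h s.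
Proof.
case: g => [j|j|] //= Hf /andP[Hj _]; case: h Hf => [i|i|] //=;
  rewrite !inE ?size_swp !isBlk_swp // /swapn => Hf.
- by do ![case: eqP => //]; lia.
- by do ![case: eqP => //]; lia.
- by do ![case: eqP => //]; lia.
Qed.

Lemma run_far s g h : ~~ has (fun p => p \in supp h) (supp g) ->
  valid (s, [:: g; h]) -> run s [:: h; g] = run s [:: g; h].
Proof.
move=> Hf; rewrite /valid /top /= !stepE; case Hg: (okstep g s) => //.
rewrite stepE okstep_far //; case Hh: (okstep h s) => // _.
have Hf' : ~~ has (fun p => p \in supp g) (supp h).
  by apply: contra Hf => /hasP[p H1 H2]; apply/hasP; exists p.
rewrite stepE okstep_far // Hg; congr Some.
case: g h Hf {Hg Hh Hf'} => [j|j|] [i|i|] //=; rewrite !inE => Hf.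
by case: (ltnP i j) => Hij; [apply: swp_comm | apply/esym/swp_comm]; lia.
Qed.

(** * Congruences modulo the defining ideal *)

Section Ideal.
Local Open Scope ring_scope.
Variables (R : comPzRingType) (N : seq nat).
Implicit Types (f g : seq (R * word)) (u v : word).

Lemma fcoef_nil D : fcoef [::] D = 0 :> R.
Proof. by rewrite /fcoef big_nil. Qed.

Lemma fcoef_cat f g D : fcoef (f ++ g) D = fcoef f D + fcoef g D.
Proof. by rewrite /fcoef big_cat. Qed.

Lemma fcoef_cons x f D : fcoef (x :: f) D = (if x.2 == D then x.1 else 0) + fcoef f D.
Proof. by rewrite /fcoef big_cons; case: ifP; rewrite ?add0r. Qed.

Lemma fcoef_scale c f D : fcoef (fscale c f) D = c * fcoef f D.
Proof. by rewrite /fcoef big_map /= big_distrr. Qed.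

Lemma fcoef_perm f g : perm_eq f g -> fcoef f =1 fcoef g.
Proof. by move=> H D; apply: perm_big. Qed.

(** Additive functionals of formal sums only see the collected coefficients; this settles the case
    [I_ext] in inductions over the ideal. *)
Lemma fcoef_ext (V : nmodType) (F : word -> R -> V) f g :
  (forall D, F D 0 = 0) -> (forall D a b, F D (a + b) = F D a + F D b) ->
  fcoef f =1 fcoef g -> \sum_(x <- f) F x.2 x.1 = \sum_(x <- g) F x.2 x.1.
Proof.
move=> F0 FD H; pose u := undup (map snd (f ++ g)).
have key h : {subset map snd h <= u} ->
    \sum_(x <- h) F x.2 x.1 = \sum_(D <- u) F D (fcoef h D).
  move=> Hs; transitivity (\sum_(x <- h) \sum_(D <- u) F D (if x.2 == D then x.1 else 0)).
    rewrite big_seq [RHS]big_seq; apply: eq_bigr => x xh.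
    have xu : x.2 \in u by apply/Hs/map_f.
    rewrite (bigD1_seq x.2) ?undup_uniq //= eqxx big1 ?addr0 // => D.
    by rewrite eq_sym => /negPf ->; apply: F0.
  rewrite exchange_big; apply: eq_bigr => D _.
  rewrite /fcoef [in RHS]big_mkcond.
  elim: h {Hs} => [|x h IH]; first by rewrite !big_nil F0.
  by rewrite !big_cons FD IH.
rewrite !key; first by apply: eq_bigr => D _; rewrite H.
all: by move=> D HD; rewrite mem_undup map_cat mem_cat HD ?orbT.
Qed.

Definition tmul u f : seq (R * word) :=
  flatten [seq (if wmul u y.2 is Some D then [:: (y.1, D)] else [::]) | y <- f].

Lemma fmul_tmul u f : fmul [:: (1, u)] f = tmul u f.
Proof.
rewrite /fmul /= cats0 /tmul; congr flatten; apply: eq_map => y.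
by case: (wmul _ _) => // D; rewrite mul1r.
Qed.

Lemma tmul_cons u y f : tmul u (y :: f) =
  (if wmul u y.2 is Some D then [:: (y.1, D)] else [::]) ++ tmul u f.
Proof. by []. Qed.

Lemma tmul_cat u f g : tmul u (f ++ g) = tmul u f ++ tmul u g.
Proof. by rewrite /tmul map_cat flatten_cat. Qed.

Lemma tmul_scale u c f : tmul u (fscale c f) = fscale c (tmul u f).
Proof. by elim: f => //= y f IH; rewrite /tmul /= -/(tmul _ _) IH; case: (wmul _ _). Qed.

Lemma fcoef_tmul u f g : fcoef f =1 fcoef g -> fcoef (tmul u f) =1 fcoef (tmul u g).
Proof.
move=> H D; pose F D' (c : R) := if wmul u D' == Some D then c else 0.
have E h : fcoef (tmul u h) D = \sum_(x <- h) F x.2 x.1.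
  elim: h => [|y h IH]; first by rewrite fcoef_nil big_nil.
  rewrite /tmul /= -/(tmul _ _) big_cons fcoef_cat IH /F; congr (_ + _).
  case: (wmul _ _) => [D'|]; last by rewrite fcoef_nil.
  by rewrite fcoef_cons fcoef_nil addr0.
rewrite !E; apply: fcoef_ext => // [D'|D' a b]; rewrite /F; case: ifP => //.
by rewrite addr0.
Qed.

Lemma tmul_tmul u u' f : tmul u (tmul u' f) =
  if top u' == Some u.1 then tmul (u'.1, u'.2 ++ u.2) f else [::].
Proof.
elim: f => [|y f IH]; first by rewrite /= if_same.
rewrite !(tmul_cons, tmul_cat) IH; case Ey: (top y.2 == Some u'.1); last first.
  by rewrite {1}/wmul Ey /= {1}/wmul Ey.
have Et : top (y.2.1, y.2.2 ++ u'.2) = top u'.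
  by move/eqP: Ey; rewrite /top /= run_cat => ->.
rewrite {1}/wmul Ey tmul_cons /= cats0 /wmul Et Ey /= catA.
by case: ifP.
Qed.

Lemma ideal_tmul u f : valid u -> in_ideal N f -> in_ideal N (tmul u f).
Proof.
move=> Hu; elim=> {f} [|u' r v Hr Hu' Hv|f g _ If _ Ig|c f _ If|f g E _ If].
- exact: I_nil.
- rewrite fmul_tmul tmul_tmul; case: eqP => E; last exact: I_nil.
  rewrite -fmul_tmul; apply: I_gen => //.
  by rewrite /valid /top /= run_cat -/(top u') E.
- by rewrite tmul_cat; apply: I_add.
- by rewrite tmul_scale; apply: I_scale.
exact: I_ext (fcoef_tmul u E) If.
Qed.

Lemma congT_refl f : congT N f f.
Proof.
apply: I_ext (I_nil _ _) => D.
by rewrite fcoef_cat fcoef_scale mulN1r subrr fcoef_nil.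
Qed.

Lemma congT_trans f g h : congT N f g -> congT N g h -> congT N f h.
Proof.
move=> H1 H2; apply: I_ext (I_add H1 H2) => D.
by rewrite !fcoef_cat !fcoef_scale !mulN1r addrA subrK.
Qed.

Lemma congT_add f f' g g' : congT N f f' -> congT N g g' -> congT N (f ++ g) (f' ++ g').
Proof.
move=> H1 H2; apply: I_ext (I_add H1 H2) => D.
by rewrite !fcoef_cat !fcoef_scale !fcoef_cat !mulN1r opprD addrACA.
Qed.

Lemma congT_scale c f g : congT N f g -> congT N (fscale c f) (fscale c g).
Proof.
move=> /(I_scale c); apply: I_ext => D.
by rewrite fcoef_scale !fcoef_cat !fcoef_scale !mulN1r mulrBr.
Qed.

Lemma congT_ideal f g : congT N f g -> in_ideal N f -> in_ideal N g.
Proof.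
move=> /(I_scale (-1)) H /(I_add H); apply: I_ext => D.
by rewrite fcoef_cat fcoef_scale fcoef_cat fcoef_scale !mulN1r opprB subrK.
Qed.

Definition homog (s t : seq strand) f :=
  forall x, x \in f -> x.2.1 = s /\ run s x.2.2 = Some t.

Lemma tmul_homog s t gs f : homog s t f ->
  tmul (t, gs) f = [seq (x.1, (s, x.2.2 ++ gs)) | x <- f].
Proof.
elim: f => //= y f IH H; rewrite /tmul /= -/(tmul _ _) IH; last first.
  by move=> x xf; apply: H; rewrite inE xf orbT.
have [E1 E2] := H y (mem_head _ _).
by rewrite /wmul /top E1 E2 eqxx.
Qed.

Lemma fmul_homog s t s0 us vs f : homog s t f -> run s0 vs = Some s ->
  fmul [:: (1, (t, us))] (fmul f [:: (1, (s0, vs))])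
  = [seq (x.1, (s0, vs ++ x.2.2 ++ us)) | x <- f].
Proof.
move=> H Hv; have -> : fmul f [:: (1, (s0, vs))] = [seq (x.1, (s0, vs ++ x.2.2)) | x <- f].
  elim: f H => // y f IH H; have [E1 _] := H y (mem_head _ _).
  have {}IH := IH (fun x xf => H x (mem_behead (s := y :: f) xf)).
  rewrite /fmul map_cons; move: IH; rewrite /fmul => E.
  by rewrite /= -E /wmul /top /= Hv E1 eqxx /= mulr1.
rewrite fmul_tmul (@tmul_homog s0 t).
  by rewrite -map_comp; apply: eq_map => x /=; rewrite catA.
move=> x /mapP[y yf ->] /=; split=> //.
by rewrite run_cat Hv; case: (H y yf).
Qed.

Lemma fmul_mismatch u v f s t : homog s t f ->
  (top v == Some s) && (u.1 == t) = false ->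
  fmul [:: (1, u)] (fmul f [:: (1, v)]) = [::].
Proof.
move=> H /negbT; rewrite negb_and fmul_tmul => Hne.
elim: f H => // x f IH H.
have {}IH := IH (fun y yr => H y (mem_behead (s := x :: f) yr)).
have [E1 E2] := H x (mem_head _ _).
rewrite /fmul map_cons [flatten _]/= -[flatten (map _ f)]/(fmul f [:: (1, v)]).
rewrite cats0 tmul_cat IH cats0 /wmul E1; case: ifP Hne => [/eqP Hv|] //=.
have Et : top (v.1, v.2 ++ x.2.2) = Some t.
  by move: Hv; rewrite /top /= run_cat => ->.
by rewrite /tmul /= /wmul Et (inj_eq Some_inj) eq_sym => /negPf ->.
Qed.

Lemma run_dots s j k : isBlk s j -> run s (nseq k (Dot j)) = Some s.
Proof. by move=> H; elim: k => //= k IH; rewrite H. Qed.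

Lemma isBlk_size s j : isBlk s j -> (j < size s)%N.
Proof. by case/andP. Qed.

Lemma isRed_size s j i : isRed s j i -> (j < size s)%N.
Proof. by case: ltnP => // H; rewrite /isRed nth_default. Qed.

Lemma isBlk_cat0 w x z : isBlk (w ++ x :: z) (size w) = (x == None).
Proof. by rewrite /isBlk size_cat nth_cat ltnn subnn /= addnS ltnS leq_addr. Qed.

Lemma isBlk_cat1 w x y z : isBlk (w ++ x :: y :: z) (size w).+1 = (y == None).
Proof. by rewrite -cat_rcons -(size_rcons w x) isBlk_cat0. Qed.

Lemma isBlk_cat2 w x y y' z : isBlk (w ++ x :: y :: y' :: z) (size w).+2 = (y' == None).
Proof. by rewrite -cat_rcons -(size_rcons w x) isBlk_cat1. Qed.

Lemma run_Dot0 w z gs :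
  run (w ++ None :: z) (Dot (size w) :: gs) = run (w ++ None :: z) gs.
Proof. by rewrite /= isBlk_cat0. Qed.

Lemma run_Dot1 w x z gs :
  run (w ++ x :: None :: z) (Dot (size w).+1 :: gs) = run (w ++ x :: None :: z) gs.
Proof. by rewrite /= isBlk_cat1. Qed.

Lemma run_Dot2 w x y z gs :
  run (w ++ x :: y :: None :: z) (Dot (size w).+2 :: gs) = run (w ++ x :: y :: None :: z) gs.
Proof. by rewrite /= isBlk_cat2. Qed.

Lemma run_Cr0 w x y z gs : run (w ++ x :: y :: z) (Cr (size w) :: gs) =
  if (x == None) || (y == None) then run (w ++ y :: x :: z) gs else None.
Proof.
rewrite [LHS]/= -/(step _ (Cr _)) stepE /= isBlk_cat0 isBlk_cat1 swp_cat.
have -> : ((size w).+1 < size (w ++ [:: x, y & z]))%N by rewrite size_cat /=; lia.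
by case: (_ || _).
Qed.

Lemma run_Cr1 w x y y' z gs : run (w ++ x :: y :: y' :: z) (Cr (size w).+1 :: gs) =
  if (y == None) || (y' == None) then run (w ++ x :: y' :: y :: z) gs else None.
Proof. by rewrite -cat_rcons -(size_rcons w x) run_Cr0 cat_rcons. Qed.

Definition runE := (run_Dot0, run_Dot1, run_Dot2, run_Cr0, run_Cr1, eqxx, orbT).

Lemma split_state2 (s : seq strand) j : (j.+1 < size s)%N -> exists w z,
  s = w ++ nth None s j :: nth None s j.+1 :: z /\ size w = j.
Proof.
move=> H; exists (take j s), (drop j.+2 s).
by rewrite -!drop_nth ?cat_take_drop ?size_take ?(ltnW H).
Qed.

Lemma split_state3 (s : seq strand) j : (j.+2 < size s)%N -> exists w z,
  s = w ++ nth None s j :: nth None s j.+1 :: nth None s j.+2 :: z /\ size w = j.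
Proof.
move=> H; exists (take j s), (drop j.+3 s).
by rewrite -!drop_nth ?cat_take_drop ?size_take ?(ltnW H) ?(ltnW (ltnW H)).
Qed.

Lemma homog_cons s t x f : x.2.1 = s -> run s x.2.2 = Some t -> homog s t f ->
  homog s t (x :: f).
Proof. by move=> H1 H2 Hf y; rewrite inE => /orP[/eqP ->|/Hf]. Qed.

Lemma homog_nil s t : homog s t [::].
Proof. by []. Qed.

Lemma isBlk_split2 s j : isBlk s j -> isBlk s j.+1 ->
  exists w z, s = w ++ None :: None :: z /\ size w = j.
Proof.
move=> /andP[_ /eqP e1] /andP[h /eqP e2].
by have := split_state2 h; rewrite e1 e2.
Qed.

Lemma isBlk_split3 s j : isBlk s j -> isBlk s j.+1 -> isBlk s j.+2 ->
  exists w z, s = w ++ None :: None :: None :: z /\ size w = j.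
Proof.
move=> /andP[_ /eqP e1] /andP[_ /eqP e2] /andP[h /eqP e3].
by have := split_state3 h; rewrite e1 e2 e3.
Qed.

Lemma rel_homog (r : seq (R * word)) : klrw_rel N r -> exists s t, homog s t r.
Proof.
case=> {r}.
- move=> s j b1 b2; have [w [z [-> <-]]] := isBlk_split2 b1 b2.
  exists (w ++ None :: None :: z), (w ++ None :: None :: z).
  do 1![apply: homog_cons; [by []|by rewrite [_.2.2]/= !runE|]]; exact: homog_nil.
- move=> s j b1 b2; have [w [z [-> <-]]] := isBlk_split2 b1 b2.
  exists (w ++ None :: None :: z), (w ++ None :: None :: z).
  do 3![apply: homog_cons; [by []|by rewrite [_.2.2]/= ?runE|]]; exact: homog_nil.
- move=> s j b1 b2; have [w [z [-> <-]]] := isBlk_split2 b1 b2.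
  exists (w ++ None :: None :: z), (w ++ None :: None :: z).
  do 3![apply: homog_cons; [by []|by rewrite [_.2.2]/= ?runE|]]; exact: homog_nil.
- move=> s j b1 b2 b3; have [w [z [-> <-]]] := isBlk_split3 b1 b2 b3.
  exists (w ++ [:: None, None, None & z]), (w ++ [:: None, None, None & z]).
  do 2![apply: homog_cons; [by []|by rewrite [_.2.2]/= ?runE|]]; exact: homog_nil.
- move=> s j i b1 b2; have h := isRed_size b2; move: b1 b2 => /andP[_ /eqP b1] /eqP b2.
  have [w [z [E <-]]] := split_state2 h; rewrite b1 b2 in E; rewrite E.
  exists (w ++ [:: None, Some i & z]), (w ++ [:: Some i, None & z]).
  do 2![apply: homog_cons; [by []|by rewrite [_.2.2]/= ?runE|]]; exact: homog_nil.
- move=> s j i b1 b2; have h := isBlk_size b2; move: b1 b2 => /eqP b1 /andP[_ /eqP b2].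
  have [w [z [E <-]]] := split_state2 h; rewrite b1 b2 in E; rewrite E.
  exists (w ++ [:: Some i, None & z]), (w ++ [:: None, Some i & z]).
  do 2![apply: homog_cons; [by []|by rewrite [_.2.2]/= ?runE|]]; exact: homog_nil.
- move=> s j i b1 b2; have h := isRed_size b2; move: b1 b2 => /andP[_ /eqP b1] /eqP b2.
  have [w [z [E <-]]] := split_state2 h; rewrite b1 b2 in E; rewrite E.
  exists (w ++ [:: None, Some i & z]), (w ++ [:: None, Some i & z]).
  do 2![apply: homog_cons; [by []|by rewrite [_.2.2]/= ?runE ?run_dots ?isBlk_cat0|]].
  exact: homog_nil.
- move=> s j i b1 b2; have h := isBlk_size b2; move: b1 b2 => /eqP b1 /andP[_ /eqP b2].
  have [w [z [E <-]]] := split_state2 h; rewrite b1 b2 in E; rewrite E.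
  exists (w ++ [:: Some i, None & z]), (w ++ [:: Some i, None & z]).
  do 2![apply: homog_cons; [by []|by rewrite [_.2.2]/= ?runE ?run_dots ?isBlk_cat1|]].
  exact: homog_nil.
- move=> s j i b1 b2 b3; have h := isBlk_size b3.
  move: b1 b2 b3 => /eqP b1 /andP[_ /eqP b2] /andP[_ /eqP b3].
  have [w [z [E <-]]] := split_state3 h; rewrite b1 b2 b3 in E; rewrite E.
  exists (w ++ [:: Some i, None, None & z]), (w ++ [:: None, None, Some i & z]).
  do 2![apply: homog_cons; [by []|by rewrite [_.2.2]/= ?runE|]]; exact: homog_nil.
- move=> s j i b1 b2 b3; have h := isRed_size b3.
  move: b1 b2 b3 => /andP[_ /eqP b1] /andP[_ /eqP b2] /eqP b3.
  have [w [z [E <-]]] := split_state3 h; rewrite b1 b2 b3 in E; rewrite E.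
  exists (w ++ [:: None, None, Some i & z]), (w ++ [:: Some i, None, None & z]).
  do 2![apply: homog_cons; [by []|by rewrite [_.2.2]/= ?runE|]]; exact: homog_nil.
- move=> s j i b1 b2 b3; have h := isBlk_size b3.
  move: b1 b2 b3 => /andP[_ /eqP b1] /eqP b2 /andP[_ /eqP b3].
  have [w [z [E <-]]] := split_state3 h; rewrite b1 b2 b3 in E; rewrite E.
  exists (w ++ [:: None, Some i, None & z]), (w ++ [:: None, Some i, None & z]).
  do 2![apply: homog_cons; [by []|by rewrite [_.2.2]/= ?runE|]].
  move=> x /mapP[k _ ->] /=; split=> //.
  by rewrite run_cat !run_dots ?isBlk_cat0 ?isBlk_cat2.
- move=> s b; exists s, s.
  do 2![apply: homog_cons; [by []|by rewrite /= b /= b|]]; exact: homog_nil.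
- move=> s b; exists s, s.
  do 1![apply: homog_cons; [by []|by rewrite /= b /= b|]]; exact: homog_nil.
- move=> s b1 b2; have [w [z [E H0]]] := isBlk_split2 b1 b2; exists s, s.
  move: E; rewrite (size0nil H0) /= => ->.
  do 2![apply: homog_cons; [by []|by rewrite /= /swapS /= !drop0|]]; exact: homog_nil.
move=> s g h Hf Hv; move: (Hv) (run_far Hf Hv); rewrite {1}/valid /top.
case E: (run _ _) => [t|] // _ E'; exists s, t.
do 2![apply: homog_cons; [by []|by []|]]; exact: homog_nil.
Qed.

(** By homogeneity, one valid term between [vs] and [us] makes all terms valid there, with the same
    top. *)
Lemma rel_ideal (r : seq (R * word)) s0 vs us e s gs t : klrw_rel N r -> (e, (s, gs)) \in r ->
  run s0 vs = Some s -> run s0 (vs ++ gs ++ us) = Some t ->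
  in_ideal N [seq (x.1, (s0, vs ++ x.2.2 ++ us)) | x <- r] /\
  forall x, x \in r -> run s0 (vs ++ x.2.2 ++ us) = Some t.
Proof.
move=> Hr Hin Hv Hrun; have [s' [t' H]] := rel_homog Hr.
have [/= E1 E2] := H _ Hin; subst s'.
move: Hrun; rewrite run_cat Hv run_cat E2 => Ht.
split; last first.
  by move=> x /H[_ Hx]; rewrite run_cat Hv run_cat Hx.
by rewrite -(fmul_homog us H Hv); apply: I_gen => //; rewrite /valid /top /= ?Ht ?Hv.
Qed.

End Ideal.

(** * Spanning *)

Section Span.
Variables (R : comPzRingType) (N : seq nat) (s0 : seq strand).
Implicit Types (Q : seq gen -> Prop) (gs vs us : seq gen) (t : seq strand).

Definition emb (f : seq (R * seq gen)) : seq (R * word) := [seq (x.1, (s0, x.2)) | x <- f].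

(** Congruence of [gs] to a combination of words satisfying [Q]. Validity and the top state are kept
    apart from [Q], which can then be purely combinatorial. *)
Definition spn t Q gs : Prop := exists f : seq (R * seq gen),
  (forall x, x \in f -> Q x.2 /\ run s0 x.2 = Some t) /\
  congT N [:: (1%R, (s0, gs))] (emb f).

Lemma spn_self t Q gs : Q gs -> run s0 gs = Some t -> spn t Q gs.
Proof.
move=> H1 H2; exists [:: (1%R, gs)]; split; last exact: congT_refl.
by move=> x; rewrite inE => /eqP ->.
Qed.

Lemma spn_comb t Q (f : seq (R * seq gen)) : (forall x, x \in f -> spn t Q x.2) ->
  exists f' : seq (R * seq gen), (forall x, x \in f' -> Q x.2 /\ run s0 x.2 = Some t) /\
    congT N (emb f) (emb f').
Proof.
elim: f => [|x f IH] H; first by exists [::]; split=> //; apply: congT_refl.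
have [f1 [Hf1 C1]] := H x (mem_head _ _).
have [f2 [Hf2 C2]] := IH (fun y yf => H y (mem_behead (s := x :: f) yf)).
exists ([seq (x.1 * y.1, y.2)%R | y <- f1] ++ f2); split.
  by move=> y; rewrite mem_cat => /orP[/mapP[z /Hf1 zf ->]|/Hf2].
have := congT_add (congT_scale x.1 C1) C2.
rewrite /fscale /= mulr1 /emb map_cat -!map_comp; exact.
Qed.

Lemma spn_trans t Q Q' gs : spn t Q gs ->
  (forall gs', Q gs' -> run s0 gs' = Some t -> spn t Q' gs') -> spn t Q' gs.
Proof.
move=> [f [Hf C]] H; have [|f' [Hf' C']] := @spn_comb t Q' f.
  by move=> x /Hf[H1 H2]; apply: H.
by exists f'; split=> //; apply: congT_trans C'.
Qed.

Lemma spn_top t t' Q Q' gs hs : spn t Q gs -> run s0 gs = Some t ->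
  run t hs = Some t' -> (forall gs', Q gs' -> Q' (gs' ++ hs)) -> spn t' Q' (gs ++ hs).
Proof.
move=> [f [Hf C]] Hgs Hhs HQ; exists [seq (x.1, x.2 ++ hs) | x <- f]; split.
  move=> x /mapP[y yf ->] /=; case: (Hf y yf) => Q1 Q2; split; first exact: HQ.
  by rewrite run_cat Q2.
have Hv : valid (t, hs) by rewrite /valid /top /= Hhs.
have := ideal_tmul Hv C; rewrite (@tmul_homog _ s0) /congT.
  congr (in_ideal N _); rewrite map_cat; congr cat.
  by rewrite /emb /fscale -!map_comp.
move=> x; rewrite mem_cat inE => /orP[/eqP -> //|/mapP[y /mapP[z zf ->] ->] /=].
by case: (Hf z zf).
Qed.

(** A relation can be solved for any term whose coefficient squares to one; it then serves as a
    rewriting rule inside a diagram. *)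
Lemma spn_rel Q r s vs us e gs r' t : klrw_rel N r -> perm_eq r ((e, (s, gs)) :: r') ->
  (e * e = 1 :> R)%R -> run s0 vs = Some s -> run s0 (vs ++ gs ++ us) = Some t ->
  (forall x, x \in r' -> Q (vs ++ x.2.2 ++ us)) -> spn t Q (vs ++ gs ++ us).
Proof.
move=> Hr Hp He Hv Ht HQ.
have Hin : (e, (s, gs)) \in r by rewrite (perm_mem Hp) mem_head.
have [HI HR] := rel_ideal Hr Hin Hv Ht.
exists [seq (- (e * x.1), vs ++ x.2.2 ++ us)%R | x <- r']; split.
  move=> x /mapP[y yr ->] /=; split; first exact: HQ.
  by apply: HR; rewrite (perm_mem Hp) inE yr orbT.
apply: I_ext (I_scale e HI) => D.
rewrite fcoef_scale fcoef_cat fcoef_scale (fcoef_perm (perm_map _ Hp)) /= !fcoef_cons.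
rewrite fcoef_nil addr0 mulrDr /=; congr (_ + _)%R; first by case: eqP; rewrite ?He ?mulr0.
elim: r' {Hp HQ} => [|x r' IH]; first by rewrite !fcoef_nil !mulr0.
rewrite /= !fcoef_cons !mulrDr IH /=; congr (_ + _)%R.
by case: eqP; rewrite ?mulr0 // mulN1r opprK.
Qed.

Lemma spn_weak t Q Q' gs : spn t Q gs -> (forall gs', Q gs' -> Q' gs') -> spn t Q' gs.
Proof.
by move=> H HQ; apply: spn_trans H _ => gs' /HQ H1 H2; apply: spn_self.
Qed.

Lemma spn_far Q vs us g h t : ~~ has (fun p => p \in supp h) (supp g) ->
  run s0 (vs ++ [:: g; h] ++ us) = Some t -> Q (vs ++ [:: h; g] ++ us) ->
  spn t Q (vs ++ [:: g; h] ++ us).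
Proof.
move=> Hf Ht HQ; have [s Hv] := run_catP Ht; rewrite catA in Ht *.
rewrite run_cat => H; have Hval : valid (s, [:: g; h]).
  by rewrite /valid /top; move: H; case: (run s _).
rewrite -catA in Ht *.
apply: (spn_rel (r_far R N Hf Hval) (perm_refl _)) => //; first by rewrite mulr1.
by move=> x; rewrite inE => /eqP ->.
Qed.

Lemma nilhecke_perm (a b c : R * word) : perm_eq [:: a; b; c] [:: b; a; c].
Proof. by rewrite (perm_catCA [:: a] [:: b] [:: c]). Qed.

(** The correction term of the nilHecke relation has lost the crossing, so it is smaller for [nd],
    which ignores dots. *)
Lemma spn_dot_past vs us p g t : nondot g ->
  run s0 (vs ++ [:: Dot p; g] ++ us) = Some t ->
  exists p', spn t (fun gs => nd gs < nd (vs ++ g :: us) \/ gs = vs ++ [:: g; Dot p'] ++ us)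
    (vs ++ [:: Dot p; g] ++ us).
Proof.
move=> Hg Ht; have [s Hv] := run_catP Ht; rewrite run_cat.
case Es: (run s [:: Dot p; g]) => [s2|] // _.
move: Es; rewrite /=; case Hp: (isBlk s p) => //; rewrite stepE; case Hok: (okstep g s) => // _.
have [Hf|Hf] := boolP (~~ has (fun q => q \in supp g) (supp (Dot p))).
  by exists p; apply: spn_far => //; right.
have ndE (d : seq gen) : nd d = 0 -> nd (vs ++ d ++ us) < nd (vs ++ g :: us).
  by move=> Hd; rewrite !nd_cat Hd /nd /= Hg; lia.
have E11 : (1 * 1 = 1 :> R)%R by rewrite mulr1.
have ENN : (-1 * -1 = 1 :> R)%R by rewrite mulrNN mulr1.
case: g Hg Hf Hok ndE Ht => [//|j|] _ /=; rewrite negbK ?orbF !inE.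
  move=> Hpj /andP[Hj Hok] ndE Ht.
  case/orP: Hpj Hp => /eqP -> Hp in Ht *.
    case Hq: (isBlk s j.+1).
      exists j.+1; apply: (spn_rel (r_nh1 R N Hp Hq) (perm_refl _)) => // x.
      by rewrite !inE => /orP[] /eqP -> /=; [right | left; apply: (ndE [::])].
    have [i Hi] : exists i, isRed s j.+1 i.
      move: Hq; rewrite /isBlk /isRed Hj /=; case: (nth _ _ _) => // i _; by exists i.
    exists j.+1; apply: (spn_rel (r_dotBR R N Hp Hi) (perm_refl _)) => // x.
    by rewrite !inE => /eqP -> /=; right.
  case Hq: (isBlk s j).
    exists j; have H := r_nh2 R N Hq Hp.
    apply: (spn_rel H (nilhecke_perm _ _ _)) => // x.
    by rewrite !inE => /orP[] /eqP -> /=; [right | left; apply: (ndE [::])].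
  have [i Hi] : exists i, isRed s j i.
    move: Hq; rewrite /isBlk /isRed (ltnW Hj) /=; case: (nth _ _ _) => // i _; by exists i.
  exists j; apply: (spn_rel (r_dotRB R N Hi Hp) (perm_refl _)) => // x.
  by rewrite !inE => /eqP -> /=; right.
move=> /eqP -> Hok ndE Ht.
exists 0; apply: (spn_rel (r_nailDot R N Hok) (perm_refl _)) => // x.
by rewrite !inE => /eqP -> /=; right.
Qed.

Definition isdot (g : gen) : bool := ~~ nondot g.

Lemma nd_dots ds : all isdot ds -> nd ds = 0.
Proof. by move=> H; apply/eqP; rewrite -leqn0 leqNgt -has_count -all_predC. Qed.

Lemma spn_dots_past vs ds g t : all isdot ds -> nondot g ->
  run s0 (vs ++ ds ++ [:: g]) = Some t ->
  spn t (fun gs => nd gs < (nd vs).+1 \/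
          exists2 ds', all isdot ds' & gs = vs ++ g :: ds') (vs ++ ds ++ [:: g]).
Proof.
move=> + Hg; elim/last_ind: ds vs t => [|ds d IH] vs t.
  by move=> _ Ht; apply: spn_self => //; right; exists [::].
rewrite all_rcons => /andP[Hd Hds]; case: d Hd => // p _.
rewrite -cats1 -catA catA => Ht; have [p' H] := spn_dot_past (us := [::]) Hg Ht.
apply: spn_trans H _ => gs [Hlt Hr|-> Hr].
  apply: spn_self => //; left; apply: leq_trans Hlt _.
  by rewrite !nd_cat (nd_dots Hds) addn0 /nd /= Hg addn1.
have E : (vs ++ ds) ++ [:: g; Dot p'] ++ [::] = (vs ++ ds ++ [:: g]) ++ [:: Dot p'].
  by rewrite -!catA.
rewrite E in Hr *; have [t1 Hr1] := run_catP Hr => Hr2.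
apply: (spn_top (IH _ _ Hds Hr1) Hr1 Hr2) => gs' [Hlt|[ds' Hds' ->]].
  by left; rewrite nd_cat (@nd_dots [:: Dot p']) // addn0.
by right; exists (ds' ++ [:: Dot p']); rewrite ?all_cat ?Hds' // -catA.
Qed.

Lemma spn_dots_top gs t : run s0 gs = Some t ->
  spn t (fun gs' => nd gs' < nd gs \/
          exists2 ds, all isdot ds & gs' = filter nondot gs ++ ds) gs.
Proof.
elim/last_ind: gs t => [|gs g IH] t Ht; first by apply: spn_self => //; right; exists [::].
rewrite -cats1 in Ht *; have [t1 Hr1] := run_catP Ht => Hr2.
apply: spn_trans (spn_top (Q' := fun gs' => nd gs' < nd (gs ++ [:: g]) \/
   exists2 ds, all isdot ds & gs' = filter nondot gs ++ ds ++ [:: g]) (IH _ Hr1) Hr1 Hr2 _) _.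
  move=> gs' [H|[ds Hds ->]]; first by left; rewrite !nd_cat; lia.
  by right; exists ds => //; rewrite catA.
move=> gs' [H|[ds Hds ->]] Hr'; first by apply: spn_self => //; left.
case Hg: (nondot g).
  apply: spn_trans (spn_dots_past Hds Hg Hr') _ => gs'' [H|[ds' Hds' ->]] Hr''.
    apply: spn_self => //; left; apply: leq_trans H _.
    by rewrite nd_cat /nd /= Hg count_filter (eq_count (a2 := nondot)) ?addn1 // => x; rewrite /= andbb.
  apply: spn_self => //; right; exists ds' => //.
  by rewrite filter_cat /= Hg -catA.
apply: spn_self => //; right; exists (ds ++ [:: g]); rewrite ?all_cat ?Hds /isdot /= ?Hg //.
by rewrite filter_cat /= Hg cats0.
Qed.

Lemma spn_dots_perm gs ds ds' t : all isdot ds -> perm_eq ds ds' ->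
  run s0 (gs ++ ds) = Some t -> spn t (eq (gs ++ ds')) (gs ++ ds).
Proof.
elim: ds' gs ds t => [|d ds' IH] gs ds t Hds Hp Ht.
  by move/perm_nilP: Hp => E; rewrite E in Ht *; apply: spn_self.
have /splitPr Hd : d \in ds by rewrite (perm_mem Hp) mem_head.
case: Hd Hds Hp Ht => p1 p2 Hds Hp Ht.
have {}Hp : perm_eq (p1 ++ p2) ds'.
  by rewrite -(perm_cons d) -(perm_catCA p1 [:: d] p2).
have Hds2 : all isdot (p1 ++ p2) by move: Hds; rewrite !all_cat /= => /and3P[-> _ ->].
have Hd : isdot d by move: Hds; rewrite all_cat /= => /and3P[].
have H1 : spn t (eq ((gs ++ [:: d]) ++ (p1 ++ p2))) (gs ++ p1 ++ d :: p2).
  have Hp1 : all isdot p1 by move: Hds2; rewrite all_cat => /andP[].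
  clear Hp Hds Hds2; elim/last_ind: p1 p2 Hp1 Ht => [|p1 e IHp] p2 Hp1 Ht.
    by apply: spn_self => //; rewrite -catA.
  move: Hp1; rewrite all_rcons => /andP[He Hp1].
  (* Dots at the same position are the same letter; dots at different positions are far apart. *)
  case: (eqVneq d e) => [Ede|Hde].
    subst e; have E : rcons p1 d ++ d :: p2 = p1 ++ d :: (d :: p2) by rewrite cat_rcons.
    by rewrite E in Ht *; rewrite cat_rcons; apply: IHp.
  have E : gs ++ rcons p1 e ++ d :: p2 = (gs ++ p1) ++ [:: e; d] ++ p2.
    by rewrite cat_rcons -catA.
  rewrite E in Ht *.
  apply: spn_trans (spn_far (Q := eq (gs ++ p1 ++ d :: e :: p2)) _ Ht _) _.
  - case: d e Hd He Hde {E Ht IHp} => [p||] //= [q||] //= _ _; rewrite orbF inE.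
    by apply: contra => /eqP ->.
  - by rewrite -catA.
  by move=> _ <- Hr; rewrite cat_rcons; apply: IHp.
apply: spn_trans H1 _ => _ <- Hr; rewrite -cat1s catA.
exact: IH.
Qed.

End Span.

(** * Braid moves and Matsumoto's theorem for diagrams *)

Lemma desc_cat0 u x y z : desc (Cr (size u)) (u ++ x :: y :: z) = (y < x)%R.
Proof.
rewrite /= size_cat /= !nth_cat ltnn (_ : (size u).+1 < size u = false); last by lia.
by rewrite subnn subSnn /= !addnS !ltnS leq_addr.
Qed.

Lemma desc_cat1 u x y y' z : desc (Cr (size u).+1) (u ++ x :: y :: y' :: z) = (y' < y)%R.
Proof. by rewrite -cat_rcons -(size_rcons u x) desc_cat0. Qed.

Lemma swp_cat1 (T : Type) u (x y y' : T) z :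
  swp (size u).+1 (u ++ x :: y :: y' :: z) = u ++ x :: y' :: y :: z.
Proof. by rewrite -cat_rcons -(size_rcons u x) swp_cat cat_rcons. Qed.

Section Matsumoto.
Variables (R : comPzRingType) (N : seq nat) (s0 : seq strand).
Let n := size s0.
Notation adm := (adm s0).
Notation cst := (cst s0).
Notation spn := (spn R N s0).
Implicit Types (c : conf) (g h : gen).

(** Both words are read downwards from [c]: as the top part of any diagram, the first may be
    replaced by the second modulo fewer crossings and nails. *)
Definition braided c (d1 d2 : seq gen) : Prop :=
  forall vs, run s0 vs = Some (cst (crun d1 c)) ->
    spn (cst c) (fun gs => nd gs < nd (vs ++ rev d1) \/ gs = vs ++ rev d2) (vs ++ rev d1).

(** The two words are the reduced expressions of the longest element of the rank two group generated
    by g and h, one starting with each. *)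
Definition braid_pair c g h : Prop := exists d1 d2,
  [/\ dpath c (g :: d1), dpath c (h :: d2), crun (g :: d1) c = crun (h :: d2) c,
      braided c (g :: d1) (h :: d2) & braided c (h :: d2) (g :: d1)].

Lemma braid_pair_sym c g h : braid_pair c g h -> braid_pair c h g.
Proof. by case=> d1 [d2 [H1 H2 H3 H4 H5]]; exists d2, d1. Qed.

Lemma braided_rel r c d1 d2 r' (e : R) : adm c -> dpath c d1 ->
  klrw_rel N r -> (e * e = 1)%R ->
  perm_eq r ((e, (cst (crun d1 c), rev d1)) :: r') ->
  (forall x, x \in r' -> nd x.2.2 < nd d1 \/ x.2.2 = rev d2) ->
  braided c d1 d2.
Proof.
move=> Hc Hd Hr He Hp Hx vs Hv; have [_ Ht] := adm_dpath Hc Hd.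
rewrite -[rev d1]cats0; apply: (spn_rel Hr Hp He Hv); first by rewrite cats0 run_cat Hv.
move=> x /Hx[H|->]; [left|right]; rewrite !cats0 // !nd_cat ltn_add2l.
by rewrite {2}/nd count_rev.
Qed.

Lemma braid_pair_far c g h : adm c -> desc g c -> desc h c ->
  ~~ has (fun p => p \in supp h) (supp g) -> braid_pair c g h.
Proof.
have key g' h' c' : cgood c' -> desc g' c' -> desc h' c' ->
    ~~ has (fun p => p \in supp h') (supp g') ->
    desc h' (cact g' c') /\ cact h' (cact g' c') = cact g' (cact h' c').
  case: g' h' => [//|i|] [//|j|] //= _ /[swap]; rewrite ?inE.
  - move=> /andP[Hj Hd] /andP[Hi _] Hf; rewrite size_swp !nth_swp // Hj.
    rewrite /swapn; do ![case: eqP => [?|_]; first by lia]; split=> //.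
    by case: (ltnP i j) => Hij; [apply: swp_comm | apply/esym/swp_comm]; lia.
  - by move=> Hd /andP[Hi _] Hf; case: i Hi Hf => // i; case: c' Hd => [|x [|y c']] //=.
  - by case/andP; case: j => // j Hj Hd _ _; case: c' Hj Hd => [|x [|y c']] //= -> ->.
move=> Hc Hg Hh Hf.
have Hf' : ~~ has (fun p => p \in supp g) (supp h).
  by apply: contra Hf => /hasP[p H1 H2]; apply/hasP; exists p.
have [K1 K2] := key g h c (adm_good Hc) Hg Hh Hf.
have [K3 _] := key h g c (adm_good Hc) Hh Hg Hf'.
have E : crun [:: g; h] c = crun [:: h; g] c by [].
have P1 : dpath c [:: g; h] by rewrite /= Hg K1.
have P2 : dpath c [:: h; g] by rewrite /= Hh K3.
exists [:: h], [:: g]; split=> //.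
  move=> vs Hv; rewrite -[rev [:: g; h]]cats0; apply: spn_far => //; last by right.
  by rewrite cats0 run_cat Hv; case: (adm_dpath Hc P1).
move=> vs Hv; rewrite -[rev [:: h; g]]cats0; apply: spn_far => //; last by right.
by rewrite cats0 run_cat Hv; case: (adm_dpath Hc P2).
Qed.

Lemma one1 : (1 * 1 = 1 :> R)%R. Proof. exact: mulr1. Qed.
Lemma oneN : (-1 * -1 = 1 :> R)%R. Proof. by rewrite mulrNN mulr1. Qed.

Lemma braid_pair_nail c : adm c -> desc Nail c -> desc (Cr 0) c -> braid_pair c Nail (Cr 0).
Proof.
move=> Hc HN HC; have Ha := adm_desc Hc HC.
case: c Hc HN HC Ha => [|x [|y z]] // Hc /= Hx Hyx _.
(* Since y < x < 0, all four letters descend, in either order. *)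
have P1 : dpath (x :: y :: z) [:: Nail; Cr 0; Nail; Cr 0] by rewrite /=; lia.
have P2 : dpath (x :: y :: z) [:: Cr 0; Nail; Cr 0; Nail] by rewrite /=; lia.
have /allP Hb : all (fun x => (x < 0)%R ==> (colour s0 x == None)) [:: x, y & z].
  by case/and3P: Hc.
have b1 : isBlk (cst (crun [:: Nail; Cr 0; Nail; Cr 0] (x :: y :: z))) 0.
  by rewrite /isBlk /= colourN; apply: (implyP (Hb x (mem_head _ _))).
have b2 : isBlk (cst (crun [:: Nail; Cr 0; Nail; Cr 0] (x :: y :: z))) 1.
  rewrite /isBlk /= colourN; apply: (implyP (Hb y _)); last by lia.
  by rewrite !inE eqxx orbT.
have Hr := r_nailCr R N b1 b2.
exists [:: Cr 0; Nail; Cr 0], [:: Nail; Cr 0; Nail]; split=> //.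
  apply: (braided_rel Hc P1 Hr one1).
    by rewrite (perm_catC [:: _] [:: _]); apply: perm_refl.
  by move=> w; rewrite inE => /eqP ->; right.
apply: (braided_rel Hc P2 Hr one1); first exact: perm_refl.
by move=> w; rewrite inE => /eqP ->; right.
Qed.

Lemma braid_pair_adj c j : adm c -> desc (Cr j) c -> desc (Cr j.+1) c ->
  braid_pair c (Cr j) (Cr j.+1).
Proof.
move=> Hc Hd1 Hd2.
have Hj : j.+2 < size c by case/andP: Hd2.
have [u [x [y [z [Ec Eu]]]]] := split_two (ltnW Hj).
case: z Ec => [|y' z] Ec; first by move: Hj; rewrite Ec size_cat /= Eu; lia.
subst c j; rewrite desc_cat0 in Hd1; rewrite desc_cat1 in Hd2.
set j := size u; set c := u ++ _ in Hc Hj *.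
have P1 : dpath c [:: Cr j; Cr j.+1; Cr j].
  by rewrite /dpath /cact /c /j desc_cat0 Hd1 swp_cat desc_cat1 swp_cat1 desc_cat0 Hd2 andbT; lia.
have P2 : dpath c [:: Cr j.+1; Cr j; Cr j.+1].
  by rewrite /dpath /cact /c /j desc_cat1 Hd2 swp_cat1 desc_cat0 swp_cat desc_cat1 Hd1 andbT; lia.
have E1 : crun [:: Cr j; Cr j.+1; Cr j] c = u ++ y' :: y :: x :: z.
  by rewrite -[LHS]/(swp j (swp j.+1 (swp j c))) /c /j swp_cat swp_cat1 swp_cat.
have E2 : crun [:: Cr j.+1; Cr j; Cr j.+1] c = u ++ y' :: y :: x :: z.
  by rewrite -[LHS]/(swp j.+1 (swp j (swp j.+1 c))) /c /j swp_cat1 swp_cat swp_cat1.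
exists [:: Cr j.+1; Cr j], [:: Cr j; Cr j.+1].
have Est : cst (u ++ y' :: y :: x :: z) = cst u ++ colour s0 y' :: colour s0 y :: colour s0 x :: cst z.
  by rewrite /cst map_cat.
have Hsu : size (cst u) = j by rewrite size_map.
have c0 : isBlk (cst (u ++ y' :: y :: x :: z)) j = (colour s0 y' == None).
  by rewrite Est -Hsu isBlk_cat0.
have c1 : isBlk (cst (u ++ y' :: y :: x :: z)) j.+1 = (colour s0 y == None).
  by rewrite Est -Hsu isBlk_cat1.
have c2 : isBlk (cst (u ++ y' :: y :: x :: z)) j.+2 = (colour s0 x == None).
  by rewrite Est -Hsu isBlk_cat2.
have d0 i : isRed (cst (u ++ y' :: y :: x :: z)) j i = (colour s0 y' == Some i).
  by rewrite /isRed Est nth_cat Hsu ltnn subnn.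
have d1 i : isRed (cst (u ++ y' :: y :: x :: z)) j.+1 i = (colour s0 y == Some i).
  by rewrite /isRed Est nth_cat Hsu ltnNge leqnSn subSnn.
have d2 i : isRed (cst (u ++ y' :: y :: x :: z)) j.+2 i = (colour s0 x == Some i).
  have [E3 E4] : (j.+2 < j) = false /\ j.+2 - j = 2 by clear; lia.
  by rewrite /isRed Est nth_cat Hsu E3 E4.
have Hrel (r' : seq (R * word)) :
    klrw_rel N [:: (1%R, (cst (u ++ y' :: y :: x :: z), [:: Cr j; Cr j.+1; Cr j])),
      ((-1)%R, (cst (u ++ y' :: y :: x :: z), [:: Cr j.+1; Cr j; Cr j.+1])) & r'] ->
    (forall w, w \in r' -> nd w.2.2 < 3) ->
    braided c [:: Cr j; Cr j.+1; Cr j] [:: Cr j.+1; Cr j; Cr j.+1] /\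
    braided c [:: Cr j.+1; Cr j; Cr j.+1] [:: Cr j; Cr j.+1; Cr j].
  move=> Hr Hr'; split.
    apply: (braided_rel Hc P1 Hr one1); first by rewrite E1; apply: perm_refl.
    by move=> w; rewrite inE => /orP[/eqP ->|/Hr']; [right | left].
  apply: (braided_rel Hc P2 Hr oneN).
    by rewrite E2 (perm_catCA [:: _] [:: _]); apply: perm_refl.
  by move=> w; rewrite inE => /orP[/eqP ->|/Hr']; [right | left].
suff [] : braided c [:: Cr j; Cr j.+1; Cr j] [:: Cr j.+1; Cr j; Cr j.+1] /\
    braided c [:: Cr j.+1; Cr j; Cr j.+1] [:: Cr j; Cr j.+1; Cr j].
  by move=> B1 B2; split=> //; rewrite E1 E2.
(* The three labels are pairwise inverted, and two red strands never are. So at most one strand is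
   red, and its place selects the braid relation. *)
have [Hxy Hxy' Hyy'] : [/\ (colour s0 x == None) || (colour s0 y == None),
    (colour s0 x == None) || (colour s0 y' == None) & (colour s0 y == None) || (colour s0 y' == None)].
  case/and3P: Hc => _ _; rewrite /c pairwise_cat /= => /and3P[_ _].
  move=> /and4P[/and3P[A1 A2 _] /andP[A3 _] _ _].
  by move: A1 A2 A3; case: (colour s0 x == None); case: (colour s0 y == None);
    case: (colour s0 y' == None) => //=; lia.
case Hx: (colour s0 x) Hxy Hxy' c2 d2 => [i|] /=.
  move=> Hy Hy' _ d2; apply: (Hrel [::]) => //.
  by apply: (@r_braidBBR R N _ _ i); rewrite ?c0 ?c1 ?d2.
move=> _ _ c2 _; case Hy: (colour s0 y) Hyy' c1 d1 => [i|] /=.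
  move=> Hy' _ d1; apply: Hrel; first by apply: (@r_braidBRB R N _ _ i); rewrite ?c0 ?c2 ?d1.
  move=> w /mapP[k _ ->] /=; rewrite nd_cat !nd_dots //; apply/allP => g; rewrite mem_nseq.
    by case/andP=> _ /eqP ->.
  by case/andP=> _ /eqP ->.
move=> _ c1 _; case Hy': (colour s0 y') c0 d0 => [i|] /= c0 d0; apply: (Hrel [::]) => //.
  by apply: (@r_braidRBB R N _ _ i); rewrite ?d0 ?c1 ?c2.
by apply: r_braidBBB; rewrite ?c0 ?c1 ?c2.
Qed.

Lemma braid_pairP c g h : adm c -> desc g c -> desc h c -> g != h -> braid_pair c g h.
Proof.
move=> Hc Hg Hh Hgh.
have [Hf|Hf] := boolP (~~ has (fun p => p \in supp h) (supp g)).
  exact: braid_pair_far.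
case: g h Hg Hh Hgh Hf => [//|i|] [//|j|] //=; rewrite negbK ?orbF !inE => Hg Hh.
- move=> Hij Hsupp.
  have {Hij} : i != j by apply: contraNneq Hij => ->.
  move=> Hij; have [E|E] : j = i.+1 \/ i = j.+1 by lia.
    by subst j; apply: braid_pair_adj.
  by subst i; apply: braid_pair_sym; apply: braid_pair_adj.
- move=> _ Hi; have E : i = 0 by lia.
  by subst i; apply: braid_pair_sym; apply: braid_pair_nail.
move=> _ Hj; have E : j = 0 by lia.
by subst j; apply: braid_pair_nail.
Qed.

(** The square of a nail or of a black crossing is zero, and that of a black/red crossing is a
    product of dots, so the two letters disappear. *)
Lemma spn_double vs g t : nondot g -> run s0 (vs ++ [:: g; g]) = Some t ->
  spn t (fun gs => nd gs < nd (vs ++ [:: g; g])) (vs ++ [:: g; g]).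
Proof.
move=> Hg Ht; have [s Hv H2] := run_catP Ht.
have ok : okstep g s by move: H2; rewrite /= stepE; case: (okstep g s).
have lower d : nd d = 0 -> nd (vs ++ d ++ [::]) < nd (vs ++ [:: g; g]).
  by move=> Hd; rewrite !nd_cat Hd /nd /= Hg; lia.
have dots0 k p : nd (nseq k (Dot p)) = 0.
  by apply: nd_dots; apply/allP => d; rewrite mem_nseq => /andP[_ /eqP ->].
rewrite -{2}[[:: g; g]]cats0 in Ht *.
case: g Hg ok lower Ht {H2} => [//|j|] _ /=; last first.
  by move=> Hb lower Ht; apply: (spn_rel (r_nail2 R N Hb) (perm_refl _) one1).
move=> /andP[Hj Hb] lower Ht.
case Hb0: (isBlk s j); case Hb1: (isBlk s j.+1).
- by apply: (spn_rel (r_ccBB R N Hb0 Hb1) (perm_refl _) one1).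
- have [i Hi] : exists i, isRed s j.+1 i.
    by move: Hb1; rewrite /isBlk /isRed Hj /=; case: (nth _ _ _) => // i _; exists i.
  apply: (spn_rel (r_ccBR R N Hb0 Hi) (perm_refl _) one1) => // x.
  by rewrite inE => /eqP -> /=; apply: lower.
- have [i Hi] : exists i, isRed s j i.
    by move: Hb0; rewrite /isBlk /isRed (ltnW Hj) /=; case: (nth _ _ _) => // i _; exists i.
  apply: (spn_rel (r_ccRB R N Hi Hb1) (perm_refl _) one1) => // x.
  by rewrite inE => /eqP -> /=; apply: lower.
by rewrite Hb0 Hb1 in Hb.
Qed.

Lemma nd_nondot gs : all nondot gs -> nd gs = size gs.
Proof. by move=> H; apply/eqP; rewrite -all_count. Qed.

(* Matsumoto's theorem for the hyperoctahedral group, modulo fewer crossings *)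
Lemma spn_reduce k gs t : size gs = k -> all nondot gs -> run s0 gs = Some t ->
  (len (crun gs (idc n)) < k -> spn t (fun gs' => nd gs' < k) gs) /\
  (len (crun gs (idc n)) = k -> forall gs', size gs' = k -> all nondot gs' ->
     run s0 gs' = Some t -> crun gs' (idc n) = crun gs (idc n) ->
     spn t (fun gs'' => nd gs'' < k \/ gs'' = gs') gs).
Proof.
have run_adm gs1 t1 : run s0 gs1 = Some t1 ->
    adm (crun gs1 (idc n)) /\ t1 = cst (crun gs1 (idc n)).
  rewrite -{1}(cst_idc s0) => H; split; last exact: run_cst H.
  apply: adm_run H; apply/and3P; split; rewrite ?abs_idc //.
    by apply/allP => x /mapP[p _ ->].
  rewrite /idc pairwise_map; have := iota_ltn_sorted 1 n.
  rewrite sorted_pairwise; last exact: ltn_trans.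
  by apply: sub_pairwise => x y /= Hxy; apply/implyP => _; lia.
have len_le gs1 : len (crun gs1 (idc n)) <= size gs1.
  by have := len_crun_le gs1 (cgood_idc n); rewrite len_idc.
elim: k gs t => [|k IH] gs t Hs Hnd Ht.
  split=> // _ gs' Hs' _ _ _; rewrite (size0nil Hs) (size0nil Hs') in Ht *.
  by apply: spn_self => //; right.
case/lastP: gs Hs Hnd Ht => // g1 g; rewrite size_rcons all_rcons => -[Hs] /andP[Hg Hnd] Ht.
have [t1 Ht1 Hst] := run_rconsP Ht; rewrite crun_rcons.
have [Ha Et1] := run_adm _ _ Ht1; have [Hac Et] := run_adm _ _ Ht; rewrite crun_rcons in Hac Et.
have Hrg : run t1 [:: g] = Some t by rewrite /= Hst.
set c1 := crun g1 (idc n) in Ha Et1 Hac Et *.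
have [IH1 IH2] := IH _ _ Hs Hnd Ht1; rewrite -/c1 in IH1 IH2.
have ndS gs' : nd (gs' ++ [:: g]) = (nd gs').+1 by rewrite nd_cat /nd /= Hg addn1.
have Hc1 : len c1 <= k by rewrite -Hs; apply: len_le.
have [Hlt|Hge] := ltnP (len c1) k.
  have Hsp : spn t (fun gs' => nd gs' < k.+1) (rcons g1 g).
    rewrite -cats1; apply: (spn_top (IH1 Hlt) Ht1 Hrg) => gs' H.
    by rewrite ndS.
  split=> // Hl; have := len_cact_le g (adm_good Ha); rewrite Hl; lia.
have {Hge}Hl1 : len c1 = k by lia.
(* If g descends, induction trades [g1] for a reduced word [rcons e g] of the same configuration,
   which creates the square of g. *)
case Hd: (desc g c1).
  have Hl := len_desc (adm_good Ha) Hd.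
  split=> [_|]; last by lia.
  have [e [He1 He2 He3 He4]] := adm_word Hac.
  have Ek : size (rcons e g) = k by rewrite size_rcons He1 -Hl.
  have Hre : run s0 (rcons e g) = Some t1.
    by apply: run_rcons He3 _; rewrite Et1; case: (adm_desc Ha Hd).
  have Hce : crun (rcons e g) (idc n) = c1 by rewrite crun_rcons He4 cactK.
  have Hne : all nondot (rcons e g) by rewrite all_rcons Hg.
  have := IH2 Hl1 _ Ek Hne Hre Hce => Hsp.
  rewrite -cats1; apply: spn_trans (spn_top (Q' := fun gs' => nd gs' < k.+1 \/
    gs' = e ++ [:: g; g]) Hsp Ht1 Hrg _) _.
    by move=> gs' [H|->]; [left; rewrite ndS | right; rewrite -cats1 -catA].
  move=> gs' [H|->] Hr'; first exact: spn_self.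
  apply: spn_weak (spn_double Hg Hr') _ => gs''.
  by rewrite nd_cat (nd_nondot He2) He1 /nd /= Hg; lia.
have Hr : inrange g (size c1).
  by move: Hst; rewrite Et1 stepE; case: g Hg {Ht Hac Et Hrg ndS Hd} => [//|j|] _ /=;
    rewrite /isBlk size_map; case: ifP => //; case/andP.
have Hl : len (cact g c1) = k.+1 by rewrite len_asc ?Hd ?Hl1 ?(adm_good Ha).
split=> [|_ gs']; first by rewrite Hl ltnn.
case/lastP: gs' => // g1' g'; rewrite size_rcons all_rcons => -[Hs'] /andP[Hg' Hnd'] Ht'.
rewrite crun_rcons; set c1' := crun g1' (idc n) => Ec.
have [t1' Ht1' Hst'] := run_rconsP Ht'.
have [Ha' Et1'] := run_adm _ _ Ht1'; rewrite -/c1' in Ha' Et1'.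
have Hrg' : run t1' [:: g'] = Some t by rewrite /= Hst'.
have ndS' gs' : nd (gs' ++ [:: g']) = (nd gs').+1 by rewrite nd_cat /nd /= Hg' addn1.
have Hl1' : len c1' = k.
  apply/eqP; rewrite eqn_leq -{1}Hs' len_le /= -ltnS -Hl -Ec.
  exact: len_cact_le (adm_good Ha').
have dsc h c' : adm c' -> len c' = k -> cact h c' = cact g c1 -> desc h (cact g c1).
  move=> Hc' Hlc E; have Hrh : inrange h (size c').
    apply: contraT => Ho; move: Hl; rewrite -E cact_oob // Hlc; lia.
  rewrite -E desc_cact ?(adm_good Hc') //; apply/negP => /(len_desc (adm_good Hc')).
  by rewrite E Hl; lia.
have Dg := dsc g c1 Ha Hl1 erefl; have Dg' := dsc g' c1' Ha' Hl1' Ec.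
have [Egg|Hgg] := eqVneq g g'.
  subst g'; have E1 : c1' = c1 by rewrite -[c1'](cactK g) Ec cactK.
  have Ht1'' : run s0 g1' = Some t1 by rewrite Et1 -E1 -Et1'.
  have Hsp := IH2 Hl1 g1' Hs' Hnd' Ht1'' E1.
  rewrite -!cats1; apply: (spn_top Hsp Ht1 Hrg) => gs' [H|->]; last by right.
  by left; rewrite ndS.
(* The last letters differ, and both descend from the common configuration. With e a reduced word of
   the configuration below the braid, [g1] becomes [e ++ rev d1] by induction, the braid move passes
   to [d2] and [g'], and [e ++ rev d2] becomes [g1'] by induction. *)
have [d1 [d2 [P1 P2 E12 B1 _]]] := braid_pairP Hac Dg Dg' Hgg.
set c := cact g c1 in Hac Et Hl Ec Dg Dg' P1 P2 E12 B1.
have [Hac' Hr1] := adm_dpath Hac P1.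
have [_ Hr2] := adm_dpath Hac P2.
have [e [He1 He2 He3 He4]] := adm_word Hac'.
have word_of h d c' tc : cact h c' = c -> tc = cst c' -> len c' = k -> adm c' ->
    dpath c (h :: d) -> crun (h :: d) c = crun (g :: d1) c ->
    [/\ size (e ++ rev d) = k, all nondot (e ++ rev d), run s0 (e ++ rev d) = Some tc
      & crun (e ++ rev d) (idc n) = c'].
  move=> Hc' -> Hlc Hadc Hp Hcr; have Ec' : c' = cact h c by rewrite -Hc' cactK.
  have /= Hd' := Hp; case/andP: Hd' => _ Hp'; rewrite -Ec' in Hp'.
  have Hcr' : crun d c' = crun (g :: d1) c by rewrite -Hcr /= -Ec'.
  have Hlen := dpath_len (adm_good Hadc) Hp'; rewrite Hcr' in Hlen.
  split.
  - by rewrite size_cat size_rev He1 -Hlen.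
  - by rewrite all_cat He2 all_rev (dpath_nondot Hp').
  - rewrite run_cat He3 -Hcr'; by case: (adm_dpath Hadc Hp').
  - by rewrite crun_cat He4 -Hcr' crun_revK.
have [W1 W2 W3 W4] := word_of g d1 c1 t1 erefl Et1 Hl1 Ha P1 erefl.
have [W1' W2' W3' W4'] := word_of g' d2 c1' t1' Ec Et1' Hl1' Ha' P2 (esym E12).
rewrite -!cats1.
apply: spn_trans (spn_top (Q' := fun gs' => nd gs' < k.+1 \/ gs' = e ++ rev (g :: d1))
  (IH2 Hl1 _ W1 W2 W3 W4) Ht1 Hrg _) _.
  move=> gs' [H|->]; first by left; rewrite ndS.
  by right; rewrite rev_cons -cats1 catA.
move=> gs' [H|->] Hr'; first by apply: spn_self => //; left.
have := B1 e He3; rewrite -Et => Hb; apply: spn_trans Hb _ => gs'' [H|->] Hr''.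
  apply: spn_self => //; left; apply: leq_trans H _.
  by rewrite rev_cons -cats1 catA ndS ltnS (nd_nondot W2) W1.
have [_ IH2'] := IH _ _ W1' W2' W3'; rewrite W4' in IH2'.
have Hsp := IH2' Hl1' g1' Hs' Hnd' Ht1' erefl.
rewrite rev_cons -cats1 catA; apply: (spn_top Hsp W3' Hrg') => gs3 [H|->]; last by right.
by left; rewrite ndS'.
Qed.

End Matsumoto.

(** * The words b_(w,l,a) are reduced *)

Lemma stateOf_cons x s : stateOf (x :: s) =
  nseq x None ++ flatten [seq Some i :: nseq (nth 0 s i) None | i <- iota 0 (size s)].
Proof. by []. Qed.

Lemma pmap_stateOf kap : pmap id (stateOf kap) = iota 0 (size kap).-1.
Proof.
rewrite /stateOf pmap_cat; have N0 k : pmap id (nseq k (@None nat)) = [::] by elim: k.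
by rewrite N0 /=; elim: (iota 0 _) => //= i s IH; rewrite pmap_cat N0 /= IH.
Qed.

Lemma count_stateOf kap : 0 < size kap -> count (pred1 None) (stateOf kap) = sumn kap.
Proof.
case: kap => // x s _; rewrite stateOf_cons count_cat count_nseq /= mul1n; congr addn.
rewrite count_flatten -map_comp -[in RHS](mkseq_nth 0 s) /mkseq.
by congr sumn; apply: eq_map => i /=; rewrite count_nseq mul1n.
Qed.

Lemma size_stateOf b r kap : in_P b r kap -> size (stateOf kap) = b + r.
Proof.
move=> /andP[/eqP Hs /eqP Hb].
rewrite -(count_predC (pred1 None)) count_stateOf ?Hs // Hb; congr addn.
transitivity (size (pmap id (stateOf kap))); last by rewrite pmap_stateOf size_iota Hs.
by rewrite size_pmap; apply: eq_count; case.
Qed.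

Definition blacks (kap : seq nat) : seq nat :=
  [seq p <- iota 0 (size (stateOf kap)) | nth None (stateOf kap) p == None].

Lemma size_blacks b r kap : in_P b r kap -> size (blacks kap) = b.
Proof.
move=> /andP[/eqP Hs /eqP <-]; rewrite -count_stateOf ?Hs //.
rewrite size_filter -[in RHS](mkseq_nth None (stateOf kap)) count_map.
by apply: eq_count.
Qed.

Lemma uniq_blacks kap : uniq (blacks kap).
Proof. by rewrite filter_uniq ?iota_uniq. Qed.

Lemma mem_blacks kap t :
  (t \in blacks kap) = (t < size (stateOf kap)) && (nth None (stateOf kap) t == None).
Proof. by rewrite mem_filter mem_iota andbC. Qed.

Lemma stateOf_sorted kap p p' i i' :
  nth None (stateOf kap) p = Some i -> nth None (stateOf kap) p' = Some i' ->
  (p < p') = (i < i').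
Proof.
have key : forall (s : seq strand) q q' k k', pairwise ltn (pmap id s) ->
    nth None s q = Some k -> nth None s q' = Some k' -> q < q' -> k < k'.
  elim=> [|x s IH] [|q] [|q'] k k' //=.
    case: x => //= y /andP[/allP Hs _] [<-] Hq' _; apply: Hs.
    elim: s q' Hq' {IH} => [|z s IH] [|q'] //=; first by move=> ->; rewrite mem_head.
    by move=> /IH H; case: z => //= z; rewrite inE H orbT.
  by rewrite ltnS; move=> H; apply: IH; case: x H => //= y /andP[].
have Hs : pairwise ltn (pmap id (stateOf kap)).
  rewrite pmap_stateOf -sorted_pairwise ?iota_ltn_sorted //; exact: ltn_trans.
move=> H1 H2; apply/idP/idP; first exact: key Hs H1 H2.
move=> Hi; rewrite ltnNge; apply/negP; rewrite leq_eqVlt => /orP[/eqP E|].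
  by move: H1 Hi; rewrite -E H2 => -[->]; rewrite ltnn.
by move/(key _ _ _ _ _ Hs H2 H1); lia.
Qed.

Definition sg (s : bool) (k : nat) : int := if s then (- Posz k)%R else Posz k.

Lemma abs_sg s k : absz (sg s k) = k.
Proof. by case: s; rewrite /sg ?abszN. Qed.

(** For a red position the index is the number of black strands; it overflows a list [l] of that
    size, and the default makes the strand not nailed. *)
Definition nailed (kap : seq nat) (l : seq bool) (t : nat) : bool :=
  nth false l (index t (blacks kap)).

(** The signed permutation of (w,l), read along the top: the inverse of [w] with a minus sign on
    each nailed strand. *)
Definition ctop (n : nat) (kap w : seq nat) (l : seq bool) : conf :=
  [seq sg (nailed kap l t) (index t w).+1 | t <- iota 0 n].

Lemma abs_ctop n kap w l : map absz (ctop n kap w l) = labels n w.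
Proof. by rewrite /ctop -map_comp; apply: eq_map => t; apply: abs_sg. Qed.

Lemma size_ctop n kap w l : size (ctop n kap w l) = n.
Proof. by rewrite size_map size_iota. Qed.

Lemma nth_ctop n kap w l t : t < n ->
  nth 0%R (ctop n kap w l) t = sg (nailed kap l t) (index t w).+1.
Proof. by move=> Ht; rewrite (nth_map 0) ?size_iota // nth_iota. Qed.

Lemma size_theta m : size (theta m) = 2 * m + 1.
Proof. by rewrite size_cat /= !size_map size_rev size_iota; lia. Qed.

Lemma nondot_theta m : all nondot (theta m).
Proof. by rewrite all_cat /= !all_map; apply/andP; split; apply/allP. Qed.

Lemma crun_down u x v :
  crun [seq Cr j | j <- rev (iota 0 (size u))] (u ++ x :: v) = x :: u ++ v.
Proof.
elim/last_ind: u v => [|u y IH] v //.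
rewrite size_rcons -addn1 iotaD rev_cat /= cat_rcons add0n.
by rewrite swp_cat IH cat_rcons.
Qed.

Lemma crun_theta u x v : crun (theta (size u)) (u ++ x :: v) = u ++ (- x)%R :: v.
Proof.
rewrite /theta crun_cat crun_down -[LHS]/(crun _ ((- x)%R :: u ++ v)) -(crun_down u (- x)%R v).
by rewrite -[X in crun [seq Cr j | j <- X] _]revK map_rev crun_revK.
Qed.

Definition flip (L : seq nat) (x : int) : int :=
  if odd (count_mem (absz x) L) then (- x)%R else x.

Lemma abs_flip L x : absz (flip L x) = absz x.
Proof. by rewrite /flip; case: ifP; rewrite ?abszN. Qed.

Lemma flip_rcons L q x : flip (rcons L q) x = flip [:: q] (flip L x).
Proof.
rewrite {2}/flip abs_flip /flip -cats1 count_cat /= addn0 oddD eq_sym.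
by case: (odd _); case: eqP => //=; rewrite opprK.
Qed.

(** [theta m] is the nail conjugated by the descent to the blue strand, so it is a reflection: it
    changes one sign and moves no strand. *)
Lemma crun_theta_flip c m : m < size c -> uniq (map absz c) ->
  crun (theta m) c = map (flip [:: absz (nth 0%R c m)]) c.
Proof.
have key u (x : int) v : uniq (map absz (u ++ x :: v)) ->
    crun (theta (size u)) (u ++ x :: v) = map (flip [:: absz x]) (u ++ x :: v).
  rewrite crun_theta !map_cat /= cat_uniq /= => /and3P[_ /norP[Hu _] /andP[Hv _]].
  have F (z : seq int) : absz x \notin map absz z -> map (flip [:: absz x]) z = z.
    move=> H; rewrite -[RHS]map_id; apply/eq_in_map => y yz; rewrite /flip /= addn0.
    by case: eqP => // E; case/negP: H; rewrite E map_f.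
  by rewrite !F // /flip /= eqxx.
move=> Hm Hu; have E : c = take m c ++ nth 0%R c m :: drop m.+1 c.
  by rewrite -drop_nth // cat_take_drop.
have Es : m = size (take m c) by rewrite size_take Hm.
by rewrite {1}Es [in RHS]E {2}E key // -E.
Qed.

Section Heights.
Variables (n : nat) (cs : seq nat) (bot : nat * nat -> nat) (plan : seq (nat * nat)).
Hypothesis Hcs : all (fun j => j.+1 < n) cs.
Hypothesis Hbot : forall x, x \in plan -> bot x < n.

Let nails h := flatten [seq theta (hpos cs (bot x) x.1) | x <- plan & x.1 == h].
Let level h := nails h ++ [seq Cr j | j <- take 1 (drop h cs)].
Let upto m := flatten [seq [seq x <- plan | x.1 == h] | h <- iota 0 m].

Lemma uptoS m : upto m.+1 = upto m ++ [seq x <- plan | x.1 == m].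
Proof. by rewrite /upto -addn1 iotaD map_cat flatten_cat /= cats0. Qed.

Lemma perm_upto m : (forall x, x \in plan -> x.1 < m) -> perm_eq (upto m) plan.
Proof.
move=> H; apply/permP => p; rewrite count_flatten -map_comp sumnE big_map.
under eq_bigr => h _ do rewrite /= count_filter.
elim: (plan) H => [|x s IH] H; first by rewrite big1.
rewrite /= big_split /= IH; last by move=> y ys; apply: H; rewrite inE ys orbT.
congr addn; rewrite (bigD1_seq x.1) ?iota_uniq ?mem_iota ?(H x) ?mem_head //=.
by rewrite eqxx andbT big1 ?addn0 // => h; rewrite eq_sym => /negPf ->; rewrite andbF.
Qed.

Lemma takeS_drop m : take m.+1 cs = take m cs ++ take 1 (drop m cs).
Proof. by rewrite -addn1 takeD. Qed.

(** Because each [theta] only changes a sign in place, a nail at height h meets the strand that the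
    bare expression [cs] has at that position, and the signs travel along unaffected. *)
Lemma crun_levels m : crun (flatten [seq level h | h <- iota 0 m]) (idc n)
  = map (flip [seq (bot x).+1 | x <- upto m]) (map Posz (arun (take m cs) (iota 1 n))).
Proof.
elim: m => [|m IH]; first by rewrite take0 -map_comp; apply: eq_map.
rewrite -addn1 iotaD map_cat flatten_cat crun_cat IH /= cats0 addn1 takeS_drop add0n.
rewrite crun_cat arun_cat; set a := arun (take m cs) (iota 1 n).
have key s L : {subset s <= [seq x <- plan | x.1 == m]} ->
    crun (flatten [seq theta (hpos cs (bot x) x.1) | x <- s]) (map (flip L) (map Posz a))
    = map (flip (L ++ [seq (bot x).+1 | x <- s])) (map Posz a).
  elim: s L => [|x s IHs] L Hs /=; first by rewrite cats0.
  have := Hs x (mem_head _ _); rewrite mem_filter => /andP[/eqP Hx1 Hx].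
  have Hta : all (fun j => j.+1 < n) (take m cs) by apply/allP => j /mem_take; apply/(allP Hcs).
  have Hpm : hpos cs (bot x) x.1 < n by rewrite Hx1; apply: pos_after_lt Hta (Hbot Hx).
  have Hsz : size a = n by rewrite size_arun size_iota.
  rewrite crun_cat crun_theta_flip; first last.
  - rewrite -map_comp (eq_map (abs_flip L)) -map_comp (eq_map (g := id)) ?map_id //.
    exact: uniq_arun.
  - by rewrite !size_map Hsz.
  rewrite (nth_map 0%R) ?size_map ?Hsz // abs_flip (nth_map 0) ?Hsz //.
  rewrite /= Hx1 /hpos nth_arun ?size_iota // nth_iota ?Hbot // -map_comp.
  rewrite -(eq_map (fun y => flip_rcons L (bot x).+1 y)) IHs ?cat_rcons //.
  by move=> y ys; apply: Hs; rewrite inE ys orbT.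
rewrite /nails key // uptoS [in RHS]map_cat.
set L := _ ++ _.
elim: (take 1 _) (a) => //= j s IHs a'.
by rewrite -!map_swp IHs.
Qed.

Lemma size_levels m : size (flatten [seq level h | h <- iota 0 m])
  = size (take m cs) + \sum_(x <- upto m) (2 * hpos cs (bot x) x.1 + 1).
Proof.
elim: m => [|m IH]; first by rewrite take0 big_nil.
rewrite -addn1 iotaD map_cat flatten_cat size_cat IH /= cats0 addn1 takeS_drop add0n.
rewrite uptoS big_cat /= !size_cat size_map.
have -> : size (nails m) = \sum_(x <- [seq x <- plan | x.1 == m]) (2 * hpos cs (bot x) x.1 + 1).
  by rewrite /nails size_flatten /shape -map_comp sumnE big_map; apply: eq_bigr => x _; rewrite /= size_theta.
by rewrite [X in _ + X]addnC addnACA.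
Qed.

Lemma nondot_levels m : all nondot (flatten [seq level h | h <- iota 0 m]).
Proof.
elim: (iota 0 m) => //= h s IH; rewrite all_cat IH andbT /level all_cat all_map.
apply/andP; split; last by apply/allP.
by rewrite /nails; elim: [seq _ <- _ | _] => //= x s' IH'; rewrite all_cat nondot_theta.
Qed.

End Heights.

(** Used for [ctop], where [f] is the inverse of [w], and for [cbot], where [f] is [w] and the two
    idempotents are exchanged. *)
Lemma conf_adm rho kap n (f : nat -> nat) (sgn : nat -> bool) :
  size (stateOf rho) = n -> size (stateOf kap) = n ->
  perm_eq (map f (iota 0 n)) (iota 0 n) ->
  (forall t, t < n -> nth None (stateOf rho) (f t) = nth None (stateOf kap) t) ->
  (forall t, t < n -> sgn t -> nth None (stateOf kap) t = None) ->
  let c := [seq sg (sgn t) (f t).+1 | t <- iota 0 n] in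
  adm (stateOf rho) c /\ cst (stateOf rho) c = stateOf kap.
Proof.
move=> Hr Hk Hf Hcol Hsgn c.
have E t : colour (stateOf rho) (sg (sgn t) (f t).+1) = nth None (stateOf rho) (f t).
  by rewrite /colour abs_sg.
split; last first.
  apply: (@eq_from_nth _ None); rewrite !size_map size_iota ?Hk // => t Ht.
  by rewrite /cst -map_comp (nth_map 0) ?size_iota // nth_iota //= E Hcol.
apply/and3P; split.
- rewrite Hr /c -map_comp (eq_map (g := fun t => (f t).+1)); last by move=> t; apply: abs_sg.
  by rewrite (map_comp succn f) -[1]addn0 iotaDl; apply: perm_map.
- apply/allP => x /mapP[t]; rewrite mem_iota => Ht ->; apply/implyP.
  by rewrite /sg; case: ifP => // Hs _; rewrite -[X in colour _ X]/(sg true _) -Hs E Hcol // Hsgn.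
rewrite /c pairwise_map.
have : pairwise ltn (iota 0 n).
  rewrite -sorted_pairwise ?iota_ltn_sorted //; exact: ltn_trans.
have : {subset iota 0 n <= iota 0 n} by [].
elim: {1 3 4}(iota 0 n) => //= t s IH Hs /andP[/allP Ht Hp].
rewrite IH // ?andbT; last by move=> y ys; apply: Hs; rewrite inE ys orbT.
apply/allP => t' t's; apply/implyP; rewrite !E.
have Htn : t < n by have := Hs t (mem_head _ _); rewrite mem_iota.
have Htn' : t' < n by have := Hs t'; rewrite inE t's orbT mem_iota => /(_ isT).
rewrite !Hcol //.
have H1 : sgn t -> nth None (stateOf kap) t == None by move=> /Hsgn -> //.
have H2 : sgn t' -> nth None (stateOf kap) t' == None by move=> /Hsgn -> //.
move: H1 H2 (Hcol t Htn) (Hcol t' Htn').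
case E1 : (nth None (stateOf kap) t) => [i|] //; case E2 : (nth None (stateOf kap) t') => [i'|] //.
case: (sgn t) => [/(_ isT)//|] _; case: (sgn t') => [/(_ isT)//|] _ E3 E4 _.
rewrite /sg ltz_nat ltnS (stateOf_sorted E3 E4) -(stateOf_sorted E1 E2).
exact: Ht.
Qed.

Section Bword.
Variables (b r : nat) (kap rho : seq nat).
Hypotheses (Hkap : in_P b r kap) (Hrho : in_P b r rho).
Let n := b + r.
Let sr := stateOf rho.
Let sk := stateOf kap.

Lemma in_SP w : in_S kap rho w -> perm_eq w (iota 0 n) /\
  forall p, p < n -> nth None sk (nth 0 w p) = nth None sr p.
Proof.
rewrite /in_S (size_stateOf Hrho) => /andP[Hw /allP H]; split=> // p Hp.
by apply/eqP/H; rewrite mem_iota.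
Qed.

Lemma nailed_black l t : size l = b -> nailed kap l t -> nth None sk t = None.
Proof.
move=> Hl; rewrite /nailed; case: (ltnP (index t (blacks kap)) b) => H.
  move=> _; have : t \in blacks kap by rewrite -index_mem (size_blacks Hkap).
  by rewrite mem_blacks => /andP[_ /eqP].
by rewrite nth_default // Hl.
Qed.

Lemma perm_index w : perm_eq w (iota 0 n) ->
  perm_eq [seq index t w | t <- iota 0 n] (iota 0 n).
Proof.
move=> Hw; have := perm_labels Hw; rewrite -[1]addn0 iotaDl /labels.
rewrite (map_comp (addn 1) (index^~ w)); apply: perm_map_inj; exact: addnI.
Qed.

Lemma ctop_adm w l : in_S kap rho w -> size l = b ->
  adm sr (ctop n kap w l) /\ cst sr (ctop n kap w l) = sk.
Proof.
move=> /in_SP[Hw Hcol] Hl; apply: conf_adm.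
- exact: size_stateOf Hrho.
- exact: size_stateOf Hkap.
- exact: perm_index.
- move=> t Ht; rewrite -(Hcol _ (index_w_lt Hw Ht)) nth_index //.
  by rewrite (mem_w Hw).
by move=> t _; apply: nailed_black.
Qed.

Lemma blk_posE i : blk_pos sk i = nth 0 (blacks kap) i.
Proof. by []. Qed.

Definition bnails (w cs : seq nat) (plan : seq (nat * nat)) : seq gen :=
  flatten [seq flatten [seq theta (hpos cs (bot_of kap w x.2) x.1)
                       | x <- plan & x.1 == h]
               ++ [seq Cr j | j <- take 1 (drop h cs)]
          | h <- iota 0 (size cs).+1].

Definition bdots (a : seq nat) : seq gen :=
  flatten [seq nseq (nth 0 a i) (Dot (blk_pos sk i)) | i <- iota 0 (size a)].

(** A left-adjusted expression has as many crossings as [w] has inversions, and each nail is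
    inserted at a position at most [nb]. By [len_signs] the word has at most [len] letters, and no
    shorter word reaches the configuration; so it is reduced, and reduced words are valid. *)
Lemma bnails_spec w l cs plan : in_S kap rho w -> size l = b ->
  left_adjusted n w cs -> nail_plan_ok kap w cs l plan ->
  [/\ all nondot (bnails w cs plan), crun (bnails w cs plan) (idc n) = ctop n kap w l,
      size (bnails w cs plan) = len (ctop n kap w l) &
      run sr (bnails w cs plan) = Some sk].
Proof.
move=> Hw Hl Hla [Hpl Hmin].
have [Hadm Hcst] := ctop_adm Hw Hl; have [Hperm Hcol] := in_SP Hw.
have [Hcs Elab Esz Hpos] := left_adjusted_spec Hperm Hla.
pose bot (x : nat * nat) := bot_of kap w x.2.
have Hx2 x : x \in plan -> x.2 < b /\ nth false l x.2.
  move=> xp; have : x.2 \in map snd plan by apply: map_f.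
  by rewrite (perm_mem Hpl) mem_filter mem_iota Hl => /andP[-> /= ->].
have Hblk i : i < b -> blk_pos sk i < n /\ index (blk_pos sk i) (blacks kap) = i.
  move=> Hi; rewrite blk_posE index_uniq ?uniq_blacks ?(size_blacks Hkap) //; split=> //.
  have : nth 0 (blacks kap) i \in blacks kap by rewrite mem_nth ?(size_blacks Hkap).
  by rewrite mem_blacks (size_stateOf Hkap) => /andP[].
have Hbot x : x \in plan -> bot x < n.
  by move=> /Hx2[/Hblk[H _] _]; apply: (index_w_lt Hperm H).
have Hup : forall x, x \in plan -> x.1 < (size cs).+1 by move=> x /Hmin[].
have Hp := perm_upto Hup.
have Hnd : all nondot (bnails w cs plan) by apply: (nondot_levels cs bot).
pose L := [seq (bot x).+1 | x <- plan].
have botK i : i < b -> nth 0 w (bot_of kap w i) = blk_pos sk i.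
  by move=> /Hblk[H _]; rewrite nth_index // (mem_w Hperm).
have HL : perm_eq L [seq (bot_of kap w i).+1 | i <- [seq i <- iota 0 (size l) | nth false l i]].
  rewrite /L (map_comp (fun i => (bot_of kap w i).+1) snd); exact: perm_map.
have HLu : uniq L.
  rewrite (perm_uniq HL) map_inj_in_uniq ?filter_uniq ?iota_uniq // => i i'.
  rewrite !mem_filter !mem_iota Hl => /andP[_ /= Hi] /andP[_ /= Hi'] [E].
  have [_ <-] := Hblk i Hi; have [_ <-] := Hblk i' Hi'.
  by rewrite -!botK // E.
(* Each nailed strand occurs exactly once in [L], so the parity in [flip] is the truth value of
   [nailed]. *)
have HLmem t : t < n -> ((index t w).+1 \in L) = nailed kap l t.
  move=> Ht; rewrite (perm_mem HL); apply/mapP/idP => [[i]|Hn].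
    rewrite mem_filter mem_iota Hl => /andP[Hli /= Hi] [E].
    have Et : t = blk_pos sk i by rewrite -botK // -E nth_index // (mem_w Hperm).
    by rewrite /nailed Et; have [_ ->] := Hblk i Hi.
  have Hi : index t (blacks kap) < b.
    by apply: contraT => H; move: Hn; rewrite /nailed nth_default // Hl leqNgt.
  exists (index t (blacks kap)); first by rewrite mem_filter mem_iota Hl /= Hi andbT; exact: Hn.
  rewrite /bot_of blk_posE nth_index // -index_mem (size_blacks Hkap) //.
have Hcrun : crun (bnails w cs plan) (idc n) = ctop n kap w l.
  rewrite [LHS](crun_levels Hcs Hbot) take_oversize // Elab -map_comp.
  rewrite /labels -!map_comp; apply/eq_in_map => t; rewrite mem_iota add0n => /andP[_ Ht].
  rewrite /comp /flip (permP (perm_map _ Hp)) -/L absz_nat (count_uniq_mem _ HLu) HLmem //.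
  by rewrite /sg; case: (nailed _ _ _).
have Hsize : size (bnails w cs plan) <= len (ctop n kap w l).
  rewrite [X in X <= _](size_levels cs bot plan) take_oversize // (len_signs (adm_good Hadm)).
  rewrite abs_ctop -Esz leq_add2l (perm_big _ Hp) /=.
  apply: (@leq_trans (\sum_(q <- L) (2 * nb (labels n w) q + 1))).
    rewrite /L big_map !big_seq; apply: leq_sum => x xp.
    rewrite leq_add2r leq_mul2l /=; have [h Hh <-] := Hpos _ (Hbot x xp).
    by case: (Hmin x xp) => _; apply.
  have -> : \sum_(y <- ctop n kap w l | (y < 0)%R) (2 * nb (labels n w) `|y| + 1)
    = \sum_(q <- [seq absz y | y <- ctop n kap w l & (y < 0)%R]) (2 * nb (labels n w) q + 1).
    by rewrite big_map big_filter.
  rewrite (perm_big [seq absz y | y <- ctop n kap w l & (y < 0)%R]) //=.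
  apply: uniq_perm => //.
    apply: (@subseq_uniq _ _ (map absz (ctop n kap w l))).
      exact/map_subseq/filter_subseq.
    by rewrite abs_ctop (perm_uniq (perm_labels Hperm)) iota_uniq.
  move=> q; apply/idP/mapP => [Hq|[y]].
    move: (Hq); rewrite (perm_mem HL) => /mapP[i].
    rewrite mem_filter mem_iota Hl => /andP[_ /= Hi] Eq.
    have [Ht _] := Hblk i Hi; rewrite Eq /bot_of HLmem // in Hq.
    exists (sg true q); last by rewrite abs_sg.
    rewrite mem_filter; apply/andP; split; first by rewrite Eq.
    by apply/mapP; exists (blk_pos sk i); rewrite ?mem_iota // Hq Eq.
  rewrite mem_filter => /andP[Hy /mapP[t]]; rewrite mem_iota /= => Ht Ey ->.
  rewrite Ey abs_sg HLmem //; move: Hy; rewrite Ey /sg.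
  by case: (nailed _ _ _).
have Es : size (bnails w cs plan) = len (ctop n kap w l).
  apply/eqP; rewrite eqn_leq Hsize -Hcrun.
  by have := len_crun_le (bnails w cs plan) (cgood_idc n); rewrite len_idc.
split=> //; rewrite -Hcst; apply: reduced_run => //.
by rewrite (size_stateOf Hrho).
Qed.

Lemma ctop_surj c : adm sr c -> cst sr c = sk ->
  exists w l, [/\ in_S kap rho w, size l = b & c = ctop n kap w l].
Proof.
move=> Hc Hcst; have Hp := adm_perm Hc; rewrite (size_stateOf Hrho) in Hp.
have Hsz : size c = n by rewrite (adm_size Hc) (size_stateOf Hrho).
have Hu : uniq (map absz c) by rewrite (perm_uniq Hp) iota_uniq.
pose w := [seq index p.+1 (map absz c) | p <- iota 0 n].
pose l := [seq (nth 0%R c (nth 0 (blacks kap) i) < 0)%R | i <- iota 0 b].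
have nth_w p : p < n -> nth 0 w p = index p.+1 (map absz c).
  by move=> Hpn; rewrite (nth_map 0) ?size_iota // nth_iota.
have mem_c p : p < n -> p.+1 \in map absz c by move=> H; rewrite (perm_mem Hp) mem_iota.
have idx_lt p : p < n -> index p.+1 (map absz c) < n.
  by move=> H; rewrite -Hsz -(size_map absz) index_mem mem_c.
have Hw : perm_eq w (iota 0 n).
  apply: uniq_perm; rewrite ?iota_uniq //.
    rewrite map_inj_in_uniq ?iota_uniq // => p p'; rewrite !mem_iota /= => H H' E.
    by have := nth_index 0 (mem_c p H); rewrite E nth_index ?mem_c // => -[].
  move=> t; rewrite mem_iota; apply/mapP/idP => [[p]|/= Ht].
    by rewrite mem_iota => H ->; apply: idx_lt.
  have : nth 0 (map absz c) t \in iota 1 n by rewrite -(perm_mem Hp) mem_nth // size_map Hsz.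
  rewrite mem_iota; case E: (nth _ _ _) => [|p] //= Hpn; exists p; first by rewrite mem_iota.
  by rewrite -E index_uniq // size_map Hsz.
have absE t : t < n -> absz (nth 0%R c t) = (index t w).+1.
  move=> Ht; have Hi : index t w < n by apply: index_w_lt.
  have E : index (index t w).+1 (map absz c) = t by rewrite -nth_w // nth_index // (mem_w Hw).
  by rewrite -[in LHS]E -(nth_map 0%R 0 absz) ?nth_index ?mem_c // Hsz idx_lt.
have colE t : t < n -> colour sr (nth 0%R c t) = nth None sk t.
  by move=> Ht; rewrite -Hcst /cst (nth_map 0%R) // Hsz.
have Hl : size l = b by rewrite size_map size_iota.
exists w, l; split=> //.
  rewrite /in_S (size_stateOf Hrho) Hw; apply/allP => p; rewrite mem_iota /= => Hpn.
  have Ht : nth 0 w p < n by rewrite nth_w // idx_lt.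
  rewrite -[nth None (stateOf kap) _](colE _ Ht) /colour absE //=.
  by rewrite index_uniq ?(uniq_w Hw) ?(perm_size_w Hw).
apply: (@eq_from_nth _ 0%R); rewrite ?size_ctop // Hsz => t Ht.
rewrite nth_ctop // -absE //.
suff -> : nailed kap l t = (nth 0%R c t < 0)%R by rewrite /sg; case: ifP; lia.
rewrite /nailed; case: (boolP (t \in blacks kap)) => Hb.
  have Hi : index t (blacks kap) < b by rewrite -(size_blacks Hkap) index_mem.
  by rewrite (nth_map 0) ?size_iota // nth_iota //= nth_index.
rewrite nth_default; last by rewrite Hl -(size_blacks Hkap) leqNgt index_mem.
apply/esym/negbTE; apply: contra Hb => Hneg.
rewrite mem_blacks (size_stateOf Hkap) Ht /= -[nth None _ _]colE //.
case/and3P: Hc => _ /allP Hneg' _; apply: (implyP (Hneg' _ _) Hneg).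
by rewrite mem_nth // Hsz.
Qed.

End Bword.

(** * Normal form of the dots and spanning *)

Lemma run_alldots ds s : all isdot ds -> run s ds = Some s \/ run s ds = None.
Proof.
elim: ds => [|d ds IH]; first by left.
by case: d => //= p /IH; case: (isBlk s p) => // _; right.
Qed.

Lemma run_bdots b r kap a : in_P b r kap -> size a = b ->
  run (stateOf kap) (bdots kap a) = Some (stateOf kap).
Proof.
move=> Hkap Ha; have H : forall i, i \in iota 0 (size a) -> isBlk (stateOf kap) (blk_pos (stateOf kap) i).
  move=> i; rewrite mem_iota /= Ha => Hi; rewrite /isBlk.
  have : blk_pos (stateOf kap) i \in blacks kap by rewrite mem_nth // (size_blacks Hkap).
  by rewrite mem_blacks.
rewrite /bdots; elim: (iota 0 _) H => //= i s IH H; rewrite run_cat run_dots.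
  by apply: IH => j js; apply: H; rewrite inE js orbT.
by apply: H; rewrite mem_head.
Qed.

Lemma dots_normal b r kap ds : in_P b r kap -> all isdot ds ->
  run (stateOf kap) ds = Some (stateOf kap) ->
  exists2 a, size a = b & perm_eq ds (bdots kap a).
Proof.
move=> Hkap; pose a ds := [seq count_mem (Dot (nth 0 (blacks kap) i)) ds | i <- iota 0 b].
move=> Hds Hrun; exists (a ds); first by rewrite size_map size_iota.
have Hpos : forall d, d \in ds -> exists2 i, i < b & d = Dot (nth 0 (blacks kap) i).
  elim: ds Hds Hrun => //= d ds IH /andP[Hd Hds]; case: d Hd => //= p _.
  case Hb: (isBlk _ p) => // Hrun d; rewrite inE => /orP[/eqP ->|]; last exact: (IH Hds Hrun d).
  have Hm : p \in blacks kap by rewrite mem_blacks; move: Hb; rewrite /isBlk.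
  exists (index p (blacks kap)); last by rewrite nth_index.
  by rewrite -(size_blacks Hkap) index_mem.
apply/allP => d _ /=; apply/eqP; rewrite /bdots count_flatten -map_comp sumnE big_map.
rewrite size_map size_iota.
have E i : i \in iota 0 b -> (count_mem d \o (fun i => nseq (nth 0 (a ds) i)
     (Dot (blk_pos (stateOf kap) i)))) i =
     if Dot (nth 0 (blacks kap) i) == d then count_mem d ds else 0.
  rewrite mem_iota /= => Hi; rewrite count_nseq /a (nth_map 0) ?size_iota // nth_iota //=.
  by rewrite -[blk_pos _ _]/(nth 0 (blacks kap) i); case: eqP => [->|]; rewrite ?mul1n.
rewrite big_seq (eq_bigr _ E) -big_seq.
case: (boolP (d \in ds)) => [/Hpos[i Hi ->]|Hd].
  rewrite (bigD1_seq i) ?iota_uniq ?mem_iota //= eqxx big_seq_cond big1 ?addn0 //.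
  move=> j /andP[]; rewrite mem_iota add0n => /andP[_ Hj] Hji; case: eqP => // -[/eqP].
  by rewrite nth_uniq ?uniq_blacks ?(size_blacks Hkap) // (negPf Hji).
rewrite (count_memPn Hd) big1 // => i _; by case: ifP.
Qed.

Section Spanning.
Variables (R : comPzRingType) (N : seq nat) (b r : nat) (kap rho : seq nat).
Variables (cs : seq nat -> seq nat) (plan : seq nat -> seq bool -> seq (nat * nat)).
Hypotheses (Hkap : in_P b r kap) (Hrho : in_P b r rho).
Hypothesis Hcs : forall w, in_S kap rho w -> left_adjusted (b + r) w (cs w).
Hypothesis Hplan : forall w l, in_S kap rho w -> size l = b ->
  nail_plan_ok kap w (cs w) l (plan w l).

Let sr := stateOf rho.
Let sk := stateOf kap.

Definition bgens (t : idx) : seq gen :=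
  bnails kap t.1 (cs t.1) (plan t.1 t.2.1) ++ bdots kap t.2.2.

Lemma in_BP (t : idx) : in_B b kap rho t ->
  [/\ in_S kap rho t.1, size t.2.1 = b & size t.2.2 = b].
Proof. by case/andP=> /andP[-> /eqP -> /eqP ->]. Qed.

Lemma run_bgens (t : idx) : in_B b kap rho t -> run sr (bgens t) = Some sk.
Proof.
move=> /in_BP[Hw Hl Ha].
have [_ _ _ Hrun] := bnails_spec Hkap Hrho Hw Hl (Hcs Hw) (Hplan Hw Hl).
by rewrite run_cat Hrun (run_bdots Hkap).
Qed.

Lemma spanning gs : run sr gs = Some sk ->
  spn R N sr sk (fun gs' => exists2 t, in_B b kap rho t & gs' = bgens t) gs.
Proof.
have [m] := ubnP (nd gs); elim: m gs => // m IH gs /ltnSE Hm Hrun.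
have low gs' : nd gs' < nd gs -> run sr gs' = Some sk ->
    spn R N sr sk (fun gs' => exists2 t, in_B b kap rho t & gs' = bgens t) gs'.
  by move=> H; apply: IH; apply: leq_trans H Hm.
apply: spn_trans (spn_dots_top R N Hrun) _ => gs' [H|[ds Hds ->]] Hr'; first exact: low.
have [s1 Hr1 Hr2] := run_catP Hr'.
have Es1 : s1 = sk by case: (run_alldots s1 Hds); rewrite Hr2 // => -[].
subst s1; set fs := filter nondot gs in Hr' Hr1 *.
have Hfs : all nondot fs by apply: filter_all.
have Hk : nd gs = size fs by rewrite /nd size_filter.
have [M1 M2] := spn_reduce R N erefl Hfs Hr1.
have Hidc : cst sr (idc (size sr)) = sr by apply: cst_idc.
have Hadm0 : adm sr (idc (size sr)).
  have /= := @conf_adm rho rho (size sr) id (fun=> false) erefl erefl.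
  case; rewrite ?map_id // => + _; congr adm.
  by rewrite /idc -[1]addn0 iotaDl -map_comp.
have Hadm : adm sr (crun fs (idc (size sr))) by apply: adm_run Hadm0 _; rewrite Hidc; apply: Hr1.
have Hcst : cst sr (crun fs (idc (size sr))) = sk.
  by apply/esym/(run_cst (s0 := sr) (gs := fs)); rewrite Hidc.
have Hle : len (crun fs (idc (size sr))) <= size fs.
  by have := len_crun_le fs (cgood_idc (size sr)); rewrite len_idc.
move: Hle; rewrite leq_eqVlt => /orP[/eqP Hlen|Hlt]; last first.
  apply: spn_trans (spn_top (Q' := fun gs' => nd gs' < nd gs) (M1 Hlt) Hr1 Hr2 _) low.
  by move=> gs1 H; rewrite nd_cat (nd_dots Hds) addn0 Hk.
have [w [l [Hw Hl Ec]]] := ctop_surj Hkap Hrho Hadm Hcst.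
have [B1 B2 B3 B4] := bnails_spec Hkap Hrho Hw Hl (Hcs Hw) (Hplan Hw Hl).
have [a Ha Hpa] := dots_normal Hkap Hds Hr2.
have Hn : b + r = size sr by rewrite (size_stateOf Hrho).
have := M2 Hlen (bnails kap w (cs w) (plan w l)); rewrite B3 -Ec Hlen => /(_ erefl B1 B4).
rewrite -Hn B2 -Ec Hn => /(_ erefl) Hsp.
apply: spn_trans (spn_top (Q' := fun gs' => nd gs' < nd gs \/
   gs' = bnails kap w (cs w) (plan w l) ++ ds) Hsp Hr1 Hr2 _) _.
  by move=> gs1 [H|->]; [left; rewrite nd_cat (nd_dots Hds) addn0 Hk | right].
move=> gs1 [H|->] Hr3; first exact: low.
apply: spn_weak (spn_dots_perm R N Hds Hpa Hr3) _ => _ <-.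
by exists (w, (l, a)) => //; rewrite /in_B /= Hw Hl Ha !eqxx.
Qed.

End Spanning.

(** * A representation by divided differences *)

Section Rep.
Local Open Scope ring_scope.
Variables (K : fieldType) (N : seq nat) (s0 : seq strand) (z : nat -> K).
Hypothesis z_inj : injective z.
Hypothesis z_neq0 : forall k, z k != 0.
Implicit Types (F G : conf -> K) (c u v : conf).

Notation colour := (colour s0).
Notation cst := (cst s0).

Definition zx (x : int) : K := z (absz x).

Definition before (a : nat) (y : int) : bool := (y < 0) && (absz y < a)%N.

(* The nails act as anticommuting creation operators, one for each label:
   [x < 0] in a configuration means that the operator of the label |x| was
   applied, and eps is the sign of reordering them. *)
Definition eps c : K := (-1) ^+ count (before (absz (head 0 c))) c.

(** The polynomial representation, localised: [F c] stands for the value at the point where each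
    strand takes the [z] of its label. Only one direction of a black/red crossing carries the power
    of z, so that a double crossing yields it once. *)
Definition op (g : gen) (F : conf -> K) (c : conf) : K :=
  match g with
  | Dot j => zx (nth 0 c j) * F c
  | Cr j => let x := nth 0 c j in let y := nth 0 c j.+1 in
    match colour x, colour y with
    | None, None => (F c - F (swp j c)) / (zx x - zx y)
    | None, Some i => zx x ^+ lab N i * F (swp j c)
    | Some _, None => F (swp j c)
    | Some _, Some _ => 0
    end
  | Nail => if 0 < head 0 c then eps c * F (negh c) else 0
  end.

#[local] Arguments op : simpl never.

Definition rep (gs : seq gen) (F : conf -> K) : conf -> K :=
  foldl (fun F g => op g F) F gs.

Lemma op_ext g F G : F =1 G -> op g F =1 op g G.
Proof.
move=> E c; by case: g => [j|j|]; rewrite /op ?E.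
Qed.

Lemma rep_ext gs F G : F =1 G -> rep gs F =1 rep gs G.
Proof. by elim: gs F G => //= g gs IH F G E; apply: IH; apply: op_ext. Qed.

Lemma rep_cat g1 g2 F : rep (g1 ++ g2) F = rep g2 (rep g1 F).
Proof. by rewrite /rep foldl_cat. Qed.

Lemma op_sum (I : Type) (r : seq I) (a : I -> K) (H : I -> conf -> K) g c :
  op g (fun c => \sum_(i <- r) a i * H i c) c = \sum_(i <- r) a i * op g (H i) c.
Proof.
case: g => [j|j|]; rewrite /op.
- by rewrite big_distrr; apply: eq_bigr => i _ /=; rewrite mulrCA.
- case: colour => [k|]; case: colour => [k'|].
  + by rewrite big1 // => i _; rewrite mulr0.
  + by [].
  + by rewrite big_distrr; apply: eq_bigr => i _ /=; rewrite mulrCA.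
  + rewrite -sumrB big_distrl; apply: eq_bigr => i _ /=.
    by rewrite -mulrBr mulrA.
case: ifP => _; last by rewrite big1 // => i _; rewrite mulr0.
by rewrite big_distrr; apply: eq_bigr => i _ /=; rewrite mulrCA.
Qed.

Lemma rep_sum (I : Type) (r : seq I) (a : I -> K) (H : I -> conf -> K) gs c :
  rep gs (fun c => \sum_(i <- r) a i * H i c) c = \sum_(i <- r) a i * rep gs (H i) c.
Proof.
elim: gs H c => //= g gs IH H c; rewrite -IH.
by apply: rep_ext => c'; apply: op_sum.
Qed.

Lemma nth_cat0 u (x : int) v : nth 0 (u ++ x :: v) (size u) = x.
Proof. by rewrite nth_cat ltnn subnn. Qed.

Lemma nth_cat1 u (x y : int) v : nth 0 (u ++ x :: y :: v) (size u).+1 = y.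
Proof. by rewrite -cat_rcons -(size_rcons u x) nth_cat0. Qed.

Lemma cst_swp_black j c : (j.+1 < size c)%N -> colour (nth 0 c j) = None ->
  colour (nth 0 c j.+1) = None -> cst (swp j c) = cst c.
Proof.
move=> Hj; have [u [x [y [v [-> <-]]]]] := split_two Hj.
by rewrite nth_cat0 nth_cat1 swp_cat !cstE !map_cat /= => -> ->.
Qed.

(** An operator reads its argument only at configurations with the colours one letter below; a black
    crossing reads two of them, of equal colours. So the value at [c] depends only on [F] at
    configurations coloured by [s]. *)
Lemma rep_local gs F s c : (forall c', cgood c' -> cst c' = s -> F c' = 0) ->
  cgood c -> run s gs = Some (cst c) -> rep gs F c = 0.
Proof.
elim: gs F s => [|g gs IH] F s HF Hc /=; first by case=> E; apply: HF.
rewrite stepE; case Hok: (okstep g s) => // Hrun; apply: IH Hrun => // c' Hc' Ec'.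
have Es : cst (cact g c') = s.
  by rewrite cst_cact Ec'; case: (g) => //= j; rewrite swpK.
have Hg : cgood (cact g c') by rewrite cgood_cact.
case: g Hok Ec' Es Hg => [j|j|] /= Hok Ec' Es Hg; rewrite /op.
- by rewrite (HF c') ?mulr0.
- case E1: (colour _) => [i|]; case E2: (colour _) => [i'|] //; rewrite ?(HF (swp j c')) ?mulr0 //.
  rewrite (HF c') ?subrr ?mul0r // -Es; apply/esym/cst_swp_black => //.
  by move: Hok => /andP[+ _]; rewrite -Es size_map size_swp.
by case: ifP => // _; rewrite HF ?mulr0.
Qed.

Lemma nth_cat2 u (x y t : int) v : nth 0 (u ++ x :: y :: t :: v) (size u).+2 = t.
Proof. by rewrite -cat_rcons -(size_rcons u x) nth_cat1. Qed.

Lemma op_Dot0 F u x v : op (Dot (size u)) F (u ++ x :: v) = zx x * F (u ++ x :: v).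
Proof. by rewrite /op nth_cat0. Qed.

Lemma op_Dot1 F u x y v :
  op (Dot (size u).+1) F (u ++ x :: y :: v) = zx y * F (u ++ x :: y :: v).
Proof. by rewrite /op nth_cat1. Qed.

Lemma op_Dot2 F u x y t v :
  op (Dot (size u).+2) F (u ++ x :: y :: t :: v) = zx t * F (u ++ x :: y :: t :: v).
Proof. by rewrite -cat_rcons -(size_rcons u x) op_Dot1. Qed.

Lemma op_Cr0 F u x y v : op (Cr (size u)) F (u ++ x :: y :: v) =
    match colour x, colour y with
    | None, None => (F (u ++ x :: y :: v) - F (u ++ y :: x :: v)) / (zx x - zx y)
    | None, Some i => zx x ^+ lab N i * F (u ++ y :: x :: v)
    | Some _, None => F (u ++ y :: x :: v)
    | Some _, Some _ => 0
    end.
Proof. by rewrite /op nth_cat0 nth_cat1 swp_cat. Qed.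

Lemma op_Cr1 F u x y t v : op (Cr (size u).+1) F (u ++ x :: y :: t :: v) =
    match colour y, colour t with
    | None, None => (F (u ++ x :: y :: t :: v) - F (u ++ x :: t :: y :: v)) / (zx y - zx t)
    | None, Some i => zx y ^+ lab N i * F (u ++ x :: t :: y :: v)
    | Some _, None => F (u ++ x :: t :: y :: v)
    | Some _, Some _ => 0
    end.
Proof. by rewrite -cat_rcons -(size_rcons u x) op_Cr0 !cat_rcons. Qed.

Definition opE := (op_Dot0, op_Dot1, op_Dot2, op_Cr0, op_Cr1).

Lemma zx_neq x y : absz x != absz y -> zx x - zx y != 0.
Proof. by rewrite subr_eq0; apply: contra => /eqP/z_inj ->. Qed.

Lemma cgood_cat2 u x y v : cgood (u ++ x :: y :: v) -> zx x - zx y != 0.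
Proof.
move=> /andP[+ _]; rewrite map_cat cat_uniq /= => /and3P[_ _ /andP[+ _]].
by rewrite inE negb_or => /andP[Hxy _]; apply: zx_neq.
Qed.

Lemma rep_dots j k F c : rep (nseq k (Dot j)) F c = zx (nth 0 c j) ^+ k * F c.
Proof.
elim: k F => [|k IH] F; first by rewrite expr0 mul1r.
by rewrite [LHS]/= IH /op mulrA exprSr.
Qed.

(** With [crB], writes every crossing in the same form, a F(c) + b F(swapped c); commutation of
    far-apart generators then becomes a ring identity without cases on colours. *)
Definition crA (x y : int) : K :=
  match colour x, colour y with None, None => (zx x - zx y)^-1 | _, _ => 0 end.

Definition crB (x y : int) : K :=
  match colour x, colour y with
  | None, None => - (zx x - zx y)^-1
  | None, Some i => zx x ^+ lab N i
  | Some _, None => 1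
  | Some _, Some _ => 0
  end.

Lemma op_DotE j F c : op (Dot j) F c = zx (nth 0 c j) * F c.
Proof. by []. Qed.

Lemma op_CrE j F c : op (Cr j) F c = crA (nth 0 c j) (nth 0 c j.+1) * F c
  + crB (nth 0 c j) (nth 0 c j.+1) * F (swp j c).
Proof.
rewrite /op /crA /crB; case: (colour _) => [i|]; case: (colour _) => [i'|].
- by rewrite !mul0r addr0.
- by rewrite mul0r add0r mul1r.
- by rewrite mul0r add0r.
by rewrite mulNr -mulrBr mulrC.
Qed.

Definition nailc c : K := if 0 < head 0 c then eps c else 0.

Lemma op_NailE F c : op Nail F c = nailc c * F (negh c).
Proof. by rewrite /op /nailc; case: ifP; rewrite ?mul0r. Qed.

Lemma nailc_swp j c : (0 < j)%N -> nailc (swp j c) = nailc c.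
Proof.
case: j => // j _; rewrite /nailc /eps (permP (perm_swp j.+1 c)).
by case: c => [|x c].
Qed.

Lemma op_far g h F c : ~~ has (fun p => p \in supp h) (supp g) ->
  all (fun p => p < size c)%N (supp g) -> all (fun p => p < size c)%N (supp h) ->
  op g (op h F) c = op h (op g F) c.
Proof.
have negh_nth p (c' : conf) : nth 0 (negh c') p.+1 = nth 0 c' p.+1 by case: c'.
have negh_swp j (c' : conf) : swp j.+1 (negh c') = negh (swp j.+1 c') by case: c' => [|x [|y c']].
have key1 i j F' c' : ~~ ((i == j) || (i == j.+1)) -> (j.+1 < size c')%N ->
    op (Dot i) (op (Cr j) F') c' = op (Cr j) (op (Dot i) F') c'.
  move=> /norP[/negPf Hi1 /negPf Hi2] Hj; rewrite op_DotE !op_CrE !op_DotE nth_swp //.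
  by rewrite /swapn Hi1 Hi2; ring.
have key2 j F' c' : op Nail (op (Cr j.+1) F') c' = op (Cr j.+1) (op Nail F') c'.
  by rewrite op_NailE !op_CrE !op_NailE !negh_nth nailc_swp // negh_swp; ring.
case: g h => [i|i|] [j|j|] //=; rewrite ?orbF ?andbT !inE.
- by move=> _ _ _; rewrite !op_DotE mulrCA.
- by move=> Hf _ /andP[_ Hj]; apply: key1.
- by case: i => // i _ _ _; rewrite !(op_DotE, op_NailE) negh_nth mulrCA.
- move=> Hf /andP[_ Hi] _; apply/esym/key1 => //.
  by move: Hf; rewrite negb_or => /andP[H1 H2]; rewrite (eq_sym j i) (eq_sym j i.+1); apply/norP.
- move=> Hf /andP[_ Hi] /andP[_ Hj].
  rewrite !op_CrE.
  have [E1 E2 E3 E4] : [/\ swapn i j = j, swapn i j.+1 = j.+1, swapn j i = i & swapn j i.+1 = i.+1].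
    by rewrite /swapn; do ![case: eqP => ?]; split; lia.
  have Es : swp i (swp j c) = swp j (swp i c).
    by case: (ltnP i j) => Hij; [apply/esym/swp_comm | apply: swp_comm]; lia.
  by rewrite !nth_swp // E1 E2 E3 E4 Es; ring.
- by case: i => // i _ _ _; apply/esym/key2.
- by case: j => // j _ _ _; rewrite !(op_DotE, op_NailE) negh_nth mulrCA.
by case: j => // j _ _ _; apply: key2.
Qed.

Lemma cst_split c (s1 s2 : seq strand) : cst c = s1 ++ s2 ->
  exists u v, [/\ c = u ++ v, cst u = s1, cst v = s2 & size u = size s1].
Proof.
move=> E; have Hs : (size s1 <= size c)%N.
  by rewrite -(size_map colour) -[map _ _]/(cst c) E size_cat leq_addr.
exists (take (size s1) c), (drop (size s1) c); rewrite cat_take_drop size_takel //.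
by split=> //; rewrite !cstE ?map_take ?map_drop -/(cst c) E ?take_size_cat ?drop_size_cat.
Qed.

Lemma cst_split2 c w (p q : strand) w' : cst c = w ++ p :: q :: w' ->
  exists u x y v, [/\ c = u ++ x :: y :: v, size u = size w, colour x = p & colour y = q].
Proof.
case/cst_split=> u [[|x [|y v]]] [Ec _ Ev Es] //; case: Ev => <- <- _.
by exists u, x, y, v.
Qed.

Lemma cst_split3 c w (p q o : strand) w' : cst c = w ++ p :: q :: o :: w' ->
  exists u x y t v, [/\ c = u ++ x :: y :: t :: v, size u = size w, colour x = p, colour y = q & colour t = o].
Proof.
case/cst_split=> u [[|x [|y [|t v]]]] [Ec _ Ev Es] //; case: Ev => <- <- <- _.
by exists u, x, y, t, v.
Qed.

Lemma cgood_cat3 u x y t v : cgood (u ++ x :: y :: t :: v) ->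
  [/\ zx x - zx y != 0, zx x - zx t != 0 & zx y - zx t != 0].
Proof.
move=> H; split; first exact: cgood_cat2 H.
  apply: (@cgood_cat2 u x t (y :: v)); move: H; rewrite !cgoodE !map_cat.
  rewrite (perm_uniq (_ : perm_eq _ (map absz u ++ map absz [:: x, t, y & v]))).
    rewrite (perm_mem (_ : perm_eq _ (map absz u ++ map absz [:: x, t, y & v]))) //.
    by rewrite perm_cat2l perm_cons (perm_catCA [:: _] [:: _]).
  by rewrite perm_cat2l perm_cons (perm_catCA [:: _] [:: _]).
by move: H; rewrite -cat_rcons => /cgood_cat2.
Qed.

Lemma homog_head s t (e : int) s' gs r : homog s t ((e, (s', gs)) :: r) ->
  s' = s /\ run s' gs = Some t.
Proof. by move=> H; have [/= E1 E2] := H _ (mem_head _ _); rewrite -E1 in E2 *. Qed.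

Lemma nailc_cons x y v : nailc (x :: y :: v) =
  if 0 < x then (-1) ^+ (before (absz x) y + count (before (absz x)) v) else 0.
Proof. by rewrite /nailc /eps /= /before ltnn andbF. Qed.

Lemma op_nailCr F x y v : cgood (x :: y :: v) -> colour x = None -> colour y = None ->
  op (Cr 0) (op Nail (op (Cr 0) (op Nail F))) (x :: y :: v)
  + op Nail (op (Cr 0) (op Nail (op (Cr 0) F))) (x :: y :: v) = 0.
Proof.
move=> Hc c1 c2; have d1 := @cgood_cat2 [::] x y v Hc.
have d2 : zx y - zx x != 0 by rewrite -opprB oppr_eq0.
have opC p q G : colour p = None -> colour q = None ->
    op (Cr 0) G (p :: q :: v) = (G (p :: q :: v) - G (q :: p :: v)) / (zx p - zx q).
  by move=> e1 e2; have := op_Cr0 G [::] p q v; rewrite e1 e2.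
have nE p q : negh (p :: q :: v) = (- p) :: q :: v by [].
have zxN (p : int) : zx (- p) = zx p by rewrite /zx abszN.
rewrite !(opC, op_NailE, colourN, c1, c2, nE, opprK, zxN) // !nailc_cons !abszN.
have [x0 y0 Hxy] : [/\ x != 0, y != 0 & absz x != absz y].
  move: Hc => /andP[/= /andP[+ _]]; rewrite !inE !negb_or => /andP[-> _].
  by rewrite (eq_sym 0 x) (eq_sym 0 y) => /and3P[-> -> _].
rewrite /before !abszN.
have sgnE (k : int) : k != 0 ->
    [/\ (0 < k) = true, (0 < - k) = false, (k < 0) = false & (- k < 0) = true] \/
    [/\ (0 < k) = false, (0 < - k) = true, (k < 0) = true & (- k < 0) = false].
  move=> k0; case: (ltrP 0 k) => Hk; [left|right]; split=> //; lia.
case: (sgnE x x0) => -[ex1 ex2 ex3 ex4]; case: (sgnE y y0) => -[ey1 ey2 ey3 ey4];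
  rewrite ?(ex1, ex2, ex3, ex4, ey1, ey2, ey3, ey4) /= ?(mul0r, mulr0, subr0, sub0r, addr0, oppr0) //.
(* Only positive x and y survive two nails. Exactly one of the two orders of nailing sees a smaller
   negative label, which gives the sign of the relation. *)
have -> : (absz x < absz y)%N = ~~ (absz y < absz x)%N.
  by move: Hxy; clear; lia.
by case: (absz y < absz x)%N; rewrite /= ?add0n ?add1n ?exprS ?expr0; field; rewrite d1 d2.
Qed.

Lemma okstep_supp g s : okstep g s -> all (fun p => p < size s)%N (supp g).
Proof.
case: g => [j|j|] /=; rewrite ?andbT; [exact: isBlk_size | | exact: isBlk_size].
by case/andP=> H _; rewrite H ltnW.
Qed.

Lemma size_sact g s : size (sact g s) = size s.
Proof. by case: g => //= j; rewrite size_swp. Qed.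

(** At a configuration with the colours of the top, each relation becomes an identity between
    rational functions in the [z] of the strands it involves, up to the signs [eps]. *)
Lemma rep_rel (r : seq (int * word)) s t c F : klrw_rel N r -> homog s t r ->
  cgood c -> cst c = t -> \sum_(x <- r) x.1%:~R * rep x.2.2 F c = 0.
Proof.
have N1 : (-1)%:~R = -1 :> K by rewrite mulrNz.
move=> Hr H Hc Ht; case: Hr H => {r}.
- move=> s' j b1 b2 /homog_head[_].
  have [w [w' [-> <-]]] := isBlk_split2 b1 b2; rewrite !runE => -[Et].
  rewrite -Ht in Et; have [u [x [y [v [Ec Eu c1 c2]]]]] := cst_split2 (esym Et); subst c.
  rewrite !big_cons big_nil -Eu /= !(opE, c1, c2).
  have d1 := cgood_cat2 Hc; have d2 : zx y - zx x != 0 by rewrite -opprB oppr_eq0.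
  by field; rewrite d1 d2.
- move=> s' j b1 b2 /homog_head[_].
  have [w [w' [-> <-]]] := isBlk_split2 b1 b2; rewrite !runE => -[Et].
  rewrite -Ht in Et; have [u [x [y [v [Ec Eu c1 c2]]]]] := cst_split2 (esym Et); subst c.
  rewrite !big_cons big_nil -Eu N1 /= !(opE, c1, c2).
  by have d1 := cgood_cat2 Hc; field.
- move=> s' j b1 b2 /homog_head[_].
  have [w [w' [-> <-]]] := isBlk_split2 b1 b2; rewrite !runE => -[Et].
  rewrite -Ht in Et; have [u [x [y [v [Ec Eu c1 c2]]]]] := cst_split2 (esym Et); subst c.
  rewrite !big_cons big_nil -Eu N1 /= !(opE, c1, c2).
  by have d1 := cgood_cat2 Hc; field.
- move=> s' j b1 b2 b3 /homog_head[_].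
  have [w [w' [-> <-]]] := isBlk_split3 b1 b2 b3; rewrite !runE => -[Et].
  rewrite -Ht in Et; have [u [x [y [o [v [Ec Eu c1 c2 c3]]]]]] := cst_split3 (esym Et); subst c.
  rewrite !big_cons big_nil -Eu N1 /= !(opE, c1, c2, c3).
  have [d1 d2 d3] := cgood_cat3 Hc.
  have [e1 e2 e3] : [/\ zx y - zx x != 0, zx o - zx x != 0 & zx o - zx y != 0].
    by rewrite -[zx y - _]opprB -[zx o - zx x]opprB -[zx o - zx y]opprB !oppr_eq0.
  by field; rewrite ?d1 ?d2 ?d3 ?e1 ?e2 ?e3.
- move=> s' j i b1 b2 /homog_head[_]; have h := isRed_size b2; move: b1 b2 => /andP[_ /eqP b1] /eqP b2.
  have [w [w' [E <-]]] := split_state2 h; rewrite b1 b2 in E; rewrite E !runE => -[Et].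
  rewrite -Ht in Et; have [u [x [y [v [Ec Eu c1 c2]]]]] := cst_split2 (esym Et); subst c.
  rewrite !big_cons big_nil -Eu N1 /= !(opE, c1, c2); ring.
- move=> s' j i b1 b2 /homog_head[_]; have h := isBlk_size b2; move: b1 b2 => /eqP b1 /andP[_ /eqP b2].
  have [w [w' [E <-]]] := split_state2 h; rewrite b1 b2 in E; rewrite E !runE => -[Et].
  rewrite -Ht in Et; have [u [x [y [v [Ec Eu c1 c2]]]]] := cst_split2 (esym Et); subst c.
  rewrite !big_cons big_nil -Eu N1 /= !(opE, c1, c2); ring.
- move=> s' j i b1 b2 /homog_head[_]; have h := isRed_size b2; move: b1 b2 => /andP[_ /eqP b1] /eqP b2.
  have [w [w' [E <-]]] := split_state2 h; rewrite b1 b2 in E; rewrite E !runE => -[Et].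
  rewrite -Ht in Et; have [u [x [y [v [Ec Eu c1 c2]]]]] := cst_split2 (esym Et); subst c.
  rewrite !big_cons big_nil -Eu N1 /= rep_dots nth_cat0 !(opE, c1, c2); ring.
- move=> s' j i b1 b2 /homog_head[_]; have h := isBlk_size b2; move: b1 b2 => /eqP b1 /andP[_ /eqP b2].
  have [w [w' [E <-]]] := split_state2 h; rewrite b1 b2 in E; rewrite E !runE => -[Et].
  rewrite -Ht in Et; have [u [x [y [v [Ec Eu c1 c2]]]]] := cst_split2 (esym Et); subst c.
  rewrite !big_cons big_nil -Eu N1 /= rep_dots nth_cat1 !(opE, c1, c2); ring.
- move=> s' j i b1 b2 b3 /homog_head[_]; have h := isBlk_size b3; move: b1 b2 b3 => /eqP b1 /andP[_ /eqP b2] /andP[_ /eqP b3].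
  have [w [w' [E <-]]] := split_state3 h; rewrite b1 b2 b3 in E; rewrite E !runE => -[Et].
  rewrite -Ht in Et; have [u [x [y [o [v [Ec Eu c1 c2 c3]]]]]] := cst_split3 (esym Et); subst c.
  rewrite !big_cons big_nil -Eu N1 /= !(opE, c1, c2, c3).
  by have [d1 d2 d3] := cgood_cat3 Hc; field.
- move=> s' j i b1 b2 b3 /homog_head[_]; have h := isRed_size b3; move: b1 b2 b3 => /andP[_ /eqP b1] /andP[_ /eqP b2] /eqP b3.
  have [w [w' [E <-]]] := split_state3 h; rewrite b1 b2 b3 in E; rewrite E !runE => -[Et].
  rewrite -Ht in Et; have [u [x [y [o [v [Ec Eu c1 c2 c3]]]]]] := cst_split3 (esym Et); subst c.
  rewrite !big_cons big_nil -Eu N1 /= !(opE, c1, c2, c3).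
  by have [d1 d2 d3] := cgood_cat3 Hc; field.
- move=> s' j i b1 b2 b3 /homog_head[_]; have h := isBlk_size b3; move: b1 b2 b3 => /andP[_ /eqP b1] /eqP b2 /andP[_ /eqP b3].
  have [w [w' [E <-]]] := split_state3 h; rewrite b1 b2 b3 in E; rewrite E !runE => -[Et].
  rewrite -Ht in Et; have [u [x [y [o [v [Ec Eu c1 c2 c3]]]]]] := cst_split3 (esym Et); subst c.
  have [d1 d2 d3] := cgood_cat3 Hc.
  rewrite !big_cons big_map -Eu N1 [rep (_, _).2.2 _ _]/= [rep (_, _).2.2 _ _]/= !(opE, c1, c2, c3).
  set n := lab N i; set a := zx x in d1 d2 *; set b := zx o in d2 d3 *.
  rewrite (eq_bigr (fun k => - (F (u ++ [:: x, y, o & v])) * (b ^+ (n.-1 - k) * a ^+ k))); last first.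
    by move=> k _; rewrite [_.2]/= rep_cat !rep_dots nth_cat0 nth_cat2 -/a -/b; ring.
  rewrite -big_distrr /= -[X in iota 0 X]subn0 -/(index_iota 0 n) big_mkord.
  (* The correction sum is the divided difference of the n-th power, the term that arises when a
     black crossing passes the red strand; for n = 0 both sides vanish. *)
  have -> : \sum_(k < n) b ^+ (n.-1 - k) * a ^+ k = (b ^+ n - a ^+ n) / (b - a).
    by rewrite subrXX mulrC mulKf // -opprB oppr_eq0.
  have d4 : b - a != 0 by rewrite -opprB oppr_eq0.
  by field; rewrite d2 d4.
- move=> s' b1 _; rewrite !big_cons big_nil N1 /= !(op_NailE, op_DotE).
  have -> : zx (nth 0 (negh c) 0) = zx (nth 0 c 0).
    by case: (c) => //= x v; rewrite /zx abszN.
  by ring.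
- move=> s' b1 _; rewrite !big_cons big_nil /= !op_NailE /nailc.
  have -> : head 0 (negh c) = - head 0 c by case: (c) => //=; rewrite oppr0.
  case: (ltrP 0 (head 0 c)) => Hx; rewrite ?mul0r ?mulr0 ?addr0 //.
  have -> : (0 < - head 0 c) = false by lia.
  by rewrite mul0r !mulr0.
- move=> s' b1 b2 /homog_head[_]; have [w [w' [E H0]]] := isBlk_split2 b1 b2.
  move: E; rewrite (size0nil H0) /= => -> /=; rewrite /swapS /= !drop0 => -[Et].
  have Hc' : cst c = [::] ++ None :: None :: w' by rewrite Ht -Et.
  have [u [x [y [v [Ec /size0nil Eu c1 c2]]]]] := cst_split2 Hc'; subst u c.
  rewrite !big_cons big_nil /= addr0 !mul1r; exact: op_nailCr.
move=> s' g h Hf _ /homog_head[_]; rewrite /= stepE; case Hg: (okstep g s') => //.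
rewrite stepE; case Hh: (okstep h (sact g s')) => // -[Et].
rewrite !big_cons big_nil N1 /= (op_far (g := g)) //; first by rewrite mul1r mulN1r addr0 subrr.
  by have := okstep_supp Hg; rewrite -(size_map colour c) -/(cst c) Ht -Et !size_sact.
by have := okstep_supp Hh; rewrite -(size_map colour c) -/(cst c) Ht -Et !size_sact.
Qed.

End Rep.

(** * Vanishing on the ideal, and evaluations as matrix coefficients *)

Section RepIdeal.
Local Open Scope ring_scope.
Variables (K : fieldType) (N : seq nat) (s0 : seq strand) (z : nat -> K).
Hypothesis z_inj : injective z.
Hypothesis z_neq0 : forall k, z k != 0.
Implicit Types (F G : conf -> K) (c u v : conf).

#[local] Arguments op : simpl never.
Notation colour := (colour s0).
Notation cst := (cst s0).
Notation rep := (rep N s0 z).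
Notation op := (op N s0 z).

(** An element of the ideal may mix diagrams with different ends, so only the terms whose top is the
    state of [c] are collected. *)
Lemma rep_ideal (f : seq (int * word)) F c : in_ideal N f -> cgood c ->
  \sum_(x <- f | top x.2 == Some (cst c)) x.1%:~R * rep x.2.2 F c = 0.
Proof.
move=> Hf Hc; elim: Hf => {f} [|u r v Hr Hu Hv|f g _ If _ Ig|a f _ If|f g E _ If].
- by rewrite big_nil.
- have [s [t H]] := rel_homog Hr.
  case Hm: ((top v == Some s) && (u.1 == t)); last by rewrite (fmul_mismatch H Hm) big_nil.
  case/andP: Hm => /eqP Htv /eqP Hut.
  have -> : u = (t, u.2) by rewrite -Hut; case: (u).
  have -> : v = (v.1, v.2) by case: (v).
  rewrite (fmul_homog u.2 H (s0 := v.1)) // big_map /=.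
  case Hrun: (run t u.2 == Some (cst c)); last first.
    rewrite big_seq_cond big1 // => x /andP[/H[_ Hx]].
    by rewrite /top /= run_cat -/(top v) Htv run_cat Hx Hrun.
  transitivity (rep u.2 (fun c' => \sum_(x <- r) x.1%:~R * rep x.2.2 (rep v.2 F) c') c).
    rewrite rep_sum [LHS]big_seq_cond [RHS]big_seq; apply: eq_big => [x|x xr].
      case: (boolP (x \in r)) => //= /H[_ Hx].
      by rewrite /top /= run_cat -/(top v) Htv run_cat Hx.
    by rewrite !rep_cat.
  (* The relation vanishes only at configurations coloured by its top; this suffices for the value
     above [u]. *)
  apply: (rep_local _ _ _ Hc (eqP Hrun)).
  by move=> c' Hc' Ec'; apply: (rep_rel z_inj _ Hr H).
- by rewrite big_cat /= If Ig addr0.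
- rewrite big_map /=; transitivity (a%:~R * \sum_(x <- f | top x.2 == Some (cst c)) x.1%:~R * rep x.2.2 F c).
    by rewrite big_distrr; apply: eq_bigr => x _ /=; rewrite intrM mulrA.
  by rewrite If mulr0.
apply: etrans If; apply/esym; rewrite big_mkcond [RHS]big_mkcond.
apply: (fcoef_ext (F := fun D a => if top D == Some (cst c) then a%:~R * rep D.2 F c else 0)) => //.
  by move=> D; case: ifP; rewrite ?mul0r.
by move=> D a b; case: ifP; rewrite ?addr0 // intrD mulrDl.
Qed.

(** Each generator can be inverted along a descent: the value of [F] at [c] is recovered from values
    of [F] and of [op g F] at the shorter configuration, down to the identity. *)
Lemma reach c : adm s0 c -> exists f : seq (K * seq gen),
  (forall y, y \in f -> run (cst c) y.2 = Some s0) /\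
  forall F, F c = \sum_(y <- f) y.1 * rep y.2 F (idc (size s0)).
Proof.
have [m] := ubnP (len c); elim: m c => // m IH c /ltnSE Hm Hc.
have [H0|/(adm_lt0 Hc)[g Hd _]] := posnP (len c).
  rewrite (adm_len0 Hc H0); exists [:: (1, [::])]; split.
    by move=> y; rewrite inE => /eqP -> /=; rewrite cst_idc.
  by move=> F; rewrite big_seq1 mul1r.
have [Ha Hst] := adm_desc Hc Hd.
have [|f [Hf Hrep]] := IH (cact g c) _ Ha.
  by rewrite -(len_desc (adm_good Hc) Hd).
have Hok := desc_ok Hc Hd.
have Hrun y : y \in f -> run (cst c) (g :: y.2) = Some s0.
  by move=> yf; rewrite /= step_cst Hok Hf.
(* A nail or a black/red crossing only rescales, by a nonzero factor. A divided difference also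
   involves [F] at the shorter configuration; the colours agree there, so the words from the
   induction serve both terms. *)
suff [[a Ea]|[a Hbl Ea]] : (exists a : K, forall F, F c = a * op g F (cact g c)) \/
    (exists2 a : K, cst (cact g c) = cst c &
       forall F, F c = F (cact g c) + a * op g F (cact g c)).
- exists [seq (a * y.1, g :: y.2) | y <- f]; split.
    by move=> y /mapP[y' y'f ->]; apply: Hrun.
  move=> F; rewrite Ea Hrep big_map big_distrr; apply: eq_bigr => y _ /=.
  by rewrite mulrA.
- exists (f ++ [seq (a * y.1, g :: y.2) | y <- f]); split.
    move=> y; rewrite mem_cat => /orP[/Hf|/mapP[y' y'f ->]]; last exact: Hrun.
    by rewrite Hbl.
  move=> F; rewrite Ea !Hrep big_cat big_map big_distrr /=; congr (_ + _).
  by apply: eq_bigr => y _ /=; rewrite mulrA.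
have Hg := adm_good Hc.
case: g Hd Ha Hok {Hst Hf Hrep Hrun} => [//|j|] /= Hd Ha.
  rewrite size_map => /andP[Hj]; have [u [x [y [v [Ec Eu]]]]] := split_two Hj.
  subst c j; rewrite !isBlk_split swp_cat => Hb.
  have d1 := cgood_cat2 z_inj Hg.
  have d2 : zx z y - zx z x != 0 by rewrite -opprB oppr_eq0.
  case cx: (colour x) Hb => [i|]; case cy: (colour y) => [i'|] // _.
  - left; exists (zx z y ^+ lab N i)^-1 => F; rewrite op_Cr0 cx cy mulKf //.
    by rewrite expf_neq0 // z_neq0.
  - by left; exists 1 => F; rewrite op_Cr0 cx cy mul1r.
  right; exists (- (zx z y - zx z x)).
    by rewrite !cstE !map_cat /= cx cy.
  by move=> F; rewrite op_Cr0 cx cy; field.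
move=> _; left; exists (eps K (negh c))^-1 => F.
have Hpos : 0 < head 0 (negh c) by case: c Hd {Ha Hg Hc Hm} => //= x c; rewrite oppr_gt0.
rewrite op_NailE /nailc Hpos neghK mulKf //.
by rewrite /eps expf_neq0 // oppr_eq0 oner_eq0.
Qed.

End RepIdeal.

(** * Independence of the diagrams without dots, over a field *)

Section Independence.
Local Open Scope ring_scope.
Variables (N : seq nat) (b r : nat) (kap rho : seq nat).
Variables (cs : seq nat -> seq nat) (plan : seq nat -> seq bool -> seq (nat * nat)).
Hypotheses (Hkap : in_P b r kap) (Hrho : in_P b r rho).
Hypothesis Hcs : forall w, in_S kap rho w -> left_adjusted (b + r) w (cs w).
Hypothesis Hplan : forall w l, in_S kap rho w -> size l = b ->
  nail_plan_ok kap w (cs w) l (plan w l).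

Let n := (b + r)%N.
Let sr := stateOf rho.
Let sk := stateOf kap.
Let B (t : idx) : word := (sr, bgens kap cs plan t).

Definition wls : seq (seq nat * seq bool) :=
  undup [seq (w, l) | w <- [seq w <- permutations (iota 0 n) | in_S kap rho w],
                      l <- [seq tval x | x <- enum {:b.-tuple bool}]].

Lemma mem_wls w l : ((w, l) \in wls) = in_S kap rho w && (size l == b).
Proof.
rewrite mem_undup; apply/allpairsP/andP => [[[w' l'] /= [H1 H2 [-> ->]]]|[H1 /eqP H2]].
  move: H1 H2; rewrite mem_filter => /andP[-> _] /mapP[x _ ->].
  by rewrite size_tuple.
exists (w, l); split=> //=.
  rewrite mem_filter H1 mem_permutations; have [H _] := in_SP Hrho H1.
  by rewrite perm_sym perm_sym.
have Hl : size l == b by apply/eqP.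
by apply/mapP; exists (Tuple Hl); rewrite ?mem_enum.
Qed.

(** The labels now number the top positions, so that the top configuration is [idc n]. At the bottom
    they form [w] itself, where [ctop] has the inverse. *)
Definition cbot (wl : seq nat * seq bool) : conf :=
  [seq sg (nailed kap wl.2 (nth 0%N wl.1 p)) (nth 0%N wl.1 p).+1 | p <- iota 0 n].

Lemma cbot_adm wl : wl \in wls -> adm sk (cbot wl) /\ cst sk (cbot wl) = sr.
Proof.
case: wl => w l; rewrite mem_wls => /andP[Hw /eqP Hl].
have [Hp Hcol] := in_SP Hrho Hw; apply: conf_adm.
- exact: size_stateOf Hkap.
- exact: size_stateOf Hrho.
- rewrite /= -[X in iota 0 X](perm_size_w Hp) -/(mkseq _ _) mkseq_nth.
  by rewrite (perm_size_w Hp).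
- exact: Hcol.
by move=> p Hpn /= Hn; rewrite -Hcol // (nailed_black Hkap Hl Hn).
Qed.

Lemma cbot_inj : {in wls &, injective cbot}.
Proof.
move=> [w l] [w' l']; rewrite !mem_wls => /andP[Hw /eqP Hl] /andP[Hw' /eqP Hl'] E.
have [Hp _] := in_SP Hrho Hw; have [Hp' _] := in_SP Hrho Hw'.
have Ep p : (p < n)%N -> sg (nailed kap l (nth 0%N w p)) (nth 0%N w p).+1
    = sg (nailed kap l' (nth 0%N w' p)) (nth 0%N w' p).+1.
  move=> Hpn; have := congr1 (fun c => nth 0 c p) E.
  by rewrite /cbot !(nth_map 0%N) ?size_iota // nth_iota.
have Ew : w = w'.
  apply: (@eq_from_nth _ 0%N); rewrite !(perm_size_w Hp) ?(perm_size_w Hp') // => p Hpn.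
  by have := congr1 absz (Ep p Hpn); rewrite !abs_sg => -[].
subst w'; congr pair; apply: (@eq_from_nth _ false); rewrite ?Hl ?Hl' // => i Hi.
have Hb : nth 0%N (blacks kap) i \in blacks kap by rewrite mem_nth // (size_blacks Hkap).
have Hbn : (nth 0%N (blacks kap) i < n)%N.
  by move: Hb; rewrite mem_blacks (size_stateOf Hkap) => /andP[].
have := Ep _ (index_w_lt Hp Hbn); rewrite nth_index ?(mem_w Hp) //.
rewrite /nailed index_uniq ?uniq_blacks ?(size_blacks Hkap) //.
by case: (nth false l i); case: (nth false l' i).
Qed.

Definition mon (K : fieldType) (z : nat -> K) (a : seq nat) : K :=
  \prod_(i <- iota 0 (size a)) z (blk_pos sk i).+1 ^+ nth 0%N a i.

Section Field.
Variables (K : fieldType) (z : nat -> K).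
Hypothesis z_inj : injective z.
Hypothesis z_neq0 : forall k, z k != 0.

Notation rep := (rep N sk z).
Let c0 := idc n.

Lemma size_sk : size sk = n. Proof. exact: size_stateOf Hkap. Qed.

Lemma rep_bdots gs a F : size a = b ->
  rep (gs ++ bdots kap a) F c0 = mon z a * rep gs F c0.
Proof.
move=> Ha; rewrite rep_cat /bdots /mon.
have H i : i \in iota 0 (size a) -> zx z (nth 0 c0 (blk_pos sk i)) = z (blk_pos sk i).+1.
  rewrite mem_iota Ha /= => Hi; have : blk_pos sk i \in blacks kap.
    by rewrite mem_nth // (size_blacks Hkap).
  rewrite mem_blacks -/sk size_sk => /andP[Hn _].
  by rewrite /c0 /idc (nth_map 0%N) ?size_iota // nth_iota.
elim: (iota 0 _) (rep gs F) H => [|i s IH] G H /=; first by rewrite big_nil mul1r.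
rewrite rep_cat IH; last by move=> j js; apply: H; rewrite inE js orbT.
by rewrite rep_dots H ?mem_head // big_cons mulrA [in RHS](mulrC (z _ ^+ _)).
Qed.

Definition lam (wl : seq nat * seq bool) (F : conf -> K) : K :=
  rep (bnails kap wl.1 (cs wl.1) (plan wl.1 wl.2)) F c0.

Lemma rep_B (t : idx) F : in_B b kap rho t ->
  rep (B t).2 F c0 = mon z t.2.2 * lam (t.1, t.2.1) F.
Proof. by move=> /in_BP[_ _ Ha]; rewrite /= /bgens rep_bdots. Qed.

Lemma top_B t : in_B b kap rho t -> top (B t) = Some (cst sk c0).
Proof.
move=> Ht; rewrite /top /= (run_bgens Hkap Hrho Hcs Hplan Ht).
by rewrite /c0 -size_sk cst_idc.
Qed.

Let m := size wls.
Let wl0 : seq nat * seq bool := ([::], [::]).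
Let Y (i : 'I_m) := nth wl0 wls i.

Definition in_span (ev : (conf -> K) -> K) : Prop :=
  exists A : 'I_m -> K, forall F, ev F = \sum_i A i * lam (Y i) F.

Lemma in_span_sum (I : eqType) (s : seq I) (a : I -> K) (ev : I -> (conf -> K) -> K) :
  (forall i, i \in s -> in_span (ev i)) -> in_span (fun F => \sum_(i <- s) a i * ev i F).
Proof.
elim: s => [|i s IH] H.
  by exists (fun=> 0) => F; rewrite big_nil big1 // => j _; rewrite mul0r.
have [A1 E1] := H i (mem_head _ _).
have [A2 E2] := IH (fun j js => H j (mem_behead (s := i :: s) js)).
exists (fun j => a i * A1 j + A2 j) => F; rewrite big_cons E1 E2 big_distrr -big_split /=.
by apply: eq_bigr => j _; rewrite mulrDl mulrA.
Qed.

Lemma in_span_ext ev ev' : (forall F, ev F = ev' F) -> in_span ev' -> in_span ev.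
Proof. by move=> E [A H]; exists A => F; rewrite E. Qed.

Lemma in_span_lam wl : wl \in wls -> in_span (lam wl).
Proof.
move=> Hwl; have Hi : (index wl wls < m)%N by rewrite index_mem.
exists (fun i => (i == Ordinal Hi)%:R) => F.
rewrite (bigD1 (Ordinal Hi)) //= eqxx mul1r /Y /= nth_index // big1 ?addr0 // => i /negPf ->.
by rewrite mul0r.
Qed.

Lemma rep_congT (f g : seq (int * word)) F : congT N f g ->
  (forall x, x \in f ++ g -> top x.2 = Some sk) ->
  \sum_(x <- f) x.1%:~R * rep x.2.2 F c0 = \sum_(x <- g) x.1%:~R * rep x.2.2 F c0.
Proof.
move=> Hc Ht; have Ec0 : cst sk c0 = sk by rewrite /c0 -size_sk cst_idc.
have := rep_ideal sk z_inj F Hc (cgood_idc n).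
rewrite big_cat big_map /= -/c0 Ec0 => E; apply/eqP; rewrite -subr_eq0 -[X in _ == X]E.
rewrite -sumrN; apply/eqP; congr (_ + _).
  rewrite [LHS]big_seq [RHS]big_seq_cond; apply: eq_bigl => x.
  by case: (boolP (x \in f)) => //= xf; rewrite Ht ?eqxx // mem_cat xf.
rewrite [LHS]big_seq [RHS]big_seq_cond; apply: eq_big => x.
  by case: (boolP (x \in g)) => //= xg; rewrite Ht ?eqxx // mem_cat xg orbT.
by move=> _; rewrite mulN1r mulrNz mulNr.
Qed.

(** Spanning over the integers expands [gs] in the b_(w,l,a), whose dots act at [c0] by the scalars
    [mon]; only the functionals [lam] remain. *)
Lemma rep_span gs : run sr gs = Some sk -> in_span (fun F => rep gs F c0).
Proof.
move=> Hrun; have [f [Hf Hc]] := spanning int N Hkap Hrho Hcs Hplan Hrun.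
apply: (in_span_ext (ev' := fun F => \sum_(x <- f) x.1%:~R * rep x.2 F c0)).
  move=> F; have := rep_congT F Hc; rewrite big_seq1 mul1r /emb big_map; apply.
  move=> x; rewrite mem_cat inE => /orP[/eqP ->|/mapP[y yf ->]] //=.
  by case: (Hf y yf).
apply: in_span_sum => x xf; have [[t Ht ->] _] := Hf x xf.
apply: (in_span_ext (ev' := fun F => \sum_(i <- [:: tt]) mon z t.2.2 * lam (t.1, t.2.1) F)).
  by move=> F; rewrite big_seq1 -rep_B.
apply: in_span_sum => _ _; apply: in_span_lam.
by rewrite mem_wls; have [-> -> _] := in_BP Ht; rewrite eqxx.
Qed.

(** Evaluations at the distinct configurations [cbot] are independent, and by [reach] and [rep_span]
    they lie in the span of equally many functionals [lam]. *)
Lemma lam_free (C : 'I_m -> K) : (forall F, \sum_i C i * lam (Y i) F = 0) ->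
  forall i, C i = 0.
Proof.
move=> H; pose X (i : 'I_m) := cbot (Y i).
have HY i : Y i \in wls by rewrite mem_nth.
have HX i : in_span (fun F => F (X i)).
  have [Ha Hcst] := cbot_adm (HY i); have [f [Hf Hrep]] := reach N z_inj z_neq0 Ha.
  apply: in_span_ext Hrep _; apply: in_span_sum => y yf.
  rewrite size_sk; apply: rep_span; rewrite -[RHS](Hf y yf) Hcst //.
have [A HA] := fin_all_exists HX.
(* The functionals are tested on the indicator functions of the configurations [cbot], where the
   evaluations give the identity matrix. *)
pose M := \matrix_(i < m, j < m) lam (Y i) (fun c => (c == X j)%:R).
pose Am := \matrix_(i < m, j < m) A i j.
have EA : Am *m M = 1%:M.
  apply/matrixP => i j; rewrite !mxE; under eq_bigr => k _ do rewrite !mxE.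
  rewrite -(HA i (fun c => (c == X j)%:R)); congr (_%:R); congr nat_of_bool.
  apply/eqP/eqP => [/cbot_inj E|-> //]; apply/val_inj/eqP.
  by rewrite -(nth_uniq wl0 (ltn_ord i) (ltn_ord j)) ?undup_uniq //; apply/eqP/E.
pose Cm := \row_(i < m) C i.
have EC : Cm *m M = 0.
  apply/matrixP => i j; rewrite !mxE; under eq_bigr => k _ do rewrite !mxE.
  exact: H.
(* [M] is square, so its left inverse is also a right inverse: this is where the equality of the two
   counts enters. *)
have E0 : Cm = 0 by rewrite -[Cm]mulmx1 -(mulmx1C EA) mulmxA EC mul0mx.
by move=> i; have := congr1 (fun V : 'rV_m => V ord0 i) E0; rewrite !mxE.
Qed.

(** Evaluated at [c0], the dots become scalars, so grouping the terms by (w,l) reduces the claim to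
    [lam_free]; the exponents remain mixed in the coefficients. *)
Lemma rep_indep (f : seq (int * idx)) : all (fun x => in_B b kap rho x.2) f ->
  in_ideal N [seq (x.1, B x.2) | x <- f] -> forall wl,
  \sum_(x <- f | (x.2.1, x.2.2.1) == wl) x.1%:~R * mon z x.2.2.2 = 0.
Proof.
move=> Hf HI wl.
have Hwls (x : int * idx) : x \in f -> (x.2.1, x.2.2.1) \in wls.
  by move=> /(allP Hf)/in_BP[H1 H2 _]; rewrite mem_wls H1 H2 eqxx.
have [Hwl|Hwl] := boolP (wl \in wls); last first.
  rewrite big_seq_cond big1 // => x /andP[/Hwls H /eqP E].
  by rewrite -E H in Hwl.
pose C i := \sum_(x <- f | (x.2.1, x.2.2.1) == Y i) x.1%:~R * mon z x.2.2.2.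
have Hi : (index wl wls < m)%N by rewrite index_mem.
suff /(_ (Ordinal Hi)) : forall i, C i = 0 by rewrite /C /Y /= nth_index.
apply: lam_free => F.
have := rep_ideal sk z_inj F HI (cgood_idc n).
rewrite big_map /= => E; rewrite -[RHS]E; rewrite /C.
transitivity (\sum_(x <- f) x.1%:~R * rep (B x.2).2 F c0); last first.
  rewrite [LHS]big_seq [RHS]big_seq_cond; apply: eq_bigl => x.
  by case: (boolP (x \in f)) => //= xf; rewrite top_B ?eqxx //; apply: (allP Hf).
under eq_bigr => i _ do rewrite big_distrl /= big_mkcond.
rewrite exchange_big big_seq [RHS]big_seq; apply: eq_bigr => x xf.
have Hj : (index (x.2.1, x.2.2.1) wls < m)%N by rewrite index_mem Hwls.
rewrite (bigD1 (Ordinal Hj)) //= /Y /= nth_index ?Hwls // eqxx big1 ?addr0.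
  by rewrite rep_B ?(allP Hf) // mulrA.
move=> i Hij; rewrite ifF //; apply: contraNF Hij => /eqP Ex.
by apply/eqP/val_inj => /=; rewrite Ex index_uniq ?undup_uniq.
Qed.

End Field.

End Independence.

(** * Separation of the exponents by Kronecker substitution *)

Lemma digits_inj D m (A A' : nat -> nat) :
  (forall p, A p < D) -> (forall p, A' p < D) ->
  \sum_(p < m) A p * D ^ p = \sum_(p < m) A' p * D ^ p -> forall p, p < m -> A p = A' p.
Proof.
elim: m A A' => [|m IH] A A' HA HA' //.
have D0 : 0 < D by apply: leq_ltn_trans (HA 0).
have E (a : nat -> nat) : \sum_(p < m.+1) a p * D ^ p = (\sum_(p < m) a p.+1 * D ^ p) * D + a 0.
  rewrite big_ord_recl muln1 addnC big_distrl; congr (_ + _)%N.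
  by apply: eq_bigr => p _; rewrite /= expnSr mulnA.
rewrite !E => H; have H0 : A 0 = A' 0.
  by have := congr1 (modn^~ D) H; rewrite !modnMDl !modn_small.
have H1 : \sum_(p < m) A p.+1 * D ^ p = \sum_(p < m) A' p.+1 * D ^ p.
  by apply/eqP; rewrite -(eqn_pmul2r D0); apply/eqP; move: H; rewrite H0 => /addIn.
case=> // p Hp; apply: (IH (fun p => A p.+1) (fun p => A' p.+1)) => //.
Qed.

Section KroneckerSubstitution.
Variables (b r : nat) (kap : seq nat) (D : nat).
Hypotheses (Hkap : in_P b r kap) (HD : 1 < D).
Let n := b + r.

Definition expo (a : seq nat) : nat :=
  \sum_(i <- iota 0 (size a)) D ^ (blk_pos (stateOf kap) i).+1 * nth 0 a i.

(** Position p carries the label p+1, whence the extra factor D; at a red position the index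
    overflows [a] and the digit is the default 0. *)
Lemma expo_digits a : size a = b ->
  expo a = D * \sum_(p < n) nth 0 a (index (nat_of_ord p) (blacks kap)) * D ^ p.
Proof.
move=> Ha; rewrite big_distrr /=.
rewrite -(big_mkord predT (fun p => D * (nth 0 a (index p (blacks kap)) * D ^ p))).
rewrite /index_iota subn0 (bigID (fun p => p \in blacks kap)) /= [X in _ + X]big1 ?addn0; last first.
  move=> p Hp; rewrite nth_default ?mul0n ?muln0 // Ha -(size_blacks Hkap) leqNgt index_mem //.
have -> : \sum_(p <- iota 0 n | p \in blacks kap) D * (nth 0 a (index p (blacks kap)) * D ^ p)
  = \sum_(p <- blacks kap) D * (nth 0 a (index p (blacks kap)) * D ^ p).
  rewrite -big_filter; apply: perm_big; apply: uniq_perm; rewrite ?filter_uniq ?iota_uniq ?uniq_blacks //.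
  move=> p; rewrite mem_filter mem_iota mem_blacks (size_stateOf Hkap) /=.
  by case: (p < n); rewrite ?andbT ?andbF.
rewrite (big_nth 0) (size_blacks Hkap) /expo Ha /index_iota subn0.
rewrite [LHS]big_seq [RHS]big_seq; apply: eq_bigr => i; rewrite mem_iota /= => Hi.
rewrite index_uniq ?uniq_blacks ?(size_blacks Hkap) // expnS.
by rewrite -[blk_pos _ _]/(nth 0 (blacks kap) i) -mulnA [D ^ _ * _]mulnC.
Qed.

Lemma expo_inj a a' : size a = b -> size a' = b -> all (fun x => x < D) a ->
  all (fun x => x < D) a' -> expo a = expo a' -> a = a'.
Proof.
move=> Ha Ha' HaD HaD'; rewrite !expo_digits // => /eqP; rewrite eqn_pmul2l ?(ltnW HD) // => /eqP E.
have small (c : seq nat) k : all (fun x => x < D) c -> nth 0 c k < D.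
  move=> /allP Hc; case: (ltnP k (size c)) => Hk; first by apply/Hc/mem_nth.
  by rewrite nth_default // ltnW.
apply: (@eq_from_nth _ 0); rewrite ?Ha ?Ha' // => i Hi.
have Hb : nth 0 (blacks kap) i \in blacks kap by rewrite mem_nth // (size_blacks Hkap).
have Hbn : nth 0 (blacks kap) i < n.
  by move: Hb; rewrite mem_blacks (size_stateOf Hkap) => /andP[].
have := @digits_inj D n (fun p => nth 0 a (index p (blacks kap)))
  (fun p => nth 0 a' (index p (blacks kap))) (fun p => small _ _ HaD) (fun p => small _ _ HaD') E _ Hbn.
by rewrite index_uniq ?uniq_blacks ?(size_blacks Hkap).
Qed.

End KroneckerSubstitution.

(** * The integral basis and its base change to an arbitrary ring *)

Section Basis.
Local Open Scope ring_scope.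
Variables (N : seq nat) (b r : nat) (kap rho : seq nat).
Variables (cs : seq nat -> seq nat) (plan : seq nat -> seq bool -> seq (nat * nat)).
Hypotheses (Hkap : in_P b r kap) (Hrho : in_P b r rho).
Hypothesis Hcs : forall w, in_S kap rho w -> left_adjusted (b + r) w (cs w).
Hypothesis Hplan : forall w l, in_S kap rho w -> size l = b ->
  nail_plan_ok kap w (cs w) l (plan w l).

Let sr := stateOf rho.
Let sk := stateOf kap.
Let B (t : idx) : word := (sr, bgens kap cs plan t).

Lemma int_indep (f : seq (int * idx)) : all (fun x => in_B b kap rho x.2) f ->
  in_ideal N [seq (x.1, B x.2) | x <- f] ->
  forall t, \sum_(x <- f | x.2 == t) x.1 = 0.
Proof.
move=> Hf HI t; have [/mapP[x0 x0f Et]|Ht] := boolP (t \in map snd f); last first.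
  rewrite big_seq_cond big1 // => x /andP[xf /eqP E].
  by case/negP: Ht; rewrite -E map_f.
(* Larger than every exponent in [f], and than 1 even when all of them vanish. *)
pose D := (\max_(x <- f) \max_(k <- x.2.2.2) k).+2.
have HD x : x \in f -> all (fun k => k < D)%N x.2.2.2.
  move=> xf; apply/allP => k ka; rewrite /D !ltnS leqW //.
  have H1 : (k <= \max_(k0 <- x.2.2.2) k0)%N by apply: leq_bigmax_seq.
  apply: leq_trans H1 _.
  exact: (@leq_bigmax_seq _ _ xpredT (fun x : int * idx => \max_(k0 <- x.2.2.2) k0)%N).
have D1 : (1 < D)%N by [].
(* The monomial [mon] becomes X to the power [expo], whose base-D digits are the exponents; the
   fraction field allows the divided differences. *)
pose z (k : nat) : {fraction {poly int}} := tofrac 'X^(D ^ k).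
have z_inj : injective z.
  move=> k k' /eqP; rewrite tofrac_eq => /eqP/(congr1 (fun p : {poly int} => size p)).
  by rewrite !size_polyXn => -[/eqP]; rewrite eqn_exp2l // => /eqP.
have z_neq0 k : z k != 0 by rewrite tofrac_eq0 -size_poly_eq0 size_polyXn.
have monE a : mon kap z a = tofrac 'X^(expo kap D a).
  rewrite /mon /expo; elim: (iota 0 _) => [|i s IH]; first by rewrite !big_nil expr0 rmorph1.
  by rewrite !big_cons IH /z exprD rmorphM /= !rmorphXn exprM.
have := rep_indep Hkap Hrho Hcs Hplan z_inj z_neq0 Hf HI (t.1, t.2.1).
pose P := \sum_(x <- f | (x.2.1, x.2.2.1) == (t.1, t.2.1)) x.1%:~R * 'X^(expo kap D x.2.2.2) : {poly int}.
have -> : \sum_(x <- f | (x.2.1, x.2.2.1) == (t.1, t.2.1)) x.1%:~R * mon kap z x.2.2.2 = tofrac P.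
  by rewrite rmorph_sum; apply: eq_bigr => x _; rewrite /= rmorphM rmorph_int monE.
(* By [expo_inj], among the terms with this (w,l) only those of index t contribute to the
   coefficient extracted here. *)
move=> /eqP; rewrite tofrac_eq0 => /eqP /(congr1 (fun p : {poly int} => p`_(expo kap D t.2.2))).
rewrite coef0 coef_sum => E; rewrite -[RHS]E [RHS]big_mkcond [LHS]big_mkcond.
rewrite [LHS]big_seq [RHS]big_seq; apply: eq_bigr => x xf.
rewrite mulrzl coefMrz coefXn.
have [Ex|Hx] := eqVneq x.2 t; first by rewrite Ex !eqxx intz.
case: ifP => // /eqP[E1 E2]; case: eqP => E3; last by rewrite mul0rz.
case/eqP: Hx; have [_ _ Hs] := in_BP (allP Hf _ xf).
have [_ _ Hs0] := in_BP (allP Hf _ x0f).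
move: E1 E2 E3 Et (HD _ x0f); rewrite /= => E1 E2 E3 Et HDt; rewrite -Et in Hs0 HDt.
have E4 := expo_inj Hkap D1 Hs0 Hs HDt (HD _ xf) E3.
by case: (x.2) E1 E2 E4 => w [l a] /=; case: (t) => w' [l' a'] /= -> -> ->.
Qed.

Lemma spanning_idx (R : comPzRingType) gs : run sr gs = Some sk -> exists f : seq (R * idx),
  all (fun x => in_B b kap rho x.2) f /\
  congT N [:: (1, (sr, gs))] [seq (x.1, B x.2) | x <- f].
Proof.
move=> Hrun; have [f [Hf Hc]] := spanning R N Hkap Hrho Hcs Hplan Hrun.
suff [g [Hg E]] : exists g : seq (R * idx), all (fun x => in_B b kap rho x.2) g /\
    emb sr f = [seq (x.1, B x.2) | x <- g] by exists g; rewrite -E.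
elim: f Hf {Hc} => [|x f IH] H; first by exists [::].
have [g [Hg E]] := IH (fun y yf => H y (mem_behead (s := x :: f) yf)).
have [[t Ht Ex] _] := H x (mem_head _ _).
exists ((x.1, t) :: g); split; first by rewrite /= Ht.
by rewrite /= -E Ex.
Qed.

Section Transfer.
Variable F : seq gen -> seq (int * idx).
Hypothesis HF : forall gs, run sr gs = Some sk -> all (fun x => in_B b kap rho x.2) (F gs) /\
  congT N [:: (1, (sr, gs))] [seq (x.1, B x.2) | x <- F gs].
Variable t : idx.

(** The t-th coordinate of a diagram, through an arbitrary choice [F] of integral expansions;
    independence over the integers makes it compatible with the relations. *)
Definition phi (D : word) : int :=
  if (D.1 == sr) && (run sr D.2 == Some sk) then \sum_(x <- F D.2 | x.2 == t) x.1 else 0.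

Lemma phi_ideal (f : seq (int * word)) : homog sr sk f -> in_ideal N f ->
  \sum_(x <- f) x.1 * phi x.2 = 0.
Proof.
move=> Hf HI; pose g := flatten [seq [seq (x.1 * y.1, y.2) | y <- F x.2.2] | x <- f].
have Hg : all (fun x => in_B b kap rho x.2) g.
  apply/allP => y /flattenP[s /mapP[x /Hf[_ Hx] ->] /mapP[y' Hy' ->]] /=.
  by have [/allP H _] := HF Hx; apply: H.
have C : congT N f [seq (x.1, B x.2) | x <- g].
  rewrite /g; elim: f Hf {HI g Hg} => [|x f IH] Hf; first exact: congT_refl.
  have {}IH := IH (fun y yf => Hf y (mem_behead (s := x :: f) yf)).
  have [E1 Hx] := Hf x (mem_head _ _); have [_ Cx] := HF Hx.
  have := congT_add (congT_scale x.1 Cx) IH.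
  rewrite /= map_cat /fscale -!map_comp /= mulr1 -{1}E1.
  by case: (x) => a [s' w'] /=; exact.
have := int_indep Hg (congT_ideal C HI) t => E; rewrite -[RHS]E.
rewrite big_flatten big_map /= [LHS]big_seq [RHS]big_seq; apply: eq_bigr => x xf.
have [E1 Hx] := Hf x xf; rewrite /phi E1 Hx !eqxx big_distrr big_map /=.
by [].
Qed.

(** The difference between a basis diagram and its chosen expansion lies in the ideal, so
    [int_indep] determines its coordinates. *)
Lemma phi_B t' : in_B b kap rho t' -> phi (B t') = (t' == t)%:R.
Proof.
move=> Ht'; have Hrun := run_bgens Hkap Hrho Hcs Hplan Ht'.
have [Hall HC] := HF Hrun; rewrite /phi /= Hrun !eqxx /=.
set f := F _ in Hall HC *.
have Hg : all (fun x => in_B b kap rho x.2) ((1, t') :: [seq (- x.1, x.2) | x <- f]).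
  by rewrite /= Ht' all_map.
have HI : in_ideal N [seq (x.1, B x.2) | x <- (1, t') :: [seq (- x.1, x.2) | x <- f] : seq (int * idx)].
  move: HC; rewrite /congT /fscale /= -!map_comp.
  by congr (in_ideal N (_ :: _)); apply: eq_map => x /=; rewrite mulN1r.
have := int_indep Hg HI t; rewrite big_cons big_map /= sumrN.
case: eqP => _ /eqP; first by rewrite subr_eq0 => /eqP <-.
by rewrite oppr_eq0 => /eqP.
Qed.

Variable R : comPzRingType.

(** The coefficients are all 1 or -1, so each relation over [R] is the image of an integral one;
    this lets the integral functional [phi] descend to the algebra over [R]. *)
Lemma rel_lift (q : seq (R * word)) : klrw_rel N q ->
  exists2 q' : seq (int * word), klrw_rel N q' & q = [seq (x.1%:~R, x.2) | x <- q'].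
Proof.
case=> {q}.
- by move=> s j H1 H2; eexists; [exact: r_ccBB H1 H2|].
- by move=> s j H1 H2; eexists; [exact: r_nh1 H1 H2|].
- by move=> s j H1 H2; eexists; [exact: r_nh2 H1 H2|].
- by move=> s j H1 H2 H3; eexists; [exact: r_braidBBB H1 H2 H3|].
- by move=> s j i H1 H2; eexists; [exact: r_dotBR H1 H2|].
- by move=> s j i H1 H2; eexists; [exact: r_dotRB H1 H2|].
- by move=> s j i H1 H2; eexists; [exact: r_ccBR H1 H2|].
- by move=> s j i H1 H2; eexists; [exact: r_ccRB H1 H2|].
- by move=> s j i H1 H2 H3; eexists; [exact: r_braidRBB H1 H2 H3|].
- by move=> s j i H1 H2 H3; eexists; [exact: r_braidBBR H1 H2 H3|].
- move=> s j i H1 H2 H3; eexists; [exact: r_braidBRB H1 H2 H3|].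
  by rewrite /= -map_comp.
- by move=> s H1; eexists; [exact: r_nailDot H1|].
- by move=> s H1; eexists; [exact: r_nail2 H1|].
- by move=> s H1 H2; eexists; [exact: r_nailCr H1 H2|].
by move=> s g h H1 H2; eexists; [exact: r_far H1 H2|].
Qed.

Lemma psi_ideal (f : seq (R * word)) : in_ideal N f ->
  \sum_(x <- f) x.1 * (phi x.2)%:~R = 0.
Proof.
elim=> {f} [|u q v Hq Hu Hv|f g _ If _ Ig|a f _ If|f g E _ If].
- by rewrite big_nil.
- have [q' Hq' Eq] := rel_lift Hq; have [s' [t' H']] := rel_homog Hq'.
  have H : homog s' t' q by rewrite Eq => x /mapP[y /H' Hy ->].
  case Hm: ((top v == Some s') && (u.1 == t')); last by rewrite (fmul_mismatch H Hm) big_nil.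
  case/andP: Hm => /eqP Htv /eqP Hut; have HI := I_gen Hq' Hu Hv.
  move: HI Htv Hu Hv; rewrite (_ : u = (t', u.2)); last by rewrite -Hut; case: (u).
  rewrite (_ : v = (v.1, v.2)); last by case: (v).
  move: (u.2) (v.1) (v.2) => us s vs HI Htv Hu Hv {u v Hut}.
  rewrite (fmul_homog us H) // big_map /=; rewrite (fmul_homog us H') // in HI.
  (* If the ends are not the two idempotents, [phi] vanishes on every term; otherwise the integral
     version of the generator is a homogeneous element to which [phi_ideal] applies. *)
  case Hs: ((s == sr) && (run t' us == Some sk)); last first.
    rewrite big_seq big1 // => x /H[_ Hx]; rewrite /phi /=.
    case: (s =P sr) Hs => [Es|_] /= Hs; last by rewrite mulr0.
    by rewrite -Es run_cat; move: Htv; rewrite /top /= => ->; rewrite run_cat Hx Hs mulr0.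
  case/andP: Hs => /eqP Es /eqP Hus; rewrite Es in HI Htv *.
  have Hh : homog sr sk [seq (x.1, (sr, vs ++ x.2.2 ++ us)) | x <- q'].
    move=> x /mapP[y /H'[_ Hy] ->] /=; split=> //.
    by rewrite run_cat; move: Htv; rewrite /top /= => ->; rewrite run_cat Hy.
  have := phi_ideal Hh HI; rewrite big_map /= => /(congr1 (fun k : int => k%:~R : R)).
  rewrite Eq big_map rmorph_sum /= => E; rewrite -[RHS]E.
  by apply: eq_bigr => x _; rewrite intrM.
- by rewrite big_cat /= If Ig addr0.
- rewrite big_map /=; transitivity (a * \sum_(x <- f) x.1 * (phi x.2)%:~R).
    by rewrite big_distrr; apply: eq_bigr => x _ /=; rewrite mulrA.
  by rewrite If mulr0.
rewrite -[RHS]If; apply/esym.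
apply: (fcoef_ext (F := fun D (a : R) => a * (phi D)%:~R)) => // [D|D a a'].
  by rewrite mul0r.
by rewrite mulrDl.
Qed.

Lemma transfer (f : seq (R * idx)) : all (fun x => in_B b kap rho x.2) f ->
  in_ideal N [seq (x.1, B x.2) | x <- f] -> \sum_(x <- f | x.2 == t) x.1 = 0.
Proof.
move=> Hf /psi_ideal; rewrite big_map /= => E; rewrite -[RHS]E big_mkcond.
rewrite big_seq [RHS]big_seq; apply: eq_bigr => x xf.
by rewrite phi_B ?(allP Hf) //; case: eqP; rewrite ?mulr1 ?mulr0.
Qed.

End Transfer.

End Basis.

Theorem theorem3p11 (R : comPzRingType) (b r : nat) (N : seq nat)
    (kap rho : seq nat)
    (cs : seq nat -> seq nat)
    (plan : seq nat -> seq bool -> seq (nat * nat)) :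
  size N = r -> in_P b r kap -> in_P b r rho ->
  (forall w, in_S kap rho w -> left_adjusted (b + r) w (cs w)) ->
  (forall w l, in_S kap rho w -> size l = b ->
     nail_plan_ok kap w (cs w) l (plan w l)) ->
  let B (t : idx) : word := bword kap rho t.1 (cs t.1) (plan t.1 t.2.1) t.2.2 in
  (* each b_{w,l,a} is a diagram in 1_kappa T 1_rho *)
  (forall t, in_B b kap rho t -> valid (B t) /\ top (B t) = Some (stateOf kap)) /\
  (* spanning *)
  (forall D : word, valid D -> D.1 = stateOf rho -> top D = Some (stateOf kap) ->
     exists f : seq (R * idx),
       all (fun x => in_B b kap rho x.2) f /\
       congT N [:: (1%R, D)] [seq (x.1, B x.2) | x <- f]) /\
  (* linear independence *)
  (forall f : seq (R * idx),
     all (fun x => in_B b kap rho x.2) f ->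
     in_ideal N [seq (x.1, B x.2) | x <- f] ->
     forall t, (\sum_(x <- f | x.2 == t) x.1)%R = 0%R).
Proof.
move=> _ Hkap Hrho Hcs Hplan B; split; last split.
- move=> t Ht; have E := run_bgens Hkap Hrho Hcs Hplan Ht.
  by rewrite /valid /top /= -[run _ _]/(run (stateOf rho) (bgens kap cs plan t)) E.
- move=> [s gs] _ /= -> Hrun; exact: (spanning_idx N Hkap Hrho Hcs Hplan R Hrun).
move=> f Hf HI t.
(* Words with other ends receive the empty list, so that an expansion exists for every word and a
   choice function can be formed. *)
have HF gs : exists g : seq (int * idx), run (stateOf rho) gs = Some (stateOf kap) ->
    all (fun x => in_B b kap rho x.2) g /\
    congT N [:: (1%R, (stateOf rho, gs))]
      [seq (x.1, (stateOf rho, bgens kap cs plan x.2)) | x <- g].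
  case: (run (stateOf rho) gs =P Some (stateOf kap)) => [E|NE]; last by exists [::].
  by have [g Hg] := spanning_idx N Hkap Hrho Hcs Hplan int E; exists g.
pose F gs := sval (ClassicalEpsilon.constructive_indefinite_description _ (HF gs)).
have HFs gs := svalP (ClassicalEpsilon.constructive_indefinite_description _ (HF gs)).
exact: (transfer Hkap Hrho Hcs Hplan HFs t Hf HI).
Qed.
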